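(* Let $\alpha\in(0,1)$. For each $N$ let $u^N$ solve $$\partial_tu^N=L^N_{a(t)}u^N+g(t,\tfrac xN)\quad\text{on }[0,T]\times\tfrac1N\mathbb T_N^n,$$ with $a(t)$ and $g(t,\cdot)$ continuous in $t$, and assume, with constants independent of $N$: (A.1) $a(t)\in\mathcal A(c_-,c_+)$ for all $t$; (A.2) $[a]^{*,N}_\alpha\le A<\infty$; (A.3) $\|g\|_\infty\le G_\infty<\infty$; and $\sup_N\|u^N\|_\infty<\infty$, where $\|u^N\|_\infty=\sup_{[0,T]\times\frac1N\mathbb T^n_N}|u^N|$. Then $$|\tilde u^N|^*_{1+\alpha}\le C\big[(A+1)^{1+\frac1\alpha}\|u^N\|_\infty+G_\infty\big].$$ In particular, for all $|e|=1$, $t\in(0,T]$, $x\in\mathbb T^n_N$, $$|\nabla^N_eu^N(t,\tfrac xN)|\le C\,t^{-\frac12}\big[(A+1)^{\frac1\alpha}\|u^N\|_\infty+(A+1)^{-1}G_\infty\big].$$ Here $C=C(n,c_\pm,T,\alpha)$ (independent of $N$).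
   Context: Lattice notation. $N\in\mathbb N$, $T>0$ fixed, $\mathbb T^n=\mathbb R^n/\mathbb Z^n$, $\mathbb T_N^n=(\mathbb Z/N\mathbb Z)^n$; functions on $\frac1N\mathbb T^n_N\subset\mathbb T^n$ are written $u(\frac xN)$. For $e\in\mathbb Z^n$, $|e|=1$: $\nabla_e^Nu(\frac xN)=N(u(\frac{x+e}N)-u(\frac xN))$. ''$e>0$'' means that the nonzero component of $e$ is $1$. Operators. For $0<c_-<c_+<\infty$, $\mathcal A(c_-,c_+)$ is the set of $a=\{a_{x,e}\}_{x\in\mathbb T_N^n,|e|=1}$ with $a_{x,e}=a_{x+e,-e}$ and $c_-\le a_{x,e}\le c_+$. $L^N_au(\frac xN)=N^2\sum_{|e|=1}a_{x,e}\{u(\frac{x+e}N)-u(\frac xN)\}$. Norms. $\Omega=[0,T]\times\mathbb T^n$, $\Omega_N=[0,T]\times\frac1N\mathbb T_N^n$. For $X=(t,z)$, $Y=(s,y)$: $|X-Y|=\max\{|t-s|^{1/2},|z-y|\}$ with $|z-y|$ the Euclidean distance on the torus, and $d(X)=\sqrt t$. For $F$ on $\Omega$, $\nabla^N_eF(t,z)=N(F(t,z+\frac eN)-F(t,z))$, and $|\nabla^NF(X)-\nabla^NF(Y)|=\max_{|e|=1,e>0}|\nabla^N_eF(X)-\nabla_e^NF(Y)|$. The polylinear interpolation in space of a function $u$ on $\Omega_N$ is $\tilde u(t,z)=\sum_{v\in\{0,1\}^n}\prod_{i=1}^n\vartheta(v_i,z_i)\,u(t,\frac{[Nz]+v}N)$,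 where $\vartheta(1,b)=\{Nb\}$, $\vartheta(0,b)=1-\{Nb\}$ and $[\cdot],\{\cdot\}$ are (componentwise) integer and fractional parts. $[a]^{*,N}_\alpha\le A$ means: for each $|e|=1$, writing $a_e(t,\frac xN)=a_{x,e}(t)$, $\sup_{X\ne Y\in\Omega_N}(d(X)\wedge d(Y))^\alpha\frac{|a_e(X)-a_e(Y)|}{|X-Y|^\alpha}\le A$. $\|g\|_\infty=\sup_{\Omega_N}|g|$. $[F]^*_{1+\alpha}=\sup_{X\ne Y\in\Omega}(d(X)\wedge d(Y))^{1+\alpha}\frac{|\nabla^NF(X)-\nabla^NF(Y)|}{|X-Y|^\alpha}$; $\langle u\rangle^{*,N}_{1+\alpha}=\sup(d(X)\wedge d(Y))^{1+\alpha}\frac{|u(X)-u(Y)|}{|t-s|^{(1+\alpha)/2}}$ over $X=(t,\frac xN)\neq Y=(s,\frac xN)$ in $\Omega_N$ with the same spatial coordinate; $|\nabla^NF|_0^{(1)}=\max_{|e|=1,e>0}\sup_{X\in\Omega}d(X)|\nabla^N_eF(X)|$; $|\tilde u^N|^*_{1+\alpha}=[\tilde u^N]^*_{1+\alpha}+\langle u^N\rangle^{*,N}_{1+\alpha}+|\nabla^N\tilde u^N|^{(1)}_0$. *)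

(* Defs.v *)
From HB Require Import structures.
From mathcomp Require Import all_boot all_order all_algebra.
From mathcomp Require Import all_classical all_reals all_analysis.

Set Implicit Arguments.
Unset Strict Implicit.
Unset Printing Implicit Defensive.

Import Order.TTheory GRing.Theory Num.Theory.
Import numFieldNormedType.Exports.

Local Open Scope classical_set_scope.
Local Open Scope ring_scope.

(* Meaningful for 0 < N only; 'I_N.-1.+1 (and not 'Z_N) so that N = 1 gives the
   one-point lattice. *)
Definition lattice (N n : nat) := 'rV['I_N.-1.+1]_n.

Definition lattice_of_int (N n : nat) (k : 'rV[int]_n) : lattice N n :=
  \row_i inZp `|(k ord0 i %% N%:Z)%Z|%N.

(* The vectors e of Z^n with |e| = 1, encoded as (index of the nonzero
   coordinate, whether it is +1 or -1).  They are kept distinct even when they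
   coincide modulo N (N <= 2), so that a sum over them has 2n terms. *)
Definition dir (n : nat) := ('I_n * bool)%type.

Definition dir_vec n (e : dir n) : 'rV[int]_n :=
  (if e.2 then 1 else -1) *: delta_mx ord0 e.1.
Definition dir_opp n (e : dir n) : dir n := (e.1, ~~ e.2).
Definition dir_pos n (e : dir n) : bool := e.2.

Definition shift N n (x : lattice N n) (e : dir n) : lattice N n :=
  x + lattice_of_int N (dir_vec e).

Section Defs.
Context {R : realType}.
Implicit Types (T alpha : R) (N n : nat).

Definition conductance N n := lattice N n -> dir n -> R.

Definition elliptic N n (cm cp : R) (a : conductance N n) : Prop :=
  (forall x e, a x e = a (shift x e) (dir_opp e)) /\
  (forall x e, cm <= a x e <= cp).

Definition generator N n (a : conductance N n) (u : lattice N n -> R)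
    (x : lattice N n) : R :=
  N%:R ^+ 2 * \sum_(e : dir n) a x e * (u (shift x e) - u x).

Definition lattice_grad N n (e : dir n) (u : lattice N n -> R)
    (x : lattice N n) : R :=
  N%:R * (u (shift x e) - u x).

(* One-sided at the endpoints when D is a closed interval. *)
Definition has_derivative_within (D : set R) (f : R -> R) (t l : R) : Prop :=
  (f s - f t) / (s - t) @[s --> within D t^'] --> l.

Definition solves N n T (a : R -> conductance N n)
    (g u : R -> lattice N n -> R) : Prop :=
  forall (t : R) (x : lattice N n), t \in `[0, T] ->
    has_derivative_within `[0, T] (fun s => u s x) t
      (generator (a t) (u t) x + g t x).

(* Space-time points (t, z); z in R^n represents its class in R^n / Z^n, and
   functions on the torus are Z^n-periodic functions of z (see
   interp_periodic below). *)
Definition stpoint n := (R * 'rV[R]_n)%type.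

Definition enorm n (z : 'rV[R]_n) : R := Num.sqrt (\sum_i z ord0 i ^+ 2).

Definition torus_dist n (z y : 'rV[R]_n) : R :=
  inf [set enorm (z - y + map_mx intr k) | k in [set: 'rV[int]_n]].

Definition same_point n (X Y : stpoint n) : Prop :=
  X.1 = Y.1 /\ exists k : 'rV[int]_n, X.2 - Y.2 = map_mx intr k.

Definition st_dist n (X Y : stpoint n) : R :=
  Num.max (Num.sqrt `|X.1 - Y.1|) (torus_dist X.2 Y.2).

Definition st_d n (X : stpoint n) : R := Num.sqrt X.1.

Definition Omega n T : set (stpoint n) := [set X | X.1 \in `[0, T]].

Definition lattice_Omega N n T : set (R * lattice N n) :=
  [set X | X.1 \in `[0, T]].

Definition embed N n (X : R * lattice N n) : stpoint n :=
  (X.1, \row_i ((X.2 ord0 i : nat)%:R / N%:R)).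

Definition cont_grad N n (e : dir n) (F : stpoint n -> R) (X : stpoint n) : R :=
  N%:R * (F (X.1, X.2 + N%:R^-1 *: map_mx intr (dir_vec e)) - F X).

Definition grad_diff N n (F : stpoint n -> R) (X Y : stpoint n) : R :=
  \big[Num.max/0]_(e : dir n | dir_pos e)
    `|cont_grad N e F X - cont_grad N e F Y|.

Definition theta N (v : bool) (b : R) : R :=
  let frac := N%:R * b - (Num.floor (N%:R * b))%:~R in
  if v then frac else 1 - frac.

Definition interp N n (u : R -> lattice N n -> R) (X : stpoint n) : R :=
  \sum_(v : {ffun 'I_n -> bool})
    (\prod_i theta N (v i) (X.2 ord0 i)) *
    u X.1 (lattice_of_int N
             (\row_i (Num.floor (N%:R * X.2 ord0 i) + (v i : nat)%:Z))).

Local Open Scope ereal_scope.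

Definition sup_norm N n T (u : R -> lattice N n -> R) : \bar R :=
  ereal_sup [set `|u X.1 X.2|%:E | X in @lattice_Omega N n T].

Definition coef_seminorm N n T alpha (a : R -> conductance N n) (e : dir n)
    : \bar R :=
  ereal_sup [set r | exists X Y : R * lattice N n,
    [/\ lattice_Omega T X, lattice_Omega T Y, X <> Y &
     r = (Num.min (st_d (embed X)) (st_d (embed Y)) `^ alpha *
          (`|a X.1 X.2 e - a Y.1 Y.2 e| /
             st_dist (embed X) (embed Y) `^ alpha))%R%:E]].

Definition grad_seminorm N n T alpha (F : stpoint n -> R) : \bar R :=
  ereal_sup [set r | exists X Y : stpoint n,
    [/\ Omega T X, Omega T Y, ~ same_point X Y &
     r = (Num.min (st_d X) (st_d Y) `^ (1 + alpha) *
          (grad_diff N F X Y / st_dist X Y `^ alpha))%R%:E]].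

Definition time_seminorm N n T alpha (u : R -> lattice N n -> R) : \bar R :=
  ereal_sup [set r | exists (t s : R) (x : lattice N n),
    [/\ t \in `[0%R, T], s \in `[0%R, T], t <> s &
     r = (Num.min (st_d (embed (t, x))) (st_d (embed (s, x))) `^ (1 + alpha) *
          (`|u t x - u s x| / `|t - s| `^ ((1 + alpha) / 2)))%R%:E]].

Definition grad_sup N n T (F : stpoint n -> R) : \bar R :=
  \big[maxe/-oo]_(e : dir n | dir_pos e)
    ereal_sup [set (st_d X * `|cont_grad N e F X|)%R%:E | X in @Omega n T].

Definition full_norm N n T alpha (u : R -> lattice N n -> R) : \bar R :=
  grad_seminorm N T alpha (interp u) + time_seminorm T alpha u
  + grad_sup N T (interp u).

End Defs.

Lemma interp_periodic (R : realType) N n (u : R -> lattice N n -> R) (t : R)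
    (z : 'rV[R]_n) (k : 'rV[int]_n) : (0 < N)%N ->
  interp u (t, z + map_mx intr k) = interp u (t, z).
Proof.
move=> N0.
have E i : N%:R * (z + map_mx intr k) ord0 i =
   N%:R * z ord0 i + (N%:Z * k ord0 i)%:~R :> R.
  by rewrite !mxE mulrDr intrM.
have F i : Num.floor (N%:R * (z + map_mx intr k) ord0 i) =
   Num.floor (N%:R * z ord0 i) + N%:Z * k ord0 i.
  by rewrite E floorDrz ?intr_int // intrKfloor.
apply: eq_bigr => v _ /=; congr (_ * u t _).
  apply: eq_bigr => i _; rewrite /theta F E intrD opprD addrACA subrr addr0.
  by [].
apply/rowP => i; rewrite !mxE; congr (inZp `|_|%N).
have := F i; rewrite !mxE => ->.
by rewrite addrAC (mulrC N%:Z) addrC modzMDl.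
Qed.

Lemma interp_node (R : realType) N n (u : R -> lattice N n -> R) (t : R)
    (x : lattice N n) : (0 < N)%N -> interp u (embed (t, x)) = u t x.
Proof.
move=> N0.
have Nn : N%:R != 0 :> R by rewrite pnatr_eq0 -lt0n.
have E i : N%:R * (embed (t, x)).2 ord0 i = (x ord0 i : nat)%:R :> R.
  by rewrite mxE mulrC divfK.
have F i : Num.floor (N%:R * (embed (t, x)).2 ord0 i : R) = (x ord0 i : nat)%:Z.
  by rewrite E -[_%:R]/((_%:Z)%:~R) intrKfloor.
rewrite /interp (bigD1 [ffun=> false]) //= [X in _ + X]big1 => [|v vN].
  rewrite addr0 big1 ?mul1r => [|i _]; last first.
    by rewrite ffunE /theta F E subrr subr0.
  congr (u t _); apply/rowP => i; rewrite mxE; apply/val_inj => /=.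
  rewrite mxE F ffunE addr0 modz_nat absz_nat.
  have xN : (x ord0 i < N)%N by rewrite -[X in (_ < X)%N](prednK N0) ltn_ord.
  by rewrite (modn_small xN) modn_small.
have [i vi] : exists i, v i.
  apply/existsP; apply: contraR vN; rewrite negb_exists => /forallP H.
  by apply/eqP/ffunP => i; rewrite ffunE; apply/negbTE.
by rewrite (bigD1 i) //= vi /theta F E subrr !mul0r.
Qed.

(* Main.v *)
(* The coefficients are frozen at a space-time point, and u is compared with the
   semigroup P of the frozen, translation-invariant generator: the derivative of
   s |-> P_{t-s} u(s) is P_{t-s} applied to a discrete divergence of
   (a - a_frozen) grad u, plus P_{t-s} g. The semigroup obeys the pointwise
   reverse Poincare inequality cm s |grad P_s f|^2 <= P_s(f^2), and it moves the
   squared distance by at most C s; together they bound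
   |grad^j P_s(dist^alpha grad u)| by s^{(alpha-j)/2} sup |grad u| at the
   freezing point, uniformly in N and at all scales, without any pointwise heat
   kernel estimate.

   Run over a time theta^2 t with theta ~ (A+1)^{-1/alpha}, this perturbation is
   a small multiple of sup sqrt(t) |grad u| and can be absorbed, which is the
   gradient bound. For the Hoelder bounds at scale r, both points are compared
   with frozen semigroups started a time r^2 earlier, whose second and third
   differences are controlled by the same computation; since the two semigroups
   then act on one and the same function with bounded gradient, exchanging the
   frozen coefficients costs only their difference, and no singular integral
   appears. Time integrals are replaced by the mean value inequality with power
   functions as majorants. *)

Require Import Defs.
From HB Require Import structures.
From mathcomp Require Import all_boot all_order all_algebra.
From mathcomp Require Import all_classical all_reals all_analysis.
From mathcomp Require Import ring lra.

Set Implicit Arguments.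
Unset Strict Implicit.
Unset Printing Implicit Defensive.

Import Order.TTheory GRing.Theory Num.Theory.
Import numFieldNormedType.Exports.

Local Open Scope classical_set_scope.
Local Open Scope ring_scope.

(** * Calculus of finite sums and mean value inequalities *)

(** The number of differences decides how a comparison can be run. Frozen at its end point, the
    drift carries under one difference the power [alpha / 2 - 1] of the remaining time, which is
    integrable up to the end. Under two or three differences the power is below -1; the comparison
    must stop a time of order r^2 before the end, and its size is then set by the last moment and
    not by the starting time. If a gradient increment were computed with the same frozen
    coefficients at both ends, one end would meet the power -1 and a logarithm; this is why
    coefficients are exchanged. Time increments of u itself meet only the power -1/2 and need no
    exchange.

    The powers of A + 1 are powers of the scale: theta^(-1) gives the exponent 1/alpha of the
    gradient bound, theta^(-(1+alpha)) gives 1 + 1/alpha, and so does A + 1 times the gradient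
    bound. Regularity is needed only at distances below theta sqrt(t); beyond that the gradient
    bound or the sup norm of u suffices. *)

Lemma cvg_finsum (R : realType) (T : Type) (F : set_system T) (FF : Filter F)
    (I : finType) (f : I -> T -> R) (l : I -> R) :
  (forall i, f i x @[x --> F] --> l i) ->
  (\sum_i f i x) @[x --> F] --> \sum_i l i.
Proof.
move=> fl.
have -> : (fun x => \sum_i f i x) = \sum_i f i.
  by apply/funext => x; rewrite fct_sumE.
by elim/big_ind2 : _ => [|g k h m *|i _]; [exact: cvg_cst|exact: cvgD|exact: fl].
Qed.

Lemma is_derive_finsum (R : realType) (I : finType) (f : I -> R -> R)
    (df : I -> R) (x : R) :
  (forall i, is_derive x 1 (f i) (df i)) ->
  is_derive x 1 (fun s => \sum_i f i s) (\sum_i df i).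
Proof.
move=> dfi.
have -> : (fun x => \sum_i f i x) = \sum_i f i.
  by apply/funext => s; rewrite fct_sumE.
by elim/big_ind2 : _ => [|g k h m *|i _];
  [exact: is_derive_cst|exact: is_deriveD|exact: dfi].
Qed.

Lemma is_derive_mul (R : realType) (f g : R -> R) (df dg x : R) :
  is_derive x 1 f df -> is_derive x 1 g dg ->
  is_derive x 1 (fun s => f s * g s) (df * g x + f x * dg).
Proof.
move=> hf hg; apply: is_derive_eq (is_deriveM hf hg) _.
by rewrite /GRing.scale /= [g x * _]mulrC addrC.
Qed.

Lemma is_derive_scale (R : realType) (c : R) (g : R -> R) (dg x : R) :
  is_derive x 1 g dg -> is_derive x 1 (fun s => c * g s) (c * dg).
Proof. by move=> hg; apply: is_derive_eq (is_deriveZ c hg) _. Qed.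

Lemma is_derive_lin (R : realType) (f g : R -> R) (c d df dg x : R) :
  is_derive x 1 f df -> is_derive x 1 g dg ->
  is_derive x 1 (fun s => c * f s + d * g s) (c * df + d * dg).
Proof.
move=> hf hg; apply: is_derive_eq (is_deriveD (is_derive_scale c hf) (is_derive_scale d hg)) _.
by [].
Qed.

Lemma is_derive_sub (R : realType) (f g : R -> R) (df dg x : R) :
  is_derive x 1 f df -> is_derive x 1 g dg ->
  is_derive x 1 (fun s => f s - g s) (df - dg).
Proof. by move=> hf hg; apply: is_derive_eq (is_deriveB hf hg) _. Qed.

Lemma is_derive_refl (R : realType) (t : R) (g : R -> R) (dg x : R) :
  is_derive (t - x) 1 g dg -> is_derive x 1 (fun s => g (t - s)) (- dg).
Proof.
move=> hg; have h : is_derive x 1 (fun s : R => t - s) (-1).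
  by apply: is_derive_eq (is_deriveB (is_derive_cst t x 1) (is_derive_id x 1)) _;
     rewrite sub0r.
by apply: is_derive_eq (@is_derive1_comp R g (fun s => t - s) x dg (-1) hg h) _; rewrite mulrN1.
Qed.

Lemma is_derive_continuous_at (R : realType) (f : R -> R) (df x : R) :
  is_derive x (1 : R) f df -> {for x, continuous f}.
Proof.
by move=> hf; apply/differentiable_continuous/derivable1_diffP; exact: ex_derive.
Qed.

Lemma sub_le_derive (R : realType) (f df : R -> R) (c a b : R) : a <= b ->
  (forall x, x \in `[a, b] -> is_derive x (1 : R) f (df x)) ->
  (forall x, x \in `[a, b] -> df x <= c) -> f b - f a <= c * (b - a).
Proof.
move=> ab hf hc.
have hoo x : x \in `]a, b[ -> is_derive x (1 : R) f (df x).
  by move=> xab; apply: hf; exact: subset_itv_oo_cc.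
have cf : {within `[a, b], continuous f}.
  by apply: derivable_within_continuous => x /hf h; exact: ex_derive.
have [x xab E] := MVT_segment ab hoo cf.
by rewrite E ler_wpM2r ?subr_ge0// hc.
Qed.

(** The half-open interval and the mere left limit at [b] serve two cases: majorants [F] whose
    derivative blows up at [b], and solutions that have only a one-sided derivative at the final
    time. *)
Lemma norm_sub_le_derive (R : realType) (f df F dF : R -> R) (B a b : R) : a < b ->
  (forall x, x \in `[a, b[ -> is_derive x (1 : R) f (df x)) ->
  (forall x, x \in `[a, b[ -> is_derive x (1 : R) F (dF x)) ->
  (forall x, x \in `[a, b[ -> `|df x| <= dF x) ->
  f x @[x --> b^'-] --> f b ->
  (forall x, x \in `[a, b[ -> F x - F a <= B) -> `|f b - f a| <= B.
Proof.
move=> ab hf hF hdf fb FB.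
have key x : x \in `[a, b[ -> `|f x - f a| <= B.
  move=> xab; have /andP[ax xb] : a <= x < b by move: xab; rewrite in_itv.
  have sub y : y \in `[a, x] -> y \in `[a, b[.
    by rewrite !in_itv /= => /andP[-> /= /le_lt_trans]; exact.
  apply: le_trans (FB x xab); rewrite ler_norml; apply/andP; split.
    have h := @sub_le_derive R (fun y => -1 * f y + -1 * F y)
      (fun y => -1 * df y + -1 * dF y) 0 a x ax
      (fun y yab => is_derive_lin _ _ (hf y (sub y yab)) (hF y (sub y yab))).
    suff : -1 * f x + -1 * F x - (-1 * f a + -1 * F a) <= 0 by lra.
    rewrite -[leRHS](mul0r (x - a)); apply: h => y /sub yab.
    by have := hdf y yab; rewrite ler_norml => /andP[+ _]; lra.
  have h := @sub_le_derive R (fun y => 1 * f y + -1 * F y)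
      (fun y => 1 * df y + -1 * dF y) 0 a x ax
      (fun y yab => is_derive_lin _ _ (hf y (sub y yab)) (hF y (sub y yab))).
  suff : 1 * f x + -1 * F x - (1 * f a + -1 * F a) <= 0 by lra.
  rewrite -[leRHS](mul0r (x - a)); apply: h => y /sub yab.
  by have := hdf y yab; rewrite ler_norml => /andP[_]; lra.
have nfb : `|f x - f a| @[x --> b^'-] --> `|f b - f a|.
  by apply: cvg_norm; apply: cvgB => //; exact: cvg_cst.
rewrite -(cvg_lim _ nfb)//; apply: limr_le; first by apply/cvg_ex; eexists; exact: nfb.
near=> x; apply: key; rewrite in_itv /=; apply/andP; split; near: x.
  exact: nbhs_left_ge.
exact: nbhs_left_lt.
Unshelve. all: by end_near. Qed.

(** * The heat semigroup of a constant-coefficient generator *)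

Section Generator.
Context {R : realType} {V : finZmodType} {n : nat}.
Variables (nu : R) (eps : dir n -> V).
Implicit Types (b : 'I_n -> R) (f : V -> R) (x : V).

Definition nabla (e : dir n) f x : R := nu * (f (x + eps e) - f x).

Definition lap b f x : R := nu * \sum_(e : dir n) b e.1 * nabla e f x.

Definition jump b f x : R := nu ^+ 2 * \sum_(e : dir n) b e.1 * f (x + eps e).

Definition rate b : R := nu ^+ 2 * \sum_(e : dir n) b e.1.

Definition jumps b (i : nat) : V -> R := iter i (jump b) (fun y => (y == 0)%:R).

(** [m] counts derivatives in the variable of the power series, so differentiating the series shifts
    [m] by one. *)
Definition coef b (m : nat) (y : V) (i : nat) : R := jumps b (i + m) y / i`!%:R.

(* [lap] is [jump] minus the constant [rate], and [jump] preserves positivity, so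
   [exp (s lap)] is [exp (- rate s)] times a power series with nonnegative
   coefficients. *)
Definition heat b (s : R) (y : V) : R :=
  expR (- rate b * s) * limn (pseries (coef b 0 y) s).

Definition heatop b (s : R) f x : R := \sum_y heat b s y * f (x + y).

Lemma lapE b f x : lap b f x = jump b f x - rate b * f x.
Proof.
rewrite /lap /jump /rate /nabla -mulrA mulr_suml -mulrBr expr2 -mulrA.
congr (_ * _); rewrite -sumrB mulr_sumr; apply: eq_bigr => e _.
by rewrite -mulrBr mulrCA.
Qed.

Lemma jump_norm b f K x : (forall i, 0 <= b i) -> (forall y, `|f y| <= K) ->
  `|jump b f x| <= rate b * K.
Proof.
move=> b0 fK; rewrite normrM ger0_norm ?sqr_ge0// /rate -mulrA.
apply: ler_wpM2l; first exact: sqr_ge0.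
rewrite mulr_suml; apply: le_trans (ler_norm_sum _ _ _) _.
by apply: ler_sum => e _; rewrite normrM ger0_norm// ler_wpM2l.
Qed.

Lemma rate_ge0 b : (forall i, 0 <= b i) -> 0 <= rate b.
Proof. by move=> b0; rewrite mulr_ge0 ?sqr_ge0// sumr_ge0. Qed.

Lemma jumps_norm b i y : (forall j, 0 <= b j) -> `|jumps b i y| <= rate b ^+ i.
Proof.
move=> b0; elim: i y => [|i IH] y.
  by rewrite /= expr0 normr_nat lern1; case: (_ == _).
by rewrite exprS; apply: jump_norm.
Qed.

Lemma jumps_ge0 b i y : (forall j, 0 <= b j) -> 0 <= jumps b i y.
Proof.
move=> b0; elim: i y => [|i IH] y; first by rewrite /= ler0n.
by rewrite mulr_ge0 ?sqr_ge0// sumr_ge0// => e _; rewrite mulr_ge0.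
Qed.

(** Each application of [jump] multiplies the sup norm by at most [rate b], so the series is
    dominated by an exponential one. *)
Lemma coef_cvg b m y K : (forall j, 0 <= b j) -> cvgn (pseries (coef b m y) K).
Proof.
move=> b0; apply: normed_cvg; rewrite /normed_series_of /=.
apply: (@series_le_cvg _ _ (fun i => rate b ^+ m * exp_coeff (rate b * `|K|) i)) => [i|i|i|].
- exact: normr_ge0.
- by rewrite mulr_ge0 ?exprn_ge0 ?rate_ge0// exp_coeff_ge0// mulr_ge0 ?rate_ge0.
- rewrite /coef /exp_coeff /= !normrM normfV normr_nat normrX.
  rewrite [(rate b * _) ^+ i]exprMn; have := jumps_norm (i + m) y b0; rewrite exprD.
  move=> Jle; rewrite [leLHS](_ : _ = `|jumps b (i + m) y| * (`|K| ^+ i / i`!%:R)).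
    rewrite [leRHS](_ : _ = rate b ^+ i * rate b ^+ m * (`|K| ^+ i / i`!%:R)).
      by rewrite ler_wpM2r// divr_ge0// exprn_ge0.
    by rewrite -!mulrA mulrCA.
  by rewrite mulrAC mulrA.
- have := is_cvg_series_exp_coeff (rate b * `|K|).
  by move=> /is_cvg_seriesZ; apply.
Qed.

Lemma pseries_diffs_coef b m y : pseries_diffs (coef b m y) = coef b m.+1 y.
Proof.
apply/funext => i; rewrite /pseries_diffs /coef addSnnS mulrCA factS natrM invfM.
by rewrite mulVKf ?pnatr_eq0.
Qed.

Lemma pseriesE (f : nat -> R) (s : R) (k : nat) :
  pseries f s k = \sum_(i < k) f i * s ^+ i.
Proof. by rewrite /pseries /series /= big_mkord. Qed.

Lemma coefS_lim b y s : (forall j, 0 <= b j) ->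
  limn (pseries (coef b 1 y) s) = jump b (fun y => limn (pseries (coef b 0 y) s)) y.
Proof.
move=> b0; apply/cvg_lim => //.
rewrite [X in X @ _ --> _](_ : _ = fun k => nu ^+ 2 *
    \sum_(e : dir n) b e.1 * pseries (coef b 0 (y + eps e)) s k); last first.
  apply/funext => k; rewrite pseriesE.
  under [in RHS]eq_bigr do rewrite pseriesE mulr_sumr.
  rewrite exchange_big mulr_sumr.
  apply: eq_bigr => i _.
  rewrite /coef addn1 addn0 /= {1}/jump -!mulrA mulr_suml; do 2!congr (nu * _).
  by apply: eq_bigr => e _; rewrite -!mulrA.
apply: cvgMr; apply: cvg_finsum => e; apply: cvgMr.
exact: coef_cvg.
Qed.

Lemma heat_derive b (s : R) y : (forall j, 0 <= b j) ->
  is_derive s (1 : R) (fun s : R => heat b s y) (lap b (heat b s) y).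
Proof.
move=> b0; rewrite lapE.
have h1 : is_derive s 1 (fun s => expR (- rate b * s)) (- rate b * expR (- rate b * s)).
  have := @is_derive1_comp R expR (fun s => - rate b * s) s _ _ (is_derive_expR _)
    (is_derive_scale (- rate b) (is_derive_id s 1)).
  by move=> h; apply: is_derive_eq h _; rewrite mulr1 mulrC.
have h2 : is_derive s 1 (fun s => limn (pseries (coef b 0 y) s))
    (limn (pseries (coef b 1 y) s)).
  rewrite -pseries_diffs_coef; apply: (@pseries_snd_diffs _ _ (`|s| + 1)).
  - exact: coef_cvg.
  - by rewrite pseries_diffs_coef; exact: coef_cvg.
  - by rewrite !pseries_diffs_coef; exact: coef_cvg.
  - by rewrite [ltRHS]ger0_norm ?addr_ge0// ltrDl.
apply: is_derive_eq (is_derive_mul h1 h2) _.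
rewrite coefS_lim// /heat addrC; congr (_ + _); last by rewrite !mulNr mulrA.
rewrite /jump mulrCA; congr (_ * _); rewrite mulr_sumr.
by apply: eq_bigr => e _; rewrite mulrCA.
Qed.

Lemma heat_ge0 b s y : (forall j, 0 <= b j) -> 0 <= s -> 0 <= heat b s y.
Proof.
move=> b0 s0; rewrite mulr_ge0 ?expR_ge0//.
apply: limr_ge; first exact: coef_cvg.
apply: nearW => k; rewrite pseriesE; apply: sumr_ge0 => i _.
by rewrite mulr_ge0 ?exprn_ge0// divr_ge0// jumps_ge0.
Qed.

Lemma heat0 b y : heat b 0 y = (y == 0)%:R.
Proof.
rewrite /heat mulr0 expR0 mul1r; apply/cvg_lim => //.
apply/cvg_ballP => e e0; near=> k.
rewrite /ball /= (_ : pseries _ _ _ = (y == 0)%:R) ?subrr ?normr0//.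
have [m ->] : exists m, k = m.+1.
  by exists k.-1; rewrite prednK//; near: k; exists 1%N.
rewrite pseriesE big_ord_recl big1 ?addr0 => [|i _].
  by rewrite /coef /= expr0 mulr1 fact0 divr1.
by rewrite expr0n /= mulr0.
Unshelve. all: by end_near. Qed.

Context (eps_opp : forall e, eps (dir_opp e) = - eps e).

Lemma dir_oppK : involutive (@dir_opp n).
Proof. by case=> i s; rewrite /dir_opp /= negbK. Qed.

Lemma sum_translate (h : V -> R) x : \sum_y h (x + y) = \sum_y h y.
Proof. by rewrite [RHS](reindex_inj (addrI x)). Qed.

(** Summation by parts: each term is translated by its step, and opposite directions, which carry
    the same coefficient [b e.1], are exchanged. *)
Lemma lap_adjoint b f g x :
  \sum_y lap b f y * g (x + y) = \sum_y f y * lap b g (x + y).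
Proof.
rewrite (eq_bigr (fun y => nu ^+ 2 * \sum_(e : dir n) b e.1 * (f (y + eps e) * g (x + y))
  - rate b * (f y * g (x + y)))); last first.
  move=> y _; rewrite lapE mulrBl -(mulrA (rate b)); congr (_ - _).
  rewrite /jump; move: (nu ^+ 2) => c; rewrite -mulrA mulr_suml; congr (_ * _).
  by apply: eq_bigr => e _; rewrite mulrA.
rewrite [RHS](eq_bigr (fun y => nu ^+ 2 * \sum_(e : dir n) b e.1 * (f y * g (x + (y + eps e)))
  - rate b * (f y * g (x + y)))); last first.
  move=> y _; rewrite lapE mulrBr; congr (_ - _); last by rewrite mulrCA.
  rewrite /jump; move: (nu ^+ 2) => c; rewrite mulrCA mulr_sumr; congr (_ * _).
  by apply: eq_bigr => e _; rewrite mulrCA addrA.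
rewrite !sumrB; congr (_ - _); rewrite -!mulr_sumr; congr (_ * _).
rewrite exchange_big [RHS]exchange_big /=.
rewrite [RHS](reindex_inj (inv_inj dir_oppK)); apply: eq_bigr => e _ /=.
rewrite -!mulr_sumr; congr (_ * _).
rewrite -[RHS](sum_translate _ (eps e)); apply: eq_bigr => y _.
by rewrite eps_opp [eps e + y]addrC addrK.
Qed.

Lemma lap_cst b c x : lap b (fun=> c) x = 0.
Proof. by rewrite /lap big1 ?mulr0// => e _; rewrite /nabla subrr !mulr0. Qed.

Lemma nablaZ e c f x : nabla e (fun y => c * f y) x = c * nabla e f x.
Proof. by rewrite /nabla; ring. Qed.

Lemma heatopD b s f g x :
  heatop b s (fun y => f y + g y) x = heatop b s f x + heatop b s g x.
Proof. by rewrite /heatop -big_split; apply: eq_bigr => y _; rewrite mulrDr. Qed.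

Lemma heatopZ b s c f x : heatop b s (fun y => c * f y) x = c * heatop b s f x.
Proof. by rewrite /heatop mulr_sumr; apply: eq_bigr => y _; rewrite mulrCA. Qed.

Lemma heatopB b s f g x :
  heatop b s (fun y => f y - g y) x = heatop b s f x - heatop b s g x.
Proof. by rewrite /heatop -sumrB; apply: eq_bigr => y _; rewrite mulrBr. Qed.

Lemma heatop_sum b s (I : finType) (f : I -> V -> R) x :
  heatop b s (fun y => \sum_i f i y) x = \sum_i heatop b s (f i) x.
Proof.
rewrite /heatop exchange_big; apply: eq_bigr => y _.
by rewrite mulr_sumr.
Qed.

Lemma heatop_ext b s f g x : f =1 g -> heatop b s f x = heatop b s g x.
Proof. by move=> fg; apply: eq_bigr => y _; rewrite fg. Qed.

Lemma nabla_heatop b e s f x :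
  nabla e (heatop b s f) x = heatop b s (nabla e f) x.
Proof.
rewrite /nabla heatopZ heatopB; congr (_ * (_ - _)).
by apply: eq_bigr => y _; rewrite addrAC.
Qed.

Lemma lap_heatop b b' s f x : lap b' (heatop b s f) x = heatop b s (lap b' f) x.
Proof.
rewrite /lap heatopZ heatop_sum; congr (_ * _); apply: eq_bigr => e _.
by rewrite heatopZ nabla_heatop.
Qed.

Lemma heatopC b b' s t f x :
  heatop b s (heatop b' t f) x = heatop b' t (heatop b s f) x.
Proof.
rewrite /heatop; under eq_bigr do rewrite mulr_sumr.
rewrite exchange_big; apply: eq_bigr => y _; rewrite mulr_sumr.
by apply: eq_bigr => z _; rewrite mulrCA addrAC.
Qed.

Lemma heatop0 b f x : heatop b 0 f x = f x.
Proof.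
rewrite /heatop (bigD1 0) //= heat0 eqxx mul1r addr0 big1 ?addr0// => y y0.
by rewrite heat0 (negbTE y0) mul0r.
Qed.

Section Ellipticity.
Variable b : 'I_n -> R.
Context (b0 : forall i, 0 <= b i).

(** Duhamel's formula in differential form: the derivative of the kernel of the remaining time is
    minus its Laplacian, and [lap_adjoint] moves that operator onto [v s]. *)
Lemma heatop_derive (t s : R) (v : R -> V -> R) (dv : V -> R) x :
  (forall y, is_derive s (1 : R) (fun s => v s y) (dv y)) ->
  is_derive s (1 : R) (fun s => heatop b (t - s) (v s) x)
    (heatop b (t - s) (fun y => dv y - lap b (v s) y) x).
Proof.
move=> hv; have hs y := is_derive_mul (is_derive_refl (heat_derive (t - s) y b0)) (hv (x + y)).
apply: is_derive_eq (is_derive_finsum hs) _.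
rewrite big_split /= heatopB addrC; congr (_ + _).
by rewrite /heatop -lap_adjoint -sumrN; apply: eq_bigr => y _; rewrite mulNr.
Qed.

Lemma heatop_time_derive (s : R) f x :
  is_derive s (1 : R) (fun s => heatop b s f x) (heatop b s (lap b f) x).
Proof.
have hs y := is_derive_mul (heat_derive s y b0) (is_derive_cst (f (x + y)) s 1).
apply: is_derive_eq (is_derive_finsum hs) _.
rewrite /heatop -lap_adjoint; apply: eq_bigr => y _.
by rewrite mulr0 addr0.
Qed.

Lemma heat_mass s : \sum_y heat b s y = 1.
Proof.
transitivity (heatop b s (fun=> 1) 0).
  by apply: eq_bigr => y _; rewrite mulr1.
have := @is_derive_0_is_cst R (fun s => heatop b s (fun=> 1) 0) s 0.
rewrite heatop0; apply=> t.
apply: is_derive_eq (heatop_time_derive t _ _) _.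
by rewrite /heatop big1// => y _; rewrite lap_cst mulr0.
Qed.

Lemma heatop_cst s c x : heatop b s (fun=> c) x = c.
Proof. by rewrite /heatop -mulr_suml heat_mass mul1r. Qed.

Lemma heatop_le s f g x : 0 <= s -> (forall y, f y <= g y) ->
  heatop b s f x <= heatop b s g x.
Proof. by move=> s0 fg; apply: ler_sum => y _; rewrite ler_wpM2l ?heat_ge0. Qed.

Lemma heatop_norm s f K x : 0 <= s -> (forall y, `|f y| <= K) ->
  `|heatop b s f x| <= K.
Proof.
move=> s0 fK; rewrite ler_norml -{1}(heatop_cst s (- K) x) -{2}(heatop_cst s K x).
by apply/andP; split; apply: heatop_le => // y; have := fK y; rewrite ler_norml => /andP[].
Qed.

(** The difference of the two sides is the variance of [f] under a probability kernel. *)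
Lemma heatop_sqr s f x : 0 <= s -> heatop b s f x ^+ 2 <= heatop b s (fun y => f y ^+ 2) x.
Proof.
move=> s0; set m := heatop b s f x; rewrite -subr_ge0.
have -> : heatop b s (fun y => f y ^+ 2) x - m ^+ 2 =
    heatop b s (fun y => (f y - m) ^+ 2) x.
  rewrite [RHS](heatop_ext (g := fun y => f y ^+ 2 - ((2 * m) * f y - m ^+ 2)) b s x); last
    first.
    by move=> y /=; ring.
  by rewrite !heatopB heatopZ heatop_cst -/m; ring.
rewrite -(heatop_cst s 0 x); apply: heatop_le => // y; exact: sqr_ge0.
Qed.

(** Running time [r] with one factor and [s + t - r] with the other gives a function of [r] with
    zero derivative, because [lap b] commutes with the semigroup; [r = 0] and [r = t] are
    compared. *)
Lemma heatop_semigroup s t f x :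
  heatop b (s + t) f x = heatop b s (heatop b t f) x.
Proof.
have := @is_derive_0_is_cst R (fun r => heatop b (s + t - r) (heatop b r f) x) 0 t.
rewrite subr0 addrK (heatop_ext (g := f) b (s + t) x); last by move=> y; rewrite heatop0.
apply=> r; apply: is_derive_eq (heatop_derive (s + t) x _) _.
  by move=> y; exact: heatop_time_derive.
rewrite -[RHS](heatop_cst (s + t - r) 0 x); apply: heatop_ext => y.
by rewrite lap_heatop subrr.
Qed.

End Ellipticity.

(** The discrete carre du champ identity. It holds on the lattice without remainder, so the
    arguments built on it are valid at times below the square of the mesh as well. *)
Lemma jensen_gap b f x :
  lap b (fun y => f y ^+ 2) x - 2 * f x * lap b f x =
  \sum_(e : dir n) b e.1 * nabla e f x ^+ 2.
Proof.
rewrite /lap /nabla !mulr_sumr -sumrB; apply: eq_bigr => e _; ring.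
Qed.

(** * The reverse Poincare inequality and its iterates *)

Section ReversePoincare.
Variables (b : 'I_n -> R) (cm : R).
Context (cm0 : 0 < cm) (bcm : forall i, cm <= b i).

Let b0 i : 0 <= b i. Proof. exact: le_trans (ltW cm0) (bcm i). Qed.

(* Along [r], the derivative of [P_{s-r} ((P_r f)^2)] is minus [P_{s-r}] of the
   squared gradient of [P_r f]; by Jensen's inequality the latter dominates
   [(nabla e P_s f)^2]. *)
Lemma nabla_heatop_sqr e s f x : 0 <= s ->
  cm * s * nabla e (heatop b s f) x ^+ 2 <= heatop b s (fun y => f y ^+ 2) x.
Proof.
move=> s0; set D := nabla _ _ _.
pose v r y := heatop b r f y ^+ 2.
pose dv r y := 2 * heatop b r f y * heatop b r (lap b f) y.
have hv r y : is_derive r (1 : R) (fun r => v r y) (dv r y).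
  have h := heatop_time_derive b0 r f y.
  apply: (is_derive_eq (is_derive_mul h h)); rewrite /dv; ring.
have := @sub_le_derive R (fun r => heatop b (s - r) (v r) x) _ (- (cm * D ^+ 2)) 0 s s0
  (fun r _ => heatop_derive b0 s x (hv r)).
rewrite subrr subr0 heatop0 => h.
have {h} : v s x - heatop b s (v 0) x <= - (cm * D ^+ 2) * s.
  apply: h => r; rewrite in_itv /= => /andP[r0 rs].
  rewrite (heatop_ext (g := fun y => - 1 * \sum_(e : dir n) b e.1 * nabla e (heatop b r f) y
    ^+ 2) b (s - r) x).
    rewrite heatopZ mulN1r lerN2.
    apply: (@le_trans _ _ (heatop b (s - r) (fun y => cm * nabla e (heatop b r f) y ^+ 2) x)).
      rewrite heatopZ ler_wpM2l ?(ltW cm0)//.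
      suff -> : D = heatop b (s - r) (nabla e (heatop b r f)) x by rewrite heatop_sqr//
        subr_ge0.
      by rewrite -nabla_heatop /D /nabla -!heatop_semigroup// subrK.
    apply: heatop_le => //; first by rewrite subr_ge0.
    move=> y; rewrite (bigD1 e) //=; apply: ler_wpDr.
      by apply: sumr_ge0 => e' _; rewrite mulr_ge0 ?sqr_ge0.
    by rewrite ler_wpM2r ?sqr_ge0.
  by move=> y; rewrite -jensen_gap lap_heatop /dv; ring.
rewrite (heatop_ext (g := fun y => f y ^+ 2) b s x); last first.
  by move=> y; rewrite /v heatop0.
have : 0 <= v s x by exact: sqr_ge0.
lra.
Qed.

Definition nablas (es : seq (dir n)) f : V -> R := foldr nabla f es.

Lemma nablas_ext es f g : f =1 g -> nablas es f =1 nablas es g.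
Proof. by move=> fg x; rewrite (_ : f = g)//; exact/funext. Qed.

Lemma nablas_heatop (b' : 'I_n -> R) es s f x :
  nablas es (heatop b' s f) x = heatop b' s (nablas es f) x.
Proof.
elim: es x => [//|e es IH] x /=.
rewrite (_ : nablas es (heatop b' s f) = heatop b' s (nablas es f)); last exact/funext.
exact: nabla_heatop.
Qed.

Lemma nablas_cat es1 es2 f : nablas (es1 ++ es2) f = nablas es1 (nablas es2 f).
Proof. by rewrite /nablas foldr_cat. Qed.

(** Each difference is paid for by its own time slice [h]: the semigroup law splits off one slice
    per step, and differences commute with the remaining slices. *)
Lemma nablas_heatop_sqr es h f x : 0 < h ->
  nablas es (heatop b ((size es)%:R * h) f) x ^+ 2 <=
  (cm * h)^-1 ^+ size es * heatop b ((size es)%:R * h) (fun y => f y ^+ 2) x.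
Proof.
move=> h0; have ch0 : 0 < cm * h by rewrite mulr_gt0.
elim: es x => [|e es IH] x /=; first by rewrite !mul0r expr0 mul1r heatop_sqr.
have -> : (size es).+1%:R * h = h + (size es)%:R * h by rewrite -natr1; ring.
rewrite (_ : heatop b (h + _) f = heatop b h (heatop b ((size es)%:R * h) f)); last first.
  by apply/funext => y; rewrite heatop_semigroup.
rewrite (_ : nablas es _ = heatop b h (nablas es (heatop b ((size es)%:R * h) f))); last first.
  by apply/funext => y; rewrite nablas_heatop.
rewrite [_ ^+ (size es).+1]exprS -[leRHS]mulrA -(ler_pM2l ch0) mulVKf ?gt_eqF//
  heatop_semigroup// -heatopZ.
apply: le_trans (nabla_heatop_sqr e _ _ (ltW h0)) _.
by apply: heatop_le => //; exact: ltW.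
Qed.

(** The time [s] is divided equally among the differences, whence the constant. Only the average of
    [f ^+ 2] seen from the one point [x] enters, so [f] may grow with the distance from a freezing
    point. *)
Lemma nablas_heatop_le es (s : R) f x (K : R) : 0 < s -> 0 <= K ->
  heatop b s (fun y => f y ^+ 2) x <= K ^+ 2 ->
  `|nablas es (heatop b s f) x| <=
    Num.sqrt ((size es)%:R / cm) ^+ size es * s `^ (- ((size es)%:R / 2)) * K.
Proof.
move=> s0 K0 hK; set j := size es.
(* An empty list has no slice length [s / j]; it is covered by Jensen's inequality. *)
have [j0|j0] := posnP j.
  have es0 : es = [::] by apply/size0nil.
  rewrite j0 es0 /= expr0 !mul0r oppr0 powRr0 !mul1r.
  by rewrite -(ler_pXn2r (ltn0Sn 1)) ?nnegrE// real_normK ?num_real// (le_trans _ hK)//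
    heatop_sqr// (ltW s0).
have jR : (0 : R) < j%:R by rewrite ltr0n.
have h0 : 0 < s / j%:R by rewrite divr_gt0.
have := nablas_heatop_sqr es f x h0; rewrite -/j mulrC divfK ?gt_eqF// => hle.
rewrite -(ler_pXn2r (ltn0Sn 1)) ?nnegrE ?mulr_ge0 ?exprn_ge0 ?sqrtr_ge0 ?powR_ge0//.
rewrite real_normK ?num_real//; apply: le_trans hle _.
rewrite !exprMn -exprM mulnC exprM sqr_sqrtr ?divr_ge0 ?(ltW cm0)//.
have -> : (s `^ (- (j%:R / 2))) ^+ 2 = s ^- j.
  rewrite -powR_invn ?(ltW s0)// -powR_mulrn ?powR_ge0// -powRrM.
  by congr (_ `^ _); field.
have -> : (cm * (s / j%:R))^-1 = j%:R / cm / s by rewrite !invfM invrK; ring.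
have -> : (j%:R / cm / s) ^+ j = (j%:R / cm) ^+ j * s ^- j by rewrite exprMn exprVn.
apply: ler_wpM2l => //.
by rewrite mulr_ge0 ?invr_ge0 ?exprn_ge0 ?divr_ge0 ?ltW.
Qed.

End ReversePoincare.

(** * Growth of the squared distance, and the divergence form of the perturbation *)

Lemma heatop_moment b c psi x s : (forall i, 0 <= b i) -> 0 <= s ->
  (forall y, lap b psi y <= c) -> heatop b s psi x <= psi x + c * s.
Proof.
move=> b0 s0 hc.
have := @sub_le_derive R (fun s => heatop b s psi x) _ c 0 s s0
  (fun r _ => heatop_time_derive b0 r psi x).
rewrite heatop0 subr0 => h; rewrite -lerBlDl; apply: h => r.
rewrite in_itv /= => /andP[r0 _].
by rewrite -[leRHS](heatop_cst b0 r c x); apply: heatop_le.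
Qed.

(** By concavity the power lies, beyond [p], below the line through the origin that meets it at [p].
    This linear majorant lets a first moment control a fractional one. *)
Lemma powR_le_scale (al p q : R) : 0 < p -> p <= q -> 0 < al -> al <= 1 ->
  q `^ al <= p `^ al / p * q.
Proof.
move=> p0 pq al0 al1; rewrite {1}(_ : q = p * (q / p)); last by field; rewrite gt_eqF.
have qp : 1 <= q / p by rewrite ler_pdivlMr ?mul1r.
rewrite powRM ?(ltW p0) ?(le_trans ler01)// -mulrA ler_wpM2l ?powR_ge0//.
by rewrite [leRHS]mulrC; exact: ler1_powR.
Qed.

Lemma heatop_weight b c psi x s rr al : (forall i, 0 <= b i) -> 0 < al -> al <= 1 ->
  0 <= s -> 0 < rr -> s <= rr -> 0 <= c -> (forall y, 0 <= psi y) ->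
  (forall y, lap b psi y <= c) -> psi x <= rr ->
  heatop b s (fun y => (rr + psi y) `^ al) x <= (2 + c) * rr `^ al.
Proof.
move=> b0 al0 al1 s0 r0 sr c0 psi0 hc px.
apply: (@le_trans _ _ (heatop b s (fun y => rr `^ al / rr * (rr + psi y)) x)).
  by apply: heatop_le => // y; apply: powR_le_scale => //; rewrite lerDl.
rewrite heatopZ heatopD heatop_cst//.
have : rr + heatop b s psi x <= (2 + c) * rr.
  have := heatop_moment x b0 s0 hc; have := ler_wpM2l c0 sr; lra.
move=> /(ler_wpM2l (divr_ge0 (powR_ge0 rr al) (ltW r0))) /le_trans; apply.
by rewrite [X in X <= _](_ : _ = (2 + c) * rr `^ al)//; field; rewrite gt_eqF.
Qed.

Definition gen (a : V -> dir n -> R) (f : V -> R) (x : V) : R :=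
  nu * \sum_(e : dir n) a x e * nabla e f x.

Lemma sum_dir (F : dir n -> R) :
  \sum_(e : dir n) F e = \sum_(i < n) (F (i, true) + F (i, false)).
Proof.
rewrite (eq_bigr (fun e => F (e.1, e.2))); last by case.
by rewrite -(pair_bigA _ (fun i s => F (i, s))); apply: eq_bigr => i _; rewrite big_bool.
Qed.

(** The symmetry of [a] pairs the edge leaving [x] in direction [(i, false)] with the edge that
    enters it, so the perturbation is a divergence of fluxes through positively oriented edges. The
    outer difference can then be carried by the kernel. *)
Lemma gen_flux a b f x : (forall y e, a y e = a (y + eps e) (dir_opp e)) ->
  gen a f x - lap b f x =
  - \sum_(i < n) nabla (i, false)
      (fun y => (a y (i, true) - b i) * nabla (i, true) f y) x.
Proof.
move=> asym; rewrite /gen /lap -mulrBr -sumrB.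
rewrite sum_dir mulr_sumr -sumrN; apply: eq_bigr => i _ /=.
have E : x + eps (i, false) + eps (i, true) = x.
  by rewrite (eps_opp (i, false)) addrK.
rewrite (asym x (i, false)) /= /dir_opp /= /nabla E; ring.
Qed.

Lemma nablasD es f g x :
  nablas es (fun y => f y + g y) x = nablas es f x + nablas es g x.
Proof.
elim: es x => [//|e es IH] x; rewrite /= /nabla !IH; ring.
Qed.

Lemma nablasN es f x : nablas es (fun y => - f y) x = - nablas es f x.
Proof. by elim: es x => [//|e es IH] x; rewrite /= /nabla !IH; ring. Qed.

Lemma nablas_sum es (I : finType) (f : I -> V -> R) x :
  nablas es (fun y => \sum_i f i y) x = \sum_i nablas es (f i) x.
Proof.
elim: es x => [//|e es IH] x; rewrite /= /nabla !IH -sumrB mulr_sumr.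
by apply: eq_bigr.
Qed.

Lemma nablas_derive es (f : R -> V -> R) (df : V -> R) (s : R) x :
  (forall y, is_derive s (1 : R) (fun s => f s y) (df y)) ->
  is_derive s (1 : R) (fun s => nablas es (f s) x) (nablas es df x).
Proof.
move=> hf; elim: es x => [//|e es IH] x /=.
rewrite /nabla; exact: is_derive_scale (is_derive_sub (IH (x + eps e)) (IH x)).
Qed.

Lemma nablas_cvg es (f : R -> V -> R) (F : set_system R) (FF : Filter F) l x :
  (forall y, f s y @[s --> F] --> l y) -> nablas es (f s) x @[s --> F] --> nablas es l x.
Proof.
move=> hf; elim: es x => [//|e es IH] x /=.
by apply: cvgMr; apply: cvgB; exact: IH.
Qed.

Lemma nabla_ext e f g x : f =1 g -> nabla e f x = nabla e g x.
Proof. by move=> fg; rewrite /nabla !fg. Qed.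

(** * Local estimates with frozen coefficients *)

(* [psi x y] plays the role of the squared torus distance; all that is needed of
   it is that it vanishes on the diagonal and has bounded Laplacian. *)
Section Local.
Variables (cm cp c1 al : R).
Context (cm0 : 0 < cm) (c10 : 0 <= c1) (al0 : 0 < al) (al1 : al < 1).
Variables (psi : V -> V -> R).
Context (psi0 : forall x, psi x x = 0) (psi_ge0 : forall x y, 0 <= psi x y).
Context (psi_lap : forall (b : 'I_n -> R) x y, (forall i, 0 <= b i <= cp) -> lap b (psi x) y
  <= c1).

Variables (a : R -> V -> dir n -> R) (g u : R -> V -> R) (lo hi : R).
Variables (As Ms G U : R).
Context (As0 : 0 <= As) (Ms0 : 0 <= Ms) (G0 : 0 <= G) (U0 : 0 <= U).
Context (a_sym : forall (s : R) x e, s \in `[lo, hi] -> a s x e = a s (x + eps e) (dir_opp e)).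
Context (a_ell : forall (s : R) x e, s \in `[lo, hi] -> cm <= a s x e <= cp).
Context (a_hol : forall (s t : R) x y i, s \in `[lo, hi] -> t \in `[lo, hi] ->
  `|a s y (i, true) - a t x (i, true)| <= As * (`|s - t| + psi x y) `^ (al / 2)).
Context (u_grad : forall (s : R) x e, s \in `[lo, hi] -> `|nabla e (u s) x| <= Ms).
Context (u_bnd : forall (s : R) x, s \in `[lo, hi] -> `|u s x| <= U).
Context (g_bnd : forall (s : R) x, s \in `[lo, hi] -> `|g s x| <= G).
Context (u_der : forall (s : R) x, s \in `[lo, hi[ ->
  is_derive s (1 : R) (fun s => u s x) (gen (a s) (u s) x + g s x)).
Context (u_left : forall (t : R) x, t \in `]lo, hi] -> u s x @[s --> t^'-] --> u t x).

Definition frozen (t : R) (x : V) (i : 'I_n) : R := a t x (i, true).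

Lemma frozen_ell t x i : t \in `[lo, hi] -> cm <= frozen t x i.
Proof. by move=> /(a_ell x (i, true)) /andP[]. Qed.

Lemma frozen_le t x i : t \in `[lo, hi] -> frozen t x i <= cp.
Proof. by move=> /(a_ell x (i, true)) /andP[]. Qed.

Lemma frozen_ge0 t x i : t \in `[lo, hi] -> 0 <= frozen t x i.
Proof. by move=> /(frozen_ell x i); exact/le_trans/ltW. Qed.

(** At most four differences act on a kernel: up to three from the estimate and one from the
    divergence of the flux. The sum dominates all these constants at once. *)
Definition ker_const : R := \sum_(j < 5) Num.sqrt (j%:R / cm) ^+ j.

Lemma ker_const_ge (j : nat) : (j < 5)%N -> Num.sqrt (j%:R / cm) ^+ j <= ker_const.
Proof.
move=> j5; rewrite /ker_const (bigD1 (Ordinal j5)) //= lerDl; apply: sumr_ge0 => i _.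
by rewrite exprn_ge0 ?sqrtr_ge0.
Qed.

Lemma ker_const_ge0 : 0 <= ker_const.
Proof. by apply: le_trans (ker_const_ge (ltn0Sn 4)). Qed.

Lemma nablas_ker (b : 'I_n -> R) es (s : R) f x (K : R) : (forall i, cm <= b i) -> (size es <
  5)%N ->
  0 < s -> 0 <= K -> heatop b s (fun y => f y ^+ 2) x <= K ^+ 2 ->
  `|nablas es (heatop b s f) x| <= ker_const * s `^ (- ((size es)%:R / 2)) * K.
Proof.
move=> bcm es5 s0 K0 hK; apply: le_trans (nablas_heatop_le cm0 bcm es s0 K0 hK) _.
by rewrite -!mulrA ler_wpM2r ?ker_const_ge// mulr_ge0 ?powR_ge0.
Qed.

Lemma nablas_ker_sup (b : 'I_n -> R) es (s : R) f x (K : R) : (forall i, cm <= b i) -> (size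
  es < 5)%N ->
  0 < s -> 0 <= K -> (forall y, `|f y| <= K) ->
  `|nablas es (heatop b s f) x| <= ker_const * s `^ (- ((size es)%:R / 2)) * K.
Proof.
move=> bcm es5 s0 K0 hK; apply: nablas_ker => //.
have b0 i : 0 <= b i by exact: le_trans (ltW cm0) (bcm i).
rewrite -[leRHS](heatop_cst b0 s _ x); apply: heatop_le (ltW s0) _ => // y.
by rewrite -real_normK ?num_real// ler_pXn2r ?nnegrE.
Qed.

(** The [n] fluxes, each with the mean square weight from [heatop_weight], and one unit for the
    source [g]. *)
Definition drift_const : R := (n%:R * Num.sqrt (2 + c1) + 1) * ker_const.

Lemma drift_bound (t0 : R) x0 (s sig : R) es x (rr : R) : t0 \in `[lo, hi] -> s \in `[lo, hi] ->
  (size es < 4)%N -> 0 < sig -> sig <= rr -> `|t0 - s| <= rr -> psi x0 x <= rr ->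
  `|nablas es (heatop (frozen t0 x0) sig
      (fun y => gen (a s) (u s) y + g s y - lap (frozen t0 x0) (u s) y)) x| <=
  drift_const * (As * Ms * rr `^ (al / 2) * sig `^ (- ((size es).+1%:R / 2))
            + G * sig `^ (- ((size es)%:R / 2))).
Proof.
move=> t0I sI es4 sig0 sigr tsr pxr; set b := frozen t0 x0.
have rr0 : 0 < rr by exact: lt_le_trans sigr.
pose h i y := (a s y (i, true) - b i) * nabla (i, true) (u s) y.
have b0 i : 0 <= b i by exact: frozen_ge0.
have bcm i : cm <= b i by exact: frozen_ell.
have E y : gen (a s) (u s) y + g s y - lap b (u s) y =
    - (\sum_(i < n) nabla (i, false) (h i) y) + g s y.
  by rewrite addrAC (gen_flux b (u s) y (fun z e => a_sym z e sI)).
rewrite (nablas_ext es (g := fun y => - (\sum_(i < n) nabla (i, false) (heatop b sig (h i)) y)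
  + heatop b sig (g s) y)); last first.
  move=> y; rewrite (heatop_ext b sig y E) heatopD; congr (_ + _).
  rewrite (heatop_ext (g := fun y => -1 * \sum_(i < n) nabla (i, false) (h i) y) b sig y).
    by rewrite heatopZ mulN1r heatop_sum; congr (- _); apply: eq_bigr => i _; rewrite
      nabla_heatop.
  by move=> z; rewrite mulN1r.
rewrite nablasD nablasN nablas_sum; apply: le_trans (ler_normD _ _) _; rewrite normrN.
rewrite mulrDr; apply: lerD; last first.
  rewrite [X in _ <= X]mulrA; apply: le_trans (nablas_ker_sup x bcm (ltnW es4) sig0 G0 (fun y
    => g_bnd y sI)) _.
  rewrite [leLHS]mulrAC; apply: ler_wpM2r; first exact: powR_ge0.
  apply: ler_wpM2r => //.
  by rewrite /drift_const ler_peMl ?ker_const_ge0// lerDr mulr_ge0 ?sqrtr_ge0.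
have key i : `|nablas es (nabla (i, false) (heatop b sig (h i))) x| <=
    ker_const * sig `^ (- ((size es).+1%:R / 2)) * (As * Ms * Num.sqrt (2 + c1) * rr `^ (al /
      2)).
  have -> : nablas es (nabla (i, false) (heatop b sig (h i))) =
      nablas (es ++ [:: (i, false)]) (heatop b sig (h i)) by rewrite nablas_cat.
  have -> : (size es).+1 = size (es ++ [:: (i, false)]) by rewrite size_cat addn1.
  apply: nablas_ker => //; first by rewrite size_cat addn1.
    by rewrite !mulr_ge0 ?sqrtr_ge0 ?powR_ge0.
  apply: (@le_trans _ _ (heatop b sig (fun y => (As * Ms) ^+ 2 * (rr + psi x0 y) `^ al) x)).
    apply: heatop_le (ltW sig0) _ => // y.
    have -> : (rr + psi x0 y) `^ al = ((rr + psi x0 y) `^ (al / 2)) ^+ 2.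
      by rewrite -powR_mulrn ?powR_ge0// -powRrM; congr (_ `^ _); field.
    rewrite -exprMn -real_normK ?num_real// ler_pXn2r ?nnegrE// ?mulr_ge0 ?powR_ge0//.
    rewrite normrM mulrAC; apply: ler_pM => //; last exact: u_grad.
    apply: le_trans (a_hol _ _ _ sI t0I) _; rewrite ler_wpM2l//.
    by apply: ge0_ler_powR; rewrite ?nnegrE ?addr_ge0 ?divr_ge0 ?lerD2r ?(ltW al0) ?(ltW
      rr0)// distrC.
  rewrite heatopZ; apply: (@le_trans _ _ ((As * Ms) ^+ 2 * ((2 + c1) * rr `^ al))).
    rewrite ler_wpM2l ?sqr_ge0//; apply: heatop_weight => //; try exact: ltW.
    by move=> y; apply: psi_lap => j; rewrite b0 frozen_le.
  rewrite [leRHS]exprMn [(As * Ms * _) ^+ 2]exprMn sqr_sqrtr ?addr_ge0// -[leRHS]mulrA.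
  rewrite -[(rr `^ _) ^+ 2]powR_mulrn ?powR_ge0// -powRrM.
  by rewrite (_ : al / 2 * 2 = al)//; field.
apply: le_trans (ler_norm_sum _ _ _) _; apply: le_trans (ler_sum _ (fun i _ => key i)) _.
rewrite sumr_const card_ord -[leLHS]mulr_natl /drift_const.
rewrite [leLHS](_ : _ = (n%:R * Num.sqrt (2 + c1)) * ker_const *
  (As * Ms * rr `^ (al / 2) * sig `^ (- ((size es).+1%:R / 2)))); last by ring.
by rewrite ler_wpM2r ?mulr_ge0 ?powR_ge0// ler_wpM2r ?ker_const_ge0// lerDl ler01.
Qed.

Section Evolution.
Variables (b : 'I_n -> R).
Context (b0 : forall i, 0 <= b i).

Definition evol (es : seq (dir n)) (t : R) (x : V) (s : R) : R :=
  nablas es (heatop b (t - s) (u s)) x.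

Lemma evol_derive es (t : R) x (s : R) : s \in `[lo, hi[ ->
  is_derive s (1 : R) (evol es t x) (nablas es (heatop b (t - s)
    (fun y => gen (a s) (u s) y + g s y - lap b (u s) y)) x).
Proof.
by move=> sI; apply: nablas_derive => y; apply: heatop_derive => // z; exact: u_der.
Qed.

Lemma evol_left es (t c : R) x : c \in `]lo, hi] ->
  evol es t x s @[s --> c^'-] --> evol es t x c.
Proof.
move=> cI; apply: nablas_cvg => y; apply: cvg_finsum => z.
apply: cvgM; last exact: u_left.
apply: cvg_at_left_filter.
exact: (is_derive_continuous_at (is_derive_refl (heat_derive (t - c) z b0))).
Qed.

Lemma powR_majorant (B p t s : R) : p != 0 -> s < t ->
  is_derive s (1 : R) (fun s => - (B / p) * (t - s) `^ p) (B * (t - s) `^ (p - 1)).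
Proof.
move=> p0 st; have ts0 : 0 < t - s by rewrite subr_gt0.
apply: is_derive_eq (is_derive_scale (- (B / p)) (is_derive_refl (is_derive1_powR p ts0))) _.
by field.
Qed.

Lemma evol_inc (B p : R) es (t : R) x (s c : R) : p != 0 -> lo <= s -> s < c -> c <= hi -> c
  <= t ->
  (forall r, r \in `[s, c[ -> `|nablas es (heatop b (t - r)
    (fun y => gen (a r) (u r) y + g r y - lap b (u r) y)) x| <= B * (t - r) `^ (p - 1)) ->
  forall D, (forall r, r \in `[s, c[ -> (B / p) * ((t - s) `^ p - (t - r) `^ p) <= D) ->
  `|evol es t x c - evol es t x s| <= D.
Proof.
move=> p0 los sc chi ct hB D hD.
have sub r : r \in `[s, c[ -> r \in `[lo, hi[.
  rewrite !in_itv /= => /andP[sr rc]; apply/andP; split; first exact: le_trans sr.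
  exact: lt_le_trans chi.
have ltt r : r \in `[s, c[ -> r < t.
  by rewrite in_itv /= => /andP[_ rc]; exact: lt_le_trans ct.
apply: (@norm_sub_le_derive R (evol es t x) _ (fun s => - (B / p) * (t - s) `^ p) _ D s c sc
  (fun r rI => evol_derive es t x (sub r rI)) (fun r rI => powR_majorant B p0 (ltt r rI)) hB).
  by apply: evol_left; rewrite in_itv /= chi andbT; exact: le_lt_trans sc.
by move=> r /hD; apply: le_trans; lra.
Qed.

(** For [p > 0] the singularity at [t] is integrable: [c = t] is allowed, and the start [s] governs
    the bound. *)
Lemma evol_inc_pos (B p : R) es (t : R) x (s c : R) : 0 <= B -> 0 < p ->
  lo <= s -> s < c -> c <= hi -> c <= t ->
  (forall r, r \in `[s, c[ -> `|nablas es (heatop b (t - r)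
    (fun y => gen (a r) (u r) y + g r y - lap b (u r) y)) x| <= B * (t - r) `^ (p - 1)) ->
  `|evol es t x c - evol es t x s| <= B / p * (t - s) `^ p.
Proof.
move=> B0 p0 los sc chi ct hB; apply: evol_inc (hB) _ _ => //; first by rewrite gt_eqF.
move=> r _; rewrite ler_wpM2l ?divr_ge0 ?(ltW p0)//.
by rewrite gerBl powR_ge0.
Qed.

Lemma powR_le_neg (p x y : R) : p <= 0 -> 0 < x -> x <= y -> y `^ p <= x `^ p.
Proof.
move=> p0 x0 xy; rewrite -[p]opprK (powRN y) (powRN x) lef_pV2 ?posrE ?powR_gt0 ?(lt_le_trans
  x0)//.
by apply: ge0_ler_powR; rewrite ?nnegrE ?oppr_ge0 ?(ltW x0) ?(le_trans (ltW x0)).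
Qed.

(** For [p < 0] the primitive blows up at [t]: the end [c < t] governs the bound, whatever the
    start. *)
Lemma evol_inc_neg (B p : R) es (t : R) x (s c : R) : 0 <= B -> p < 0 ->
  lo <= s -> s < c -> c <= hi -> c < t ->
  (forall r, r \in `[s, c[ -> `|nablas es (heatop b (t - r)
    (fun y => gen (a r) (u r) y + g r y - lap b (u r) y)) x| <= B * (t - r) `^ (p - 1)) ->
  `|evol es t x c - evol es t x s| <= B / (- p) * (t - c) `^ p.
Proof.
move=> B0 p0 los sc chi ct hB; apply: evol_inc (hB) _ _ => //; rewrite ?(ltW ct) ?lt_eqF//.
move=> r; rewrite in_itv /= => /andP[_ rc].
have -> : B / p * ((t - s) `^ p - (t - r) `^ p) = B / (- p) * ((t - r) `^ p - (t - s) `^ p).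
  by rewrite invrN; ring.
rewrite ler_wpM2l ?divr_ge0 ?oppr_ge0 ?(ltW p0)//.
apply: (@le_trans _ _ ((t - r) `^ p)); first by rewrite gerBl powR_ge0.
by apply: powR_le_neg; rewrite ?(ltW p0) ?subr_gt0// lerD2l lerN2 ltW.
Qed.

End Evolution.

Lemma powR_add (x r s : R) : 0 < x -> x `^ (r + s) = x `^ r * x `^ s.
Proof. by move=> x0; rewrite powRD// (gt_eqF x0) implybT. Qed.

Lemma sqr_powR (r p : R) : 0 <= r -> (r ^+ 2) `^ p = r `^ (2 * p).
Proof. by move=> r0; rewrite -powR_mulrn// -powRrM. Qed.

Lemma two_powR (p : R) : p <= 1 -> 2 `^ p <= 2 :> R.
Proof. by move=> p1; rewrite -[leRHS]powRr1//; apply: ler_powR => //; rewrite ler1n. Qed.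

(** * Estimates in a parabolic neighbourhood of radius [rho] *)

Variable rho : R.
Context (rho0 : 0 < rho).

(** The weight of [G] turns its contribution, for times up to [2 * rho ^+ 2], into the same power of
    time as that of the flux. In [Kfar], the weight of [U] does so for data given at least a time
    [rho ^+ 2] earlier. *)
Definition Kdrift : R := As * Ms + G * rho `^ (1 - al).
Definition Kfar : R := Kdrift + U * rho `^ (- (1 + al)).

Lemma Kdrift_ge0 : 0 <= Kdrift.
Proof. by rewrite addr_ge0 ?mulr_ge0 ?powR_ge0. Qed.

Lemma Kdrift_le : Kdrift <= Kfar.
Proof. by rewrite lerDl mulr_ge0 ?powR_ge0. Qed.

Lemma Kfar_ge0 : 0 <= Kfar.
Proof. exact: le_trans Kdrift_ge0 Kdrift_le. Qed.

Lemma drift_const_ge0 : 0 <= drift_const.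
Proof. by rewrite mulr_ge0 ?ker_const_ge0// addr_ge0 ?mulr_ge0 ?sqrtr_ge0. Qed.

Lemma Kdrift_const_ge0 : 0 <= 2 * drift_const * Kdrift.
Proof. by rewrite (mulr_ge0 _ Kdrift_ge0)// (mulr_ge0 _ drift_const_ge0). Qed.

(** The choice [rr = 2 * sig] in [drift_bound] makes both terms multiples of one power of [sig]. In
    exchange, the distance to the freezing point has to be controlled by [sig] itself. *)
Lemma drift_scaled (t0 : R) x0 (s sig : R) es x : t0 \in `[lo, hi] -> s \in `[lo, hi] ->
  (size es < 4)%N -> 0 < sig -> sig <= 2 * rho ^+ 2 ->
  `|t0 - s| <= 2 * sig -> psi x0 x <= 2 * sig ->
  `|nablas es (heatop (frozen t0 x0) sig
      (fun y => gen (a s) (u s) y + g s y - lap (frozen t0 x0) (u s) y)) x| <=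
  2 * drift_const * Kdrift * sig `^ ((al + 1 - (size es)%:R) / 2 - 1).
Proof.
move=> t0I sI es4 sig0 sigr ts px.
have := @drift_bound t0 x0 s sig es x (2 * sig) t0I sI es4 sig0 _ ts px.
move/(_ _)/le_trans; apply; first by lra.
set j := size es; set S := sig `^ (_ - 1).
rewrite [leRHS](_ : _ = drift_const * (As * Ms * (2 * S) + G * (2 * rho `^ (1 - al) * S))).
  2: by rewrite /Kdrift; ring.
apply: ler_wpM2l; first exact: drift_const_ge0.
apply: lerD.
  rewrite -[leLHS]mulrA; apply: ler_wpM2l; first exact: mulr_ge0.
  rewrite powRM ?(ltW sig0)// /S.
  have -> : (al + 1 - j%:R) / 2 - 1 = al / 2 - j.+1%:R / 2 by rewrite -natr1; field.
  rewrite powR_add// -mulrA ler_wpM2r ?mulr_ge0 ?powR_ge0//.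
  by apply: two_powR; have := al1; lra.
apply: ler_wpM2l => //; rewrite /S.
have -> : (al + 1 - j%:R) / 2 - 1 = - ((1 - al) / 2) + - (j%:R / 2) by field.
rewrite (powR_add _ _ sig0) mulrA ler_peMl ?powR_ge0// powRN ler_pdivlMr ?powR_gt0// mul1r.
apply: (@le_trans _ _ ((2 * rho ^+ 2) `^ ((1 - al) / 2))).
  have r2 : 0 <= 2 * rho ^+ 2 by rewrite mulr_ge0// sqr_ge0.
  apply: ge0_ler_powR; rewrite ?nnegrE ?(ltW sig0) ?r2//.
  by have := al1; lra.
rewrite powRM ?sqr_ge0// sqr_powR ?(ltW rho0)//.
have -> : 2 * ((1 - al) / 2) = 1 - al by field.
by rewrite ler_wpM2r ?powR_ge0//; apply: two_powR; have := al0; lra.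
Qed.

(** Freezing at the end point [(t0, x0)] keeps the lag below the smoothing time, and one difference
    leaves the integrable power [al / 2 - 1], so the comparison runs all the way to [t0]. *)
Lemma grad_near (t0 h : R) x0 e : t0 \in `]lo, hi] -> 0 < h -> h <= 2 * rho ^+ 2 ->
  lo <= t0 - h ->
  `|nabla e (u t0) x0 - nabla e (heatop (frozen t0 x0) h (u (t0 - h))) x0| <=
  4 * drift_const / al * Kdrift * h `^ (al / 2).
Proof.
move=> t0I h0 hr lot.
have /andP[lot0 t0hi] : lo < t0 <= hi by move: t0I; rewrite in_itv.
have t0I' : t0 \in `[lo, hi] by rewrite in_itv /= t0hi ltW.
have := @evol_inc_pos (frozen t0 x0) (fun i => frozen_ge0 x0 i t0I') (2 * drift_const * Kdrift)
  (al / 2) [:: e] t0 x0 (t0 - h) t0.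
rewrite /evol /= subrr subKr (nabla_ext e (g := u t0)); last by move=> y; rewrite heatop0.
rewrite (_ : 2 * drift_const * Kdrift / (al / 2) = 4 * drift_const / al * Kdrift); last first.
  by field; rewrite gt_eqF.
apply => //; rewrite ?divr_gt0 ?Kdrift_const_ge0 ?ltrBlDr ?ltrDl//.
move=> r; rewrite in_itv /= => /andP[r1 r2].
have sr0 : 0 < t0 - r by rewrite subr_gt0.
have := @drift_scaled t0 x0 r (t0 - r) [:: e] x0 t0I'.
rewrite /= (_ : (al + 1 - 1%:R) / 2 - 1 = al / 2 - 1); last by field.
apply => //; rewrite ?psi0 ?in_itv ?gtr0_norm //=; lra.
Qed.

(** The drift between [lo] and [tau] is dominated by its part near [tau]. The data at [lo] have been
    smoothed for a time at least [rho ^+ 2] and obey the same power of [t - tau]. *)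
Lemma evol_far (t0 t tau : R) x0 x es : t0 \in `[lo, hi] ->
  (1 < size es < 4)%N -> lo + rho ^+ 2 <= t -> t - lo <= 2 * rho ^+ 2 ->
  lo <= tau -> tau < t -> tau <= hi ->
  (forall r, lo <= r -> r <= tau -> `|t0 - r| <= 2 * (t - r)) ->
  psi x0 x <= 2 * (t - tau) ->
  `|nablas es (heatop (frozen t0 x0) (t - tau) (u tau)) x| <=
  (4 * drift_const / (1 - al) + ker_const) * Kfar * (t - tau) `^ ((al + 1 - (size es)%:R) / 2).
Proof.
move=> t0I /andP[es1 es4] tlo tlo2 lotau taut tauhi ht hpsi.
have es2 : 2 <= (size es)%:R :> R by rewrite ler_nat.
set p := (_ / 2); have p0 : p < 0 by rewrite /p; have := al1; lra.
have pal : (1 - al) / 2 <= - p by rewrite /p; lra.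
have bcm i : cm <= frozen t0 x0 i by exact: frozen_ell.
have b0 i : 0 <= frozen t0 x0 i by exact: frozen_ge0.
have al10 : 0 < 1 - al by rewrite subr_gt0.
have loI : lo \in `[lo, hi] by rewrite in_itv /= lexx (le_trans lotau).
have init : `|evol (frozen t0 x0) es t x lo| <= ker_const * Kfar * (t - tau) `^ p.
  have tlo0 : 0 < t - lo by lra.
  apply: le_trans (nablas_ker_sup x bcm (ltnW es4) tlo0 U0 (fun y => u_bnd y loI)) _.
  rewrite -!mulrA ler_wpM2l ?ker_const_ge0//.
  (* The first part of the exponent is spent on [t - lo >= rho ^+ 2], the rest on
     [t - lo >= t - tau]. *)
  have -> : - ((size es)%:R / 2) = - ((1 + al) / 2) + p by rewrite /p; field.
  rewrite (powR_add _ _ tlo0) mulrAC ler_pM ?mulr_ge0 ?powR_ge0//; last first.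
    by apply: powR_le_neg; rewrite ?(ltW p0) ?subr_gt0// lerD2l lerN2.
  rewrite mulrC; apply: (@le_trans _ _ (U * rho `^ (- (1 + al)))); last first.
    by rewrite lerDr Kdrift_ge0.
  rewrite ler_wpM2l// -[X in _ <= _ `^ X](_ : 2 * (- ((1 + al) / 2)) = _); last by field.
  rewrite -sqr_powR ?(ltW rho0)//; apply: powR_le_neg; rewrite ?exprn_gt0//; last by lra.
  by have := al0; lra.
have cf : 4 * drift_const / (1 - al) * Kfar = 4 * drift_const * Kfar / (1 - al) by ring.
have cd0 : 0 <= 4 * drift_const * Kfar / (1 - al).
  by rewrite (divr_ge0 _ (ltW al10))// (mulr_ge0 _ Kfar_ge0)// (mulr_ge0 _ drift_const_ge0).
rewrite mulrDl cf mulrDl.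
have [tlo'|tlo'] := eqVneq lo tau.
  by rewrite -tlo'; apply: le_trans init _; rewrite tlo' lerDr mulr_ge0 ?powR_ge0.
have lott : lo < tau by rewrite lt_neqAle tlo'.
have inc := @evol_inc_neg (frozen t0 x0) b0 (2 * drift_const * Kdrift) p es t x lo tau
  Kdrift_const_ge0 p0
  (lexx _) lott tauhi taut.
have {}inc : `|evol (frozen t0 x0) es t x tau - evol (frozen t0 x0) es t x lo| <=
    2 * drift_const * Kdrift / - p * (t - tau) `^ p.
  apply: inc => r; rewrite in_itv /= => /andP[r1 r2].
  apply: drift_scaled => //; rewrite ?in_itv ?(ht _ r1 (ltW r2))//=; lra.
have -> : nablas es (heatop (frozen t0 x0) (t - tau) (u tau)) x =
    (evol (frozen t0 x0) es t x tau - evol (frozen t0 x0) es t x lo)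
    + evol (frozen t0 x0) es t x lo by rewrite subrK.
apply: le_trans (ler_normD _ _) _; apply: lerD init; apply: le_trans inc _.
apply: ler_wpM2r; first exact: powR_ge0.
have -> : 4 * drift_const * Kfar / (1 - al) = 2 * drift_const * Kfar / ((1 - al) / 2).
  by field; rewrite gt_eqF.
apply: ler_pM; rewrite ?invr_ge0 ?oppr_ge0 ?(ltW p0) ?Kdrift_const_ge0//.
  by rewrite ler_wpM2l ?Kdrift_le// (mulr_ge0 _ drift_const_ge0).
by rewrite lef_pV2 ?posrE ?divr_gt0 ?oppr_gt0.
Qed.

(* The constant-coefficient operators commute, so both difference quotients
   may act on the semigroup that has run for the longer time. *)
Lemma heatop_switch (b b' : 'I_n -> R) e (h : R) f x (beta M : R) :
  (forall i, cm <= b i) -> (forall i, cm <= b' i) -> (forall i, `|b i - b' i| <= beta) ->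
  (forall e y, `|nabla e f y| <= M) -> 0 < h -> 0 <= M ->
  `|nabla e (heatop b h f) x - nabla e (heatop b' h f) x| <= 2 * n%:R * ker_const * beta * M.
Proof.
move=> bcm b'cm bb fM h0 M0.
have b0 i : 0 <= b i by exact: le_trans (ltW cm0) (bcm i).
have b'0 i : 0 <= b' i by exact: le_trans (ltW cm0) (b'cm i).
pose w s := heatop b' s f.
pose dphi s := nablas [:: e] (heatop b (h - s) (fun y => heatop b' s (lap b' f) y - lap b (w
  s) y)) x.
have dphiE s y : heatop b' s (lap b' f) y - lap b (w s) y =
    -1 * \sum_(i < n) (b' i - b i) * nabla (i, false) (heatop b' s (nabla (i, true) f)) y.
  rewrite -lap_heatop -/(w s).
  have := @gen_flux (fun _ e => b' e.1) b (w s) y (fun _ _ => erefl).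
  rewrite /gen -/(lap b' (w s) y) => ->; rewrite mulN1r; congr (- _).
  apply: eq_bigr => i _; rewrite nablaZ; congr (_ * _); apply: nabla_ext => z.
  by rewrite /w nabla_heatop.
have hder s : is_derive s (1 : R) (fun s => nablas [:: e] (heatop b (h - s) (w s)) x) (dphi s).
  apply: nablas_derive => y; apply: heatop_derive => // z; exact: heatop_time_derive.
have hF s : is_derive s (1 : R) (fun s => (2 * n%:R * ker_const * beta * M / h) * s) (2 *
  n%:R * ker_const * beta * M / h).
  by apply: is_derive_eq (is_derive_scale _ (is_derive_id s 1)) _; rewrite mulr1.
have := @norm_sub_le_derive R _ dphi _ _ (2 * n%:R * ker_const * beta * M) 0 h h0
  (fun s _ => hder s) (fun s _ => hF s).
rewrite /= distrC /w subrr subr0 => H.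
rewrite (nabla_ext e x (g := heatop b h (heatop b' 0 f))); last first.
  by move=> y; apply: heatop_ext => z; rewrite heatop0.
rewrite [X in _ - X](nabla_ext e x (g := heatop b 0 (heatop b' h f))); last first.
  by move=> y; rewrite heatop0.
rewrite distrC in H *; apply: H.
- move=> s; rewrite in_itv /= => /andP[s0 sh].
  have ker z (c : 'I_n -> R) v i : (forall i, cm <= c i) -> h / 2 <= z -> (forall y, `|v y|
    <= M) ->
      `|nablas [:: e; (i, false)] (heatop c z v) x| <= ker_const * (2 / h) * M.
    move=> ccm hz vM; have z0 : 0 < z by apply: lt_le_trans hz; rewrite divr_gt0.
    apply: le_trans (nablas_ker_sup (es := [:: e; (i, false)]) x ccm isT z0 M0 vM) _.
    rewrite ler_wpM2r// ler_wpM2l ?ker_const_ge0// (_ : - (2%:R / 2) = - 1 :> R); last by field.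
    by rewrite powR_inv1 ?(ltW z0)// -[leRHS]invf_div lef_pV2 ?posrE// divr_gt0.
  have kern i : `|nablas [:: e; (i, false)] (heatop b (h - s) (heatop b' s (nabla (i, true)
    f))) x|
      <= ker_const * (2 / h) * M.
    have hs0 : 0 <= h - s by rewrite subr_ge0 ltW.
    have [hs|hs] := leP (h / 2) (h - s).
      by apply: ker => // y; exact: heatop_norm.
    rewrite (nablas_ext [:: e; (i, false)]
      (g := heatop b' s (heatop b (h - s) (nabla (i, true) f)))); last first.
      by move=> y; rewrite heatopC.
    by apply: ker => //; [lra|move=> y; exact: heatop_norm].
  rewrite /dphi (nablas_ext [:: e] (g := fun y => - \sum_(i < n)
    (b' i - b i) * nabla (i, false) (heatop b (h - s) (heatop b' s (nabla (i, true) f))) y)).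
    rewrite nablasN normrN nablas_sum; apply: le_trans (ler_norm_sum _ _ _) _.
    apply: (@le_trans _ _ (\sum_(i < n) beta * (ker_const * (2 / h) * M))).
      apply: ler_sum => i _; rewrite /nablas /= nablaZ normrM.
      by apply: ler_pM => //; [rewrite distrC; exact: bb|exact: kern].
    rewrite sumr_const card_ord -[leLHS]mulr_natl.
    by rewrite [leRHS](_ : _ = n%:R * (beta * (ker_const * (2 / h) * M)))//; ring.
  move=> y; rewrite (heatop_ext b (h - s) y (dphiE s)) heatopZ mulN1r heatop_sum.
  congr (- _); apply: eq_bigr => i _; rewrite heatopZ nabla_heatop.
  by congr (_ * _); apply: heatop_ext => z; rewrite nabla_heatop.
- apply: cvg_at_left_filter.
  by move: (is_derive_continuous_at (hder h)); rewrite /prop_for /continuous_at /w /= subrr.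
- move=> s; rewrite in_itv /= => /andP[s0 sh]; rewrite mulr0 subr0.
  rewrite mulrAC ler_pdivrMr// ler_wpM2l ?(ltW sh)//.
  case: (posnP n) => [n0|n0]; first by rewrite n0 mulr0 !mul0r.
  have beta0 : 0 <= beta by apply: le_trans (bb (Ordinal n0)).
  by rewrite !mulr_ge0 ?ker_const_ge0.
Qed.

Lemma nabla_walk (f : V -> R) x i (k : nat) (B : R) : 0 < nu ->
  (forall l, (l < k)%N -> `|nabla (i, true) f (x + eps (i, true) *+ l)| <= B) ->
  `|f (x + eps (i, true) *+ k) - f x| <= k%:R / nu * B.
Proof.
move=> nu0; elim: k => [|k IH] hB; first by rewrite addr0 subrr normr0 !mul0r.
have h1 := IH (fun l lk => hB l (ltnW lk)).
have := hB k (ltnSn k); rewrite /nabla normrM gtr0_norm// mulrC -ler_pdivlMr// => h2.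
rewrite mulrSr addrA (_ : _ - f x = (f (x + eps (i, true) *+ k + eps (i, true)) -
  f (x + eps (i, true) *+ k)) + (f (x + eps (i, true) *+ k) - f x)); last by rewrite subrKA.
apply: le_trans (ler_normD _ _) _; rewrite -natr1 mulrDl mulrDl addrC.
by apply: lerD => //; apply: le_trans h2 _; rewrite mul1r mulrC.
Qed.

Context (cp0 : 0 <= cp).

Lemma AsMs_le : As * Ms <= Kfar.
Proof. by apply: le_trans Kdrift_le; rewrite lerDl mulr_ge0 ?powR_ge0. Qed.

Definition far_const : R := 4 * drift_const / (1 - al) + ker_const.

(** The summands belong in turn to the comparison of [u] with frozen semigroups, the exchange of
    coefficients, the motion in time and the motion in space. *)
Definition hoelder_const : R := 16 * drift_const / al + 2 * n%:R * ker_const + n%:R * cp *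
  far_const + far_const.

Lemma powR_sqr_half (r p : R) : 0 <= r -> (r ^+ 2) `^ (p / 2) = r `^ p.
Proof. by move=> r0; rewrite sqr_powR//; congr (_ `^ _); field. Qed.

Lemma far_const_ge0 : 0 <= far_const.
Proof.
rewrite addr_ge0 ?ker_const_ge0// divr_ge0 ?subr_ge0 ?(ltW al1)//.
by rewrite (mulr_ge0 _ drift_const_ge0).
Qed.

Lemma grad_holder_space (t r : R) x e i (k : nat) : 0 < nu -> (0 < k)%N ->
  r = k%:R / nu -> r <= rho -> t = hi -> lo = t - rho ^+ 2 ->
  (forall l, (l <= k)%N -> psi x (x + eps (i, true) *+ l) <= (l%:R / nu) ^+ 2) ->
  `|nabla e (u t) (x + eps (i, true) *+ k) - nabla e (u t) x| <=
    hoelder_const * Kfar * r `^ al.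
Proof.
move=> nu0 k0 rE rrho thi loE hpsi.
have r0 : 0 < r by rewrite rE divr_gt0// ltr0n.
have r2rho : r ^+ 2 <= rho ^+ 2 by rewrite ler_pXn2r ?nnegrE ?(ltW r0) ?(ltW rho0).
have r20 : 0 < r ^+ 2 by rewrite exprn_gt0.
have tI : t \in `]lo, hi] by rewrite in_itv /=; apply/andP; split; lra.
have tI' : t \in `[lo, hi] by rewrite in_itv /=; apply/andP; split; lra.
have tauI : t - r ^+ 2 \in `[lo, hi] by rewrite in_itv /=; apply/andP; split; lra.
pose y := x + eps (i, true) *+ k.
pose w z := heatop (frozen t z) (r ^+ 2) (u (t - r ^+ 2)).
have near z : `|nabla e (u t) z - nabla e (w z) z| <= 4 * drift_const / al * Kdrift * r `^ al.
  by rewrite -(powR_sqr_half al (ltW r0)); apply: grad_near => //; lra.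
have sw : `|nabla e (w x) y - nabla e (w y) y| <=
    2 * n%:R * ker_const * (As * r `^ al) * Ms.
  apply: heatop_switch => //.
  - by move=> j; exact: frozen_ell.
  - by move=> j; exact: frozen_ell.
  - move=> j; rewrite distrC; apply: le_trans (a_hol _ _ _ tI' tI') _.
    rewrite subrr normr0 add0r ler_wpM2l// -(powR_sqr_half al (ltW r0)).
    apply: ge0_ler_powR; rewrite ?nnegrE ?(ltW r20) ?psi_ge0 ?divr_ge0 ?(ltW al0)//.
    by rewrite rE; exact: hpsi.
  - by move=> ? ?; exact: u_grad.
have mv : `|nabla e (w x) y - nabla e (w x) x| <= far_const * Kfar * r `^ al.
  apply: le_trans (nabla_walk (B := far_const * Kfar * r `^ (al - 1)) nu0 _) _.
    move=> l lk; rewrite -/(nablas [:: (i, true); e] (w x) _).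
    rewrite -(powR_sqr_half (al - 1) (ltW r0)).
    have := @evol_far t t (t - r ^+ 2) x (x + eps (i, true) *+ l) [:: (i, true); e] tI' isT.
    rewrite subKr /= (_ : al + 1 - 2%:R = al - 1); last by ring.
    apply; try lra.
      by move=> s s1 s2; rewrite ger0_norm; lra.
    apply: le_trans (hpsi l (ltnW lk)) _.
    apply: (@le_trans _ _ (r ^+ 2)); last by lra.
    by rewrite rE ler_pXn2r ?nnegrE ?divr_ge0 ?(ltW nu0)// ler_wpM2r ?invr_ge0 ?(ltW nu0)//
      ler_nat ltnW.
  rewrite -rE mulrCA [leLHS](_ : _ = far_const * Kfar * (r * r `^ (al - 1))); last by ring.
  by rewrite mulr_powRB1// ltW.
have -> : nabla e (u t) y - nabla e (u t) x =
  (nabla e (u t) y - nabla e (w y) y) + - (nabla e (w x) y - nabla e (w y) y)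
  + (nabla e (w x) y - nabla e (w x) x) - (nabla e (u t) x - nabla e (w x) x) by ring.
have four (p q s z : R) : `|p - q + s - z| <= `|p| + `|q| + `|s| + `|z|.
  by do 3 (apply: le_trans (ler_normB _ _) _ || apply: le_trans (ler_normD _ _) _;
    rewrite ?lerD2r).
apply: le_trans (four _ _ _ _) _.
apply: le_trans (lerD (lerD (lerD (near y) sw) mv) (near x)) _.
have ra0 : 0 <= r `^ al by exact: powR_ge0.
have cd0 : 0 <= drift_const / al by rewrite divr_ge0 ?(ltW al0) ?drift_const_ge0.
apply: (@le_trans _ _ ((8 * (drift_const / al) + 2 * n%:R * ker_const + far_const) * Kfar * r
  `^ al)).
  rewrite [leLHS](_ : _ = ((8 * (drift_const / al)) * Kdrift + 2 * n%:R * ker_const * (As * Ms)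
    + far_const * Kfar) * r `^ al); last by ring.
  rewrite [leRHS](_ : _ = ((8 * (drift_const / al)) * Kfar + 2 * n%:R * ker_const * Kfar
    + far_const * Kfar) * r `^ al); last by ring.
  apply: ler_wpM2r => //; rewrite lerD2r; apply: lerD.
    by apply: ler_wpM2l; rewrite ?Kdrift_le ?(mulr_ge0 _ cd0).
  by apply: ler_wpM2l; rewrite ?AsMs_le// !mulr_ge0 ?ker_const_ge0.
apply: ler_wpM2r => //; apply: ler_wpM2r; first exact: Kfar_ge0.
have : 0 <= n%:R * cp * far_const by rewrite !mulr_ge0 ?far_const_ge0.
rewrite /hoelder_const; lra.
Qed.

(** In this form a time derivative of the semigroup amounts to two further differences. *)
Lemma lap_nablas b f x :
  lap b f x = - \sum_(i < n) b i * nablas [:: (i, false); (i, true)] f x.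
Proof.
have := @gen_flux (fun _ e => b e.1) (fun=> 0) f x (fun _ _ => erefl).
rewrite /gen -/(lap b f x) (_ : lap (fun=> 0) f x = 0); last first.
  by rewrite /lap big1 ?mulr0// => e _; rewrite mul0r.
rewrite subr0 => ->; congr (- _); apply: eq_bigr => i _; rewrite -nablaZ.
by apply: nabla_ext => y; rewrite subr0.
Qed.

Lemma nablasZ es c f x : nablas es (fun y => c * f y) x = c * nablas es f x.
Proof. by elim: es x => [//|e es IH] x; rewrite /= /nabla !IH; ring. Qed.

Lemma evol_time_move (t0 t s r : R) x es : t0 \in `[lo, hi] -> t0 = s -> (size es < 2)%N ->
  0 < r -> r <= rho -> lo = s - rho ^+ 2 -> s <= t -> t - s <= r ^+ 2 ->
  `|nablas es (heatop (frozen t0 x) (t - (s - r ^+ 2)) (u (s - r ^+ 2))) x -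
    nablas es (heatop (frozen t0 x) (s - (s - r ^+ 2)) (u (s - r ^+ 2))) x| <=
  n%:R * cp * far_const * Kfar * r `^ (al + 1 - (size es)%:R).
Proof.
move=> t0I t0s es2 r0 rrho loE st tsr; set tau := s - r ^+ 2; set b := frozen t0 x.
have r2rho : r ^+ 2 <= rho ^+ 2 by rewrite ler_pXn2r ?nnegrE ?(ltW r0) ?(ltW rho0).
have r20 : 0 < r ^+ 2 by rewrite exprn_gt0.
have [<-|tns] := eqVneq s t.
  by rewrite subrr normr0 mulr_ge0 ?powR_ge0// !mulr_ge0 ?far_const_ge0 ?Kfar_ge0.
have {tns}st : s < t by rewrite lt_neqAle tns.
have b0 i : 0 <= b i by exact: frozen_ge0.
set j := size es; set f := u tau; set B := n%:R * cp * far_const * Kfar.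
have hder t' : is_derive t' (1 : R) (fun t' => nablas es (heatop b (t' - tau) f) x)
    (nablas es (heatop b (t' - tau) (lap b f)) x).
  apply: nablas_derive => y.
  have h1 : is_derive t' (1 : R) (fun t' : R => t' - tau) 1.
    by apply: is_derive_eq (is_derive_sub (is_derive_id t' 1) (is_derive_cst tau t' 1)) _;
      rewrite subr0.
  have := @is_derive1_comp R (fun z => heatop b z f y) (fun t' => t' - tau) t' _ _
    (heatop_time_derive b0 (t' - tau) f y) h1.
  by rewrite mulr1.
have hF t' : is_derive t' (1 : R) (fun t' => B * r `^ (al - 1 - j%:R) * t') (B * r `^ (al - 1
  - j%:R)).
  by apply: is_derive_eq (is_derive_scale _ (is_derive_id t' 1)) _; rewrite mulr1.
have jle : j%:R <= 1 :> R by rewrite lern1 -ltnS.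
have B0 : 0 <= B by rewrite !mulr_ge0 ?far_const_ge0 ?Kfar_ge0.
have /andP[_ shi] : lo <= s <= hi by rewrite -t0s; move: t0I; rewrite in_itv.
have := @norm_sub_le_derive R _ _ _ _ (B * r `^ (al + 1 - j%:R)) s t st
  (fun s _ => hder s) (fun s _ => hF s).
apply.
- move=> t' /=; rewrite in_itv /= => /andP[st' t't].
  rewrite (nablas_ext es (g := fun y => - \sum_(i < n) b i *
      nablas [:: (i, false); (i, true)] (heatop b (t' - tau) f) y)); last first.
    by move=> y; rewrite -lap_nablas lap_heatop.
  rewrite nablasN normrN nablas_sum; apply: le_trans (ler_norm_sum _ _ _) _.
  apply: (@le_trans _ _ (\sum_(i < n) cp * (far_const * Kfar * r `^ (al - 1 - j%:R)))).
    apply: ler_sum => i _; rewrite nablasZ -nablas_cat normrM ger0_norm//.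
    apply: ler_pM => //; first exact: frozen_le.
    have szE : size (es ++ [:: (i, false); (i, true)]) = j.+2 by rewrite size_cat addn2.
    have := @evol_far t0 t' tau x x (es ++ [:: (i, false); (i, true)]) t0I.
    rewrite szE ltnS /= => h; apply: le_trans (h _ _ _ _ _ _ _ _) _; rewrite ?psi0 /tau; try
      lra.
    + by rewrite -[(j.+2 < 4)%N]/(j < 2)%N.
    + by move=> z z1 z2; rewrite t0s ger0_norm; lra.
    rewrite ler_wpM2l ?mulr_ge0 ?far_const_ge0 ?Kfar_ge0//.
    rewrite (_ : al + 1 - j.+2%:R = al - 1 - j%:R); last by rewrite -addn2 natrD; ring.
    rewrite -[leRHS](powR_sqr_half _ (ltW r0)).
    have j0 : 0 <= j%:R :> R by exact: ler0n.
    by apply: powR_le_neg => //; [have := al1; lra|lra].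
  rewrite sumr_const card_ord -[leLHS]mulr_natl /B.
  by rewrite [leRHS](_ : _ = n%:R * (cp * (far_const * Kfar * r `^ (al - 1 - j%:R))))//; ring.
- by apply: cvg_at_left_filter; exact: (is_derive_continuous_at (hder t)).
- move=> z; rewrite in_itv /= => /andP[sz zt]; rewrite -mulrBr -mulrA ler_wpM2l//.
  have -> : al + 1 - j%:R = al - 1 - j%:R + 2%:R by ring.
  by rewrite (powR_add (al - 1 - j%:R) 2%:R r0) powR_mulrn ?(ltW r0)// ler_wpM2l ?powR_ge0//;
    lra.
Qed.

Lemma grad_holder_time (t s r : R) x e : 0 < r -> r <= rho -> t = hi ->
  lo = s - rho ^+ 2 -> t - s = r ^+ 2 ->
  `|nabla e (u t) x - nabla e (u s) x| <= hoelder_const * Kfar * r `^ al.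
Proof.
move=> r0 rrho thi loE tsE.
have r2rho : r ^+ 2 <= rho ^+ 2 by rewrite ler_pXn2r ?nnegrE ?(ltW r0) ?(ltW rho0).
have r20 : 0 < r ^+ 2 by rewrite exprn_gt0.
have tI : t \in `]lo, hi] by rewrite in_itv /=; apply/andP; split; lra.
have tI' : t \in `[lo, hi] by rewrite in_itv /=; apply/andP; split; lra.
have sI : s \in `]lo, hi] by rewrite in_itv /=; apply/andP; split; lra.
have sI' : s \in `[lo, hi] by rewrite in_itv /=; apply/andP; split; lra.
set tau := s - r ^+ 2.
have tauI : tau \in `[lo, hi] by rewrite in_itv /= /tau; apply/andP; split; lra.
(* [z] is the time of freezing and [h] the time of evaluation; the start [tau] is common to all. *)
pose w (z h : R) := nabla e (heatop (frozen z x) (h - tau) (u tau)) x.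
have near1 : `|nabla e (u t) x - w t t| <= 4 * drift_const / al * Kdrift * (2 * r `^ al).
  have := @grad_near t (t - tau) x e tI; rewrite subKr => h.
  apply: (@le_trans _ _ (4 * drift_const / al * Kdrift * (t - tau) `^ (al / 2))).
    have A1 : 0 < t - tau by rewrite /tau; lra.
    have A2 : t - tau <= 2 * rho ^+ 2 by rewrite /tau; lra.
    have A3 : lo <= tau by rewrite /tau; lra.
    exact: h A1 A2 A3.
  rewrite /tau.
  apply: ler_wpM2l; first by rewrite mulr_ge0 ?Kdrift_ge0 ?divr_ge0 ?(ltW al0)// (mulr_ge0 _
    drift_const_ge0).
  rewrite (_ : t - (s - r ^+ 2) = 2 * r ^+ 2); last by lra.
  rewrite powRM ?sqr_ge0// (powR_sqr_half al (ltW r0)) ler_wpM2r ?powR_ge0//.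
  by apply: two_powR; have := al1; lra.
have near2 : `|nabla e (u s) x - w s s| <= 4 * drift_const / al * Kdrift * r `^ al.
  have := @grad_near s (s - tau) x e sI; rewrite (subKr s tau) => h.
  apply: (@le_trans _ _ (4 * drift_const / al * Kdrift * (s - tau) `^ (al / 2))).
    have A1 : 0 < s - tau by rewrite /tau; lra.
    have A2 : s - tau <= 2 * rho ^+ 2 by rewrite /tau; lra.
    have A3 : lo <= tau by rewrite /tau; lra.
    exact: h A1 A2 A3.
  rewrite /tau.
  by rewrite subKr (powR_sqr_half al (ltW r0)).
have sw : `|w t t - w s t| <= 2 * n%:R * ker_const * (As * r `^ al) * Ms.
  apply: heatop_switch => //.
  - by move=> j; exact: frozen_ell.
  - by move=> j; exact: frozen_ell.
  - move=> j; apply: le_trans (a_hol _ _ _ tI' sI') _.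
    rewrite psi0 addr0 tsE ger0_norm ?sqr_ge0//.
    by rewrite (powR_sqr_half al (ltW r0)).
  - by move=> ? ?; exact: u_grad.
  - by rewrite /tau; lra.
have mv : `|w s t - w s s| <= n%:R * cp * far_const * Kfar * r `^ al.
  have := @evol_time_move s t s r x [:: e] sI' erefl isT r0 rrho loE.
  rewrite /= (_ : al + 1 - 1%:R = al); last by ring.
  by apply; lra.
have -> : nabla e (u t) x - nabla e (u s) x =
  (nabla e (u t) x - w t t) - - (w t t - w s t)
  + (w s t - w s s) - (nabla e (u s) x - w s s) by ring.
have four (p q s' z : R) : `|p - q + s' - z| <= `|p| + `|q| + `|s'| + `|z|.
  by do 3 (apply: le_trans (ler_normB _ _) _ || apply: le_trans (ler_normD _ _) _;
    rewrite ?lerD2r).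
apply: le_trans (four _ _ _ _) _; rewrite normrN.
apply: le_trans (lerD (lerD (lerD near1 sw) mv) near2) _.
have ra0 : 0 <= r `^ al by exact: powR_ge0.
have cd0 : 0 <= drift_const / al by rewrite divr_ge0 ?(ltW al0) ?drift_const_ge0.
apply: (@le_trans _ _ ((16 * (drift_const / al) + 2 * n%:R * ker_const + n%:R * cp *
  far_const) * Kfar * r `^ al)).
  rewrite [leLHS](_ : _ = ((12 * (drift_const / al)) * Kdrift + 2 * n%:R * ker_const * (As * Ms)
    + n%:R * cp * far_const * Kfar) * r `^ al); last by ring.
  rewrite [leRHS](_ : _ = ((16 * (drift_const / al)) * Kfar + 2 * n%:R * ker_const * Kfar
    + n%:R * cp * far_const * Kfar) * r `^ al); last by ring.
  apply: ler_wpM2r => //; rewrite lerD2r; apply: lerD.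
    by apply: ler_pM; rewrite ?Kdrift_le ?Kdrift_ge0 ?(mulr_ge0 _ cd0)//; lra.
  by apply: ler_wpM2l; rewrite ?AsMs_le// !mulr_ge0 ?ker_const_ge0.
apply: ler_wpM2r => //; apply: ler_wpM2r; first exact: Kfar_ge0.
have := far_const_ge0; rewrite /hoelder_const; lra.
Qed.

(** The freezing time [s] may precede [t] by [r ^+ 2], so the scale [2 * r ^+ 2] stays fixed while
    the smoothing time tends to 0, and [drift_bound] is applied directly. Without differences this
    leaves the integrable power -1/2. *)
Lemma value_near (t0 t s r : R) x : t0 = s -> t0 \in `[lo, hi] -> 0 < r -> r <= rho ->
  lo = s - rho ^+ 2 -> s <= t -> t - s <= r ^+ 2 -> t <= hi ->
  `|u t x - heatop (frozen t0 x) (t - (s - r ^+ 2)) (u (s - r ^+ 2)) x| <=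
  8 * drift_const * Kdrift * r `^ (1 + al).
Proof.
move=> t0s t0I r0 rrho loE st tsr thi; set b := frozen t0 x.
have r2rho : r ^+ 2 <= rho ^+ 2 by rewrite ler_pXn2r ?nnegrE ?(ltW r0) ?(ltW rho0).
have r20 : 0 < r ^+ 2 by rewrite exprn_gt0.
have b0 i : 0 <= b i by exact: frozen_ge0.
have ra0 : 0 <= r `^ al by exact: powR_ge0.
have := @evol_inc_pos b b0 (2 * drift_const * Kdrift * r `^ al) (1 / 2) [::] t x (s - r ^+ 2) t.
rewrite /evol /= subrr heatop0 => h; apply: le_trans (h _ _ _ _ _ _ _) _; try lra.
- by rewrite mulr_ge0 ?Kdrift_const_ge0.
- move=> z; rewrite in_itv /= => /andP[z1 z2].
  have zt0 : 0 < t - z by rewrite subr_gt0.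
  have zI : z \in `[lo, hi] by rewrite in_itv /=; apply/andP; split; lra.
  apply: le_trans (@drift_bound t0 x z (t - z) [::] x (2 * r ^+ 2) t0I zI isT zt0 _ _ _) _;
    rewrite ?psi0 ?t0s; try lra.
    by rewrite ler_norml; lra.
  rewrite /= mul0r oppr0 powRr0 mulr1 (_ : 1 / 2 - 1 = - (1%:R / 2)); last by field.
  set S := (t - z) `^ _.
  have S0 : 0 < S by rewrite powR_gt0.
  rewrite [leRHS](_ : _ = drift_const * (As * Ms * (2 * r `^ al) * S
    + G * (2 * rho `^ (1 - al) * r `^ al * S))); last by rewrite /Kdrift; ring.
  apply: ler_wpM2l; first exact: drift_const_ge0.
  apply: lerD.
    apply: ler_wpM2r; first exact: ltW.
    apply: ler_wpM2l; first by rewrite mulr_ge0.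
    rewrite powRM ?sqr_ge0// (powR_sqr_half al (ltW r0)) ler_wpM2r//.
    by apply: two_powR; have := al1; lra.
  rewrite -[leLHS]mulr1; apply: ler_wpM2l => //.
  have rsplit : r <= rho `^ (1 - al) * r `^ al.
    rewrite -[leLHS]powRr1 ?(ltW r0)// {1}(_ : 1 = (1 - al) + al); last by ring.
    rewrite (powR_add _ _ r0) ler_wpM2r//.
    by apply: ge0_ler_powR; rewrite ?nnegrE ?(ltW r0) ?(ltW rho0) ?subr_ge0 ?(ltW al1).
  (* The source term carries no power of the smoothing time; this factor gives it the common power
     [S]. *)
  have rS : 1 <= 2 * r * S.
    rewrite /S powRN ler_pdivlMr ?powR_gt0// mul1r.
    apply: (@le_trans _ _ ((2 * r ^+ 2) `^ (1 / 2))).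
      by apply: ge0_ler_powR; rewrite ?nnegrE ?(ltW zt0)//; lra.
    rewrite powRM ?sqr_ge0// (powR_sqr_half 1 (ltW r0)) powRr1 ?(ltW r0)//.
    by rewrite ler_wpM2r ?(ltW r0)//; apply: two_powR; lra.
  apply: le_trans rS _; rewrite ler_wpM2r ?(ltW S0)// -mulrA; lra.
have base : (t - (s - r ^+ 2)) `^ (1 / 2) <= 2 * r.
  apply: (@le_trans _ _ ((2 * r ^+ 2) `^ (1 / 2))).
    by apply: ge0_ler_powR; rewrite ?nnegrE //; lra.
  rewrite powRM ?sqr_ge0// (powR_sqr_half 1 (ltW r0)) powRr1 ?(ltW r0)//.
  by rewrite ler_wpM2r ?(ltW r0)//; apply: two_powR; lra.
rewrite (powR_add _ _ r0) powRr1 ?(ltW r0)//.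
rewrite [leRHS](_ : _ = 2 * drift_const * Kdrift * r `^ al / (1 / 2) * (2 * r)); last by field.
by apply: ler_wpM2l => //; rewrite (divr_ge0 (mulr_ge0 Kdrift_const_ge0 ra0)).
Qed.

(** Both times share the freezing point [(s, x)], so no coefficients are exchanged. *)
Lemma value_holder_time (t s r : R) x : 0 < r -> r <= rho -> t = hi ->
  lo = s - rho ^+ 2 -> t - s = r ^+ 2 ->
  `|u t x - u s x| <= hoelder_const * Kfar * r `^ (1 + al).
Proof.
move=> r0 rrho thi loE tsE.
have r2rho : r ^+ 2 <= rho ^+ 2 by rewrite ler_pXn2r ?nnegrE ?(ltW r0) ?(ltW rho0).
have r20 : 0 < r ^+ 2 by rewrite exprn_gt0.
have sI : s \in `[lo, hi] by rewrite in_itv /=; apply/andP; split; lra.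
pose w (h : R) := heatop (frozen s x) (h - (s - r ^+ 2)) (u (s - r ^+ 2)) x.
have near1 : `|u t x - w t| <= 8 * drift_const * Kdrift * r `^ (1 + al).
  by apply: value_near => //; lra.
have near2 : `|u s x - w s| <= 8 * drift_const * Kdrift * r `^ (1 + al).
  by apply: value_near => //; lra.
have mv : `|w t - w s| <= n%:R * cp * far_const * Kfar * r `^ (1 + al).
  have := @evol_time_move s t s r x [::] sI erefl isT r0 rrho loE.
  rewrite /= subr0 [al + 1]addrC.
  by apply; lra.
have -> : u t x - u s x = (u t x - w t) + (w t - w s) - (u s x - w s) by ring.
apply: le_trans (ler_normB _ _) _; apply: le_trans (lerD (ler_normD _ _) (lexx _)) _.
apply: le_trans (lerD (lerD near1 mv) near2) _.
have ra0 : 0 <= r `^ (1 + al) by exact: powR_ge0.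
rewrite [leLHS](_ : _ = (16 * drift_const * Kdrift + n%:R * cp * far_const * Kfar) * r `^ (1
  + al)); last by ring.
apply: ler_wpM2r => //.
apply: (@le_trans _ _ ((16 * drift_const + n%:R * cp * far_const) * Kfar)).
  rewrite [leRHS]mulrDl lerD2r; apply: ler_wpM2l; last exact: Kdrift_le.
  by rewrite (mulr_ge0 _ drift_const_ge0).
apply: ler_wpM2r; first exact: Kfar_ge0.
have h1 : 16 * drift_const <= 16 * drift_const / al.
  by rewrite ler_pdivlMr// ler_piMr ?(ltW al1)// (mulr_ge0 _ drift_const_ge0).
have h2 : 0 <= 2 * n%:R * ker_const by rewrite !mulr_ge0 ?ker_const_ge0.
have := far_const_ge0; rewrite /hoelder_const; lra.
Qed.

End Local.
End Generator.

(** * Estimates weighted by the distance to the initial time *)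

Section Weighted.
Context {R : realType} {V : finZmodType} {n : nat}.
Variables (nu : R) (eps : dir n -> V).
Context (nu0 : 0 < nu) (eps_opp : forall e, eps (dir_opp e) = - eps e).
Variables (cm cp c1 al T : R).
Context (cm0 : 0 < cm) (cp0 : 0 <= cp) (c10 : 0 <= c1) (al0 : 0 < al) (al1 : al < 1).
Context (T0 : 0 < T).
Variables (psi : V -> V -> R).
Context (psi0 : forall x, psi x x = 0) (psi_ge0 : forall x y, 0 <= psi x y).
Context (psi_lap : forall (b : 'I_n -> R) x y, (forall i, 0 <= b i <= cp) -> lap nu eps b
  (psi x) y <= c1).
Context (psi_step : forall x i (k : nat), psi x (x + eps (i, true) *+ k) <= (k%:R / nu) ^+ 2).
Variables (a : R -> V -> dir n -> R) (g u : R -> V -> R) (A G U : R).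
Context (A0 : 0 <= A) (G0 : 0 <= G) (U0 : 0 <= U).
Context (a_sym : forall (s : R) x e, s \in `[0, T] -> a s x e = a s (x + eps e) (dir_opp e)).
Context (a_ell : forall (s : R) x e, s \in `[0, T] -> cm <= a s x e <= cp).
Context (a_hol : forall (s t : R) x y i, s \in `]0, T] -> t \in `]0, T] ->
  Num.min (Num.sqrt s) (Num.sqrt t) `^ al * `|a s y (i, true) - a t x (i, true)| <=
  A * (`|s - t| + psi x y) `^ (al / 2)).
Context (u_bnd : forall (s : R) x, s \in `[0, T] -> `|u s x| <= U).
Context (g_bnd : forall (s : R) x, s \in `[0, T] -> `|g s x| <= G).
Context (u_der : forall (s : R) x, s \in `]0, T[ ->
  is_derive s (1 : R) (fun s => u s x) (gen nu eps (a s) (u s) x + g s x)).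
Context (u_left : forall (t : R) x, t \in `]0, T] -> u s x @[s --> t^'-] --> u t x).

(** Four times the constant of [grad_near]: the coefficients and the gradient each lose a factor 2
    when weights near [t0] are replaced by the weight at [t0]. *)
Definition near_const : R := 16 * drift_const (n := n) cm c1 / al.
(** The part of [theta0^-1] that does not depend on [A]. *)
Definition theta_scale : R := (2 * (near_const + 1)) `^ al^-1.

(* Fraction of the parabolic distance [sqrt t] on which the oscillation of the
   coefficients is small enough for the perturbation to be absorbed. *)
Definition theta0 : R := (2 * (near_const + 1) * (A + 1)) `^ (- al^-1).
Definition grad_const : R := 2 * (ker_const cm * theta_scale + near_const * T).
Definition Mgrad : R := grad_const * ((A + 1) `^ al^-1 * U + (A + 1)^-1 * G).
Definition data_size : R := (A + 1) `^ (1 + al^-1) * U + G.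

Lemma near_const_ge0 : 0 <= near_const.
Proof. by rewrite divr_ge0 ?(ltW al0)// mulr_ge0 ?drift_const_ge0. Qed.

Let AA : 0 < A + 1. Proof. by rewrite ltr_wpDl. Qed.
Let CC : 0 < 2 * (near_const + 1). Proof. by have := near_const_ge0; lra. Qed.
Let ial : 1 <= al^-1. Proof. by rewrite invf_ge1// ltW. Qed.

Lemma theta0_gt0 : 0 < theta0.
Proof. by rewrite powR_gt0// (mulr_gt0 CC AA). Qed.

Lemma theta0_al : theta0 `^ al = (2 * (near_const + 1) * (A + 1))^-1.
Proof. by rewrite -powRrM mulNr mulVf ?gt_eqF// powR_inv1// (ltW (mulr_gt0 CC AA)). Qed.

Lemma theta0_inv : theta0^-1 = theta_scale * (A + 1) `^ al^-1.
Proof. by rewrite /theta0 powRN invrK powRM ?(ltW CC) ?(ltW AA). Qed.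

(** Base and exponent [al^-1] are both at least 1, so the power exceeds the base. This is the origin
    of the factor [(A + 1)^-1] in front of [G]. *)
Lemma theta0_le_inv : theta0 <= (A + 1)^-1 / 2.
Proof.
have P1 : 0 < 2 * (near_const + 1) * (A + 1) := mulr_gt0 CC AA.
have P2 : 0 < (A + 1) * 2 by rewrite mulr_gt0.
rewrite -invfM /theta0 powRN lef_pV2 ?posrE ?powR_gt0 ?P1 ?P2//.
have h : (A + 1) * 2 <= 2 * (near_const + 1) * (A + 1).
  by rewrite mulrC ler_wpM2r ?(ltW AA)//; have := near_const_ge0; lra.
apply: le_trans h _; apply: le1r_powR; last exact: ial.
by apply: mulr_ege1; [have := near_const_ge0|have := A0]; lra.
Qed.

Lemma theta0_le_half : theta0 <= 1 / 2.
Proof.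
apply: le_trans theta0_le_inv _; by rewrite ler_wpM2r// invf_le1//; have := A0; lra.
Qed.

(** * The neighbourhood of a fixed positive time *)

Section LocalData.
Variables (t0 M : R).
Context (t00 : 0 < t0) (t0T : t0 <= T) (M0 : 0 <= M).
Context (u_M : forall (s : R) x e, s \in `]0, T] -> Num.sqrt s * `|nabla nu eps e (u s) x| <=
  M).

Let d := Num.sqrt t0.
Let rho := theta0 * d.
Let lo := t0 - rho ^+ 2.

Let d0 : 0 < d. Proof. by rewrite sqrtr_gt0. Qed.
Let d2 : d ^+ 2 = t0. Proof. by rewrite sqr_sqrtr// ltW. Qed.
Let rho0 : 0 < rho. Proof. by rewrite mulr_gt0 ?theta0_gt0. Qed.

(** As [theta0 <= 1 / 2], the neighbourhood stays away from the initial time, and the weight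
    [Num.sqrt s] loses at most a factor 2 on it. *)
Lemma lo_ge : t0 / 4 <= lo.
Proof.
rewrite /lo /rho exprMn d2.
have : theta0 ^+ 2 <= (1 / 2) ^+ 2.
  by rewrite ler_pXn2r ?nnegrE ?(ltW theta0_gt0) ?theta0_le_half//; lra.
by move=> /(ler_wpM2r (ltW t00)); have := t00; lra.
Qed.

Lemma sqrt_lo (s : R) : lo <= s -> d / 2 <= Num.sqrt s.
Proof.
move=> los; rewrite -(ler_pXn2r (ltn0Sn 1)) ?nnegrE ?sqrtr_ge0 ?divr_ge0 ?(ltW d0)//.
have s0 : 0 <= s by have := lo_ge; have := t00; have := t0T; lra.
by rewrite sqr_sqrtr// exprMn d2; have := lo_ge; have := t00; have := t0T; lra.
Qed.

Lemma local_hol (hi s t : R) x y i : hi <= T -> s \in `[lo, hi] -> t \in `[lo, hi] ->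
  `|a s y (i, true) - a t x (i, true)| <=
    (2 * A / d `^ al) * (`|s - t| + psi x y) `^ (al / 2).
Proof.
move=> hiT; rewrite !in_itv /= => /andP[s1 s2] /andP[t1 t2].
have sI : s \in `]0, T] by rewrite in_itv /=; have := lo_ge; have := t00; have := t0T; lra.
have tI : t \in `]0, T] by rewrite in_itv /=; have := lo_ge; have := t00; have := t0T; lra.
have m1 : d / 2 <= Num.min (Num.sqrt s) (Num.sqrt t) by rewrite le_min !sqrt_lo.
have m2 : d `^ al / 2 <= Num.min (Num.sqrt s) (Num.sqrt t) `^ al.
  apply: (@le_trans _ _ ((d / 2) `^ al)).
    rewrite powRM ?invr_ge0 ?(ltW d0)// ler_wpM2l ?powR_ge0//.
    rewrite -[leLHS]powRr1 ?invr_ge0//; apply: ger_powR; last exact: ltW.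
    by rewrite invr_gt0 ltr0n invf_le1 ?ler1n.
  have m3 : 0 <= Num.min (Num.sqrt s) (Num.sqrt t) by rewrite le_min !sqrtr_ge0.
  have m4 : 0 <= d / 2 by rewrite divr_ge0 ?(ltW d0).
  by apply: ge0_ler_powR; rewrite ?nnegrE ?(ltW al0).
have := a_hol x y i sI tI; have p0 := powR_gt0 al d0.
move: (_ `^ (al / 2)) => Y h.
rewrite (_ : 2 * A / d `^ al * Y = A * Y / (d `^ al / 2)); last by field; rewrite gt_eqF.
rewrite ler_pdivlMr ?divr_gt0// mulrC; apply: le_trans h.
by rewrite ler_wpM2r.
Qed.

Lemma local_grad (hi s : R) x e : hi <= T -> s \in `[lo, hi] ->
  `|nabla nu eps e (u s) x| <= 2 * M / d.
Proof.
move=> hiT; rewrite in_itv /= => /andP[s1 s2].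
have sI : s \in `]0, T] by rewrite in_itv /=; have := lo_ge; have := t00; have := t0T; lra.
rewrite (_ : 2 * M / d = M / (d / 2)); last by field; rewrite gt_eqF.
rewrite ler_pdivlMr ?divr_gt0// mulrC; apply: le_trans (u_M x e sI).
by rewrite ler_wpM2r// sqrt_lo.
Qed.

Lemma lo_gt0 : 0 < lo.
Proof. by have := lo_ge; have := t00; lra. Qed.

Lemma sub_cc (hi s : R) : hi <= T -> s \in `[lo, hi] -> s \in `[0, T].
Proof. by move=> hiT; rewrite !in_itv /= => /andP[? ?]; have := lo_gt0; lra. Qed.

Lemma sub_co (hi s : R) : hi <= T -> s \in `[lo, hi[ -> s \in `]0, T[.
Proof. by move=> hiT; rewrite !in_itv /= => /andP[? ?]; have := lo_gt0; lra. Qed.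

Lemma sub_oc (hi s : R) : hi <= T -> s \in `]lo, hi] -> s \in `]0, T].
Proof. by move=> hiT; rewrite !in_itv /= => /andP[? ?]; have := lo_gt0; lra. Qed.

Let As := 2 * A / d `^ al.
Let Ms := 2 * M / d.
Let As0 : 0 <= As. Proof. by rewrite divr_ge0 ?powR_ge0// mulr_ge0. Qed.
Let Ms0 : 0 <= Ms. Proof. by rewrite divr_ge0 ?(ltW d0)// mulr_ge0. Qed.

Lemma Kdrift_weighted :
  d * (Kdrift al As Ms G rho * rho `^ al) = 4 * A * M * theta0 `^ al + G * theta0 * t0.
Proof.
rewrite /Kdrift mulrDl -mulrA -[G * _ * _]mulrA -powR_add// subrK powRr1 ?(ltW rho0)//.
rewrite {1}/rho powRM ?(ltW theta0_gt0) ?(ltW d0)// mulrDr -d2 /rho /As /Ms.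
by field; rewrite gt_eqF//= gt_eqF// powR_gt0.
Qed.

Lemma grad_step x e : d * `|nabla nu eps e (u t0) x| <= Mgrad / 2 + M / 2.
Proof.
have t0I : t0 \in `]lo, t0] by rewrite in_itv /= lexx andbT /lo gtrBl exprn_gt0.
have t0I' : t0 \in `[lo, t0] by rewrite in_itv /= lexx andbT /lo gerBl sqr_ge0.
have loI : lo \in `[lo, t0] by rewrite in_itv /= lexx /lo gerBl sqr_ge0.
have r2 : 0 < rho ^+ 2 by rewrite exprn_gt0.
have near := @grad_near R V n nu eps eps_opp cm cp c1 al cm0 c10 al0 al1 psi psi0 psi_ge0
  psi_lap a g u lo t0 As Ms G As0 Ms0 G0 (fun s x e sI => a_sym x e (sub_cc t0T sI))
  (fun s x e sI => a_ell x e (sub_cc t0T sI)) (fun s t x y i => local_hol x y i t0T)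
  (fun s x e => local_grad x e t0T) (fun s x sI => g_bnd x (sub_cc t0T sI))
  (fun s x sI => u_der x (sub_co t0T sI)) (fun s x sI => @u_left s x (sub_oc t0T sI))
  rho rho0 t0 (rho ^+ 2) x e t0I r2.
have {}near := near _ (lexx _).
have {near} near : `|nabla nu eps e (u t0) x - nabla nu eps e
    (heatop nu eps (frozen a t0 x) (rho ^+ 2) (u lo)) x| <=
    near_const / 4 * (Kdrift al As Ms G rho * rho `^ al).
  rewrite -(powR_sqr_half al (ltW rho0)); apply: le_trans (near _) _; first by lra.
  by rewrite /near_const (_ : 16 * _ / al / 4 = 4 * drift_const (n := n) cm c1 / al)
    ?mulrA//; field; rewrite gt_eqF.
have bcm i : cm <= frozen a t0 x i.
  by have /andP[] := a_ell x (i, true) (sub_cc t0T t0I').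
have start : `|nabla nu eps e (heatop nu eps (frozen a t0 x) (rho ^+ 2) (u lo)) x| <=
    ker_const cm * rho^-1 * U.
  have := nablas_ker_sup nu eps_opp cm0 (es := [:: e]) x bcm isT r2 U0
    (fun y => u_bnd y (sub_cc t0T loI)).
  by rewrite /= -mulNr (powR_sqr_half _ (ltW rho0)) powR_inv1// ltW.
have split : d * `|nabla nu eps e (u t0) x| <= ker_const cm * theta0^-1 * U +
    near_const / 4 * (4 * A * M * theta0 `^ al + G * theta0 * t0).
  rewrite -Kdrift_weighted.
  rewrite [leRHS](_ : _ = d * (ker_const cm * rho^-1 * U + near_const / 4 *
    (Kdrift al As Ms G rho * rho `^ al))); last first.
    rewrite mulrDr; congr (_ + _); last by rewrite mulrCA.
    by rewrite /rho; field; rewrite !gt_eqF// theta0_gt0.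
  apply: ler_wpM2l; first exact: ltW.
  apply: le_trans (lerD start near).
  by rewrite -[X in `|X|](subrK (nabla nu eps e
    (heatop nu eps (frozen a t0 x) (rho ^+ 2) (u lo)) x)) addrC ler_normD.
apply: le_trans split _.
have cn0 := near_const_ge0.
(* The inequality for which [theta0] is chosen: it turns the flux term into [M / 2]. *)
have p1 : near_const * (A * theta0 `^ al) <= 1 / 2.
  rewrite theta0_al mulrA ler_pdivrMr ?(mulr_gt0 CC AA)//.
  have : near_const * A <= (near_const + 1) * (A + 1) by apply: ler_pM => //; lra.
  lra.
have p2 : theta0 <= (A + 1)^-1.
  by apply: le_trans theta0_le_inv _; rewrite ler_piMr ?invr_ge0 ?(ltW AA)//; lra.
have p3 : G * theta0 * t0 <= T * ((A + 1)^-1 * G).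
  rewrite mulrC ler_pM ?mulr_ge0 ?(ltW t00) ?(ltW theta0_gt0)//.
  by rewrite mulrC ler_wpM2r.
have p4 := ler_wpM2l cn0 p3; have p5 := ler_wpM2r M0 p1.
rewrite theta0_inv /Mgrad /grad_const.
rewrite [X in X / 2 + _](_ : _ = 2 * (ker_const cm * (theta_scale * (A + 1) `^ al^-1) * U
  + near_const * (T * ((A + 1)^-1 * G)) + ker_const cm * theta_scale * ((A + 1)^-1 * G)
  + near_const * T * ((A + 1) `^ al^-1 * U))); last by ring.
have q1 : 0 <= ker_const cm * theta_scale * ((A + 1)^-1 * G).
  by rewrite !mulr_ge0 ?ker_const_ge0 ?powR_ge0 ?invr_ge0 ?(ltW AA).
have q2 : 0 <= near_const * T * ((A + 1) `^ al^-1 * U).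
  by rewrite (mulr_ge0 (mulr_ge0 cn0 (ltW T0)))// mulr_ge0 ?powR_ge0.
have q3 : 0 <= near_const * (T * ((A + 1)^-1 * G)).
  by rewrite (mulr_ge0 cn0)// !mulr_ge0 ?invr_ge0 ?(ltW AA) ?(ltW T0).
lra.
Qed.

Definition Kweighted : R :=
  4 * A * M + G * theta0 `^ (1 - al) * t0 + U * theta0 `^ (- (1 + al)).

Lemma Kfar_weighted : d `^ (1 + al) * Kfar al As Ms G U rho = Kweighted.
Proof.
have t10 := theta0_gt0; have p0 := powR_gt0 al d0.
rewrite /Kfar /Kdrift /Kweighted /rho !powRM ?(ltW t10) ?(ltW d0)//.
rewrite powRN (powRN d) (powR_add _ _ d0) powRr1 ?(ltW d0)//.
have -> : d `^ (1 - al) = d / d `^ al by rewrite (powR_add _ _ d0) powRr1 ?(ltW d0)// powRN.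
rewrite -d2 /As /Ms; field.
by rewrite !gt_eqF// powR_gt0.
Qed.

Let weight (X r p : R) : X <= hoelder_const (n := n) cm cp c1 al * Kfar al As Ms G U rho * r
  `^ p ->
  d `^ (1 + al) * X <= hoelder_const (n := n) cm cp c1 al * Kweighted * r `^ p.
Proof.
move=> h; rewrite -Kfar_weighted.
rewrite [leRHS](_ : _ = d `^ (1 + al) *
  (hoelder_const (n := n) cm cp c1 al * Kfar al As Ms G U rho * r `^ p)); last by ring.
by rewrite ler_wpM2l ?powR_ge0.
Qed.

Lemma space_local x e i (k : nat) (r : R) : (0 < k)%N -> r = k%:R / nu -> r <= rho ->
  d `^ (1 + al) * `|nabla nu eps e (u t0) (x + eps (i, true) *+ k) - nabla nu eps e (u t0) x|
  <= hoelder_const (n := n) cm cp c1 al * Kweighted * r `^ al.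
Proof.
move=> k0 rE rrho; apply: weight.
exact: (grad_holder_space eps_opp cm0 c10 al0 al1 psi0 psi_ge0
  psi_lap As0 Ms0 G0 U0 (fun s x e sI => a_sym x e (sub_cc t0T sI))
  (fun s x e sI => a_ell x e (sub_cc t0T sI)) (fun s t x y i => local_hol x y i t0T)
  (fun s x e => local_grad x e t0T) (fun s x sI => u_bnd x (sub_cc t0T sI))
  (fun s x sI => g_bnd x (sub_cc t0T sI))
  (fun s x sI => u_der x (sub_co t0T sI)) (fun s x sI => @u_left s x (sub_oc t0T sI))
  rho0 cp0 e nu0 k0 rE rrho erefl erefl (fun l _ => psi_step x i l)).
Qed.

Lemma grad_time_local t x e (r : R) : t <= T -> 0 < r -> r <= rho -> t - t0 = r ^+ 2 ->
  d `^ (1 + al) * `|nabla nu eps e (u t) x - nabla nu eps e (u t0) x|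
  <= hoelder_const (n := n) cm cp c1 al * Kweighted * r `^ al.
Proof.
move=> tT r0 rrho tE; apply: weight.
exact: (grad_holder_time eps_opp cm0 c10 al0 al1 psi0 psi_ge0
  psi_lap As0 Ms0 G0 U0 (fun s x e sI => a_sym x e (sub_cc tT sI))
  (fun s x e sI => a_ell x e (sub_cc tT sI)) (fun s t x y i => local_hol x y i tT)
  (fun s x e => local_grad x e tT) (fun s x sI => u_bnd x (sub_cc tT sI))
  (fun s x sI => g_bnd x (sub_cc tT sI))
  (fun s x sI => u_der x (sub_co tT sI)) (fun s x sI => @u_left s x (sub_oc tT sI))
  rho0 cp0 x e r0 rrho erefl erefl tE).
Qed.

Lemma value_time_local t x (r : R) : t <= T -> 0 < r -> r <= rho -> t - t0 = r ^+ 2 ->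
  d `^ (1 + al) * `|u t x - u t0 x| <= hoelder_const (n := n) cm cp c1 al * Kweighted * r `^
    (1 + al).
Proof.
move=> tT r0 rrho tE; apply: weight.
exact: (value_holder_time eps_opp cm0 c10 al0 al1 psi0 psi_ge0
  psi_lap As0 Ms0 G0 U0 (fun s x e sI => a_sym x e (sub_cc tT sI))
  (fun s x e sI => a_ell x e (sub_cc tT sI)) (fun s t x y i => local_hol x y i tT)
  (fun s x e => local_grad x e tT) (fun s x sI => u_bnd x (sub_cc tT sI))
  (fun s x sI => g_bnd x (sub_cc tT sI))
  (fun s x sI => u_der x (sub_co tT sI)) (fun s x sI => @u_left s x (sub_oc tT sI))
  rho0 cp0 x r0 rrho erefl erefl tE).
Qed.

End LocalData.

(** For each lattice the supremum of the weighted gradient is finite, by a crude bound that depends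
    on [nu]. With this supremum as [M], [grad_step] bounds it by [Mgrad / 2] plus half of itself. *)
Lemma grad_bound (t : R) x e : t \in `]0, T] ->
  Num.sqrt t * `|nabla nu eps e (u t) x| <= Mgrad.
Proof.
move=> tI.
pose E := [set r : R | exists s y e', s \in `]0, T] /\ r = Num.sqrt s * `|nabla nu eps e' (u
  s) y|].
have Et : E (Num.sqrt t * `|nabla nu eps e (u t) x|) by exists t, x, e.
have ubE : ubound E (Num.sqrt T * (nu * (2 * U))).
  move=> _ [s [y [e' [sI ->]]]].
  have /andP[s0 sT] : 0 < s <= T by move: sI; rewrite in_itv.
  have sI' : s \in `[0, T] by rewrite in_itv /= (ltW s0).
  apply: ler_pM; rewrite ?sqrtr_ge0 ?ler_wsqrtr// normrM gtr0_norm//.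
  rewrite ler_wpM2l ?(ltW nu0)//; apply: le_trans (ler_normB _ _) _.
  by have := u_bnd y sI'; have := u_bnd (y + eps e') sI'; lra.
have hE : has_sup E by split; [eexists; exact: Et|eexists; exact: ubE].
have leS r : E r -> r <= sup E by exact: sup_upper_bound.
have S0 : 0 <= sup E.
  by apply: le_trans (leS _ Et); rewrite mulr_ge0 ?sqrtr_ge0.
suff : sup E <= Mgrad / 2 + sup E / 2 by have := leS _ Et; lra.
apply: ge_sup; first by eexists; exact: Et.
move=> _ [s [y [e' [sI ->]]]].
have /andP[s0 sT] : 0 < s <= T by move: sI; rewrite in_itv.
apply: grad_step => // s' y' e'' s'I; apply: leS; by exists s', y', e''.
Qed.

Lemma grad_const_ge0 : 0 <= grad_const.
Proof.
by rewrite mulr_ge0// addr_ge0 ?(mulr_ge0 near_const_ge0 (ltW T0))// (mulr_ge0 (ker_const_ge0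
  _))// powR_ge0.
Qed.

Let Mg0 : 0 <= Mgrad.
Proof.
rewrite (mulr_ge0 grad_const_ge0)// addr_ge0// ?mulr_ge0 ?powR_ge0 ?invr_ge0//; exact: ltW.
Qed.

Lemma AMgrad_le : (A + 1) * Mgrad <= grad_const * data_size.
Proof.
rewrite /Mgrad /data_size powR_add// powRr1 ?(ltW AA)//.
by rewrite le_eqVlt; apply/orP; left; apply/eqP; field; rewrite gt_eqF.
Qed.

(** The first summand serves distances up to [theta0] times the square root of time; at larger
    distances the second serves gradients and the third values. *)
Definition weighted_const : R := hoelder_const (n := n) cm cp c1 al * (4 * grad_const + T +
  theta_scale `^ (1 + al))
  + 4 * (near_const + 1) * grad_const + 2 * theta_scale `^ (1 + al).

Let W0 : 0 <= data_size.
Proof. by rewrite addr_ge0 ?mulr_ge0 ?powR_ge0. Qed.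

Let cf0 : 0 <= far_const (n := n) cm c1 al. Proof. exact: far_const_ge0. Qed.

Let chol0 : 0 <= hoelder_const (n := n) cm cp c1 al.
Proof.
have cd0 : 0 <= 16 * drift_const (n := n) cm c1 / al := near_const_ge0.
have ck0 := ker_const_ge0 cm.
by rewrite (addr_ge0 _ cf0)// addr_ge0 ?(mulr_ge0 _ cf0) ?mulr_ge0// (addr_ge0 cd0)//
  mulr_ge0 ?mulr_ge0.
Qed.

Lemma weighted_const_ge0 : 0 <= weighted_const.
Proof.
have g0 := grad_const_ge0; have c0 := near_const_ge0; have s0 := powR_ge0 theta_scale (1 + al).
have p1 : 0 <= 4 * grad_const + T + theta_scale `^ (1 + al) by have := T0; lra.
have p2 : 0 <= 4 * (near_const + 1) * grad_const by rewrite mulr_ge0//; lra.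
have := mulr_ge0 chol0 p1; rewrite /weighted_const; lra.
Qed.

Lemma Kweighted_le (t0 : R) : 0 < t0 -> t0 <= T ->
  Kweighted t0 Mgrad <= (4 * grad_const + T + theta_scale `^ (1 + al)) * data_size.
Proof.
move=> t00 t0T; rewrite /Kweighted.
rewrite [leRHS](_ : _ = 4 * (grad_const * data_size) + T * data_size + theta_scale `^ (1 +
  al) * data_size); last by ring.
apply: lerD; first apply: lerD.
- rewrite -[leLHS]mulrA ler_wpM2l//; apply: le_trans AMgrad_le.
  by rewrite ler_wpM2r// lerDl.
- rewrite mulrC ler_pM ?mulr_ge0 ?powR_ge0 ?(ltW t00)//.
  apply: (@le_trans _ _ (G * 1)); last by rewrite mulr1 lerDr mulr_ge0 ?powR_ge0.
  rewrite ler_wpM2l//; have al10 : 0 <= 1 - al by rewrite subr_ge0 ltW.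
  have th1 : 0 < theta0 <= 1 by rewrite theta0_gt0; have := theta0_le_half; lra.
  by have := ger_powR th1 al10; rewrite powRr0.
(* The exponents combine to [al^-1 * (1 + al) = 1 + al^-1]. *)
- rewrite powRN -powR_inv1 ?powR_ge0// -powRrM mulrN1 -(mulN1r (1 + al)) powRrM.
  rewrite powR_inv1 ?(ltW theta0_gt0)// theta0_inv powRM ?powR_ge0// mulrC -mulrA.
  rewrite ler_wpM2l ?powR_ge0//.
  rewrite -powRrM mulrDr mulr1 mulVf ?gt_eqF// [al^-1 + 1]addrC lerDl//.
Qed.

Let theta_inv_al : theta0 `^ (- al) = 2 * (near_const + 1) * (A + 1).
Proof. by rewrite powRN theta0_al invrK. Qed.

Let big_grad (t0 r X : R) : 0 < t0 -> t0 <= T -> theta0 * Num.sqrt t0 < r ->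
  X <= 2 * (Mgrad / Num.sqrt t0) ->
  Num.sqrt t0 `^ (1 + al) * X <= weighted_const * data_size * r `^ al.
Proof.
move=> t00 t0T dr hX; have d0 : 0 < Num.sqrt t0 by rewrite sqrtr_gt0.
have th0 := theta0_gt0; have c0 := near_const_ge0.
have r0 : 0 < r by apply: lt_trans dr; rewrite mulr_gt0.
have dal : Num.sqrt t0 `^ al <= 2 * (near_const + 1) * (A + 1) * r `^ al.
  rewrite -theta_inv_al powRN mulrC ler_pdivlMr ?(powR_gt0 al th0)// -powRM ?(ltW d0) ?(ltW
    th0)//.
  by apply: ge0_ler_powR; rewrite ?nnegrE ?(ltW al0) ?(ltW r0) ?mulr_ge0 ?(ltW d0) ?(ltW
    th0)// mulrC ltW.
rewrite (powR_add _ _ d0) powRr1 ?(ltW d0)//.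
apply: (@le_trans _ _ (2 * Mgrad * Num.sqrt t0 `^ al)).
  rewrite [leRHS](_ : _ = Num.sqrt t0 * Num.sqrt t0 `^ al * (2 * (Mgrad / Num.sqrt t0))).
    by rewrite ler_wpM2l// mulr_ge0 ?powR_ge0 ?(ltW d0).
  by field; rewrite gt_eqF.
apply: (@le_trans _ _ (2 * Mgrad * (2 * (near_const + 1) * (A + 1) * r `^ al))).
  by rewrite ler_wpM2l// mulr_ge0.
rewrite [leLHS](_ : _ = 4 * (near_const + 1) * ((A + 1) * Mgrad) * r `^ al); last by ring.
rewrite ler_wpM2r ?powR_ge0//.
have c4 : 0 <= 4 * (near_const + 1) by lra.
apply: le_trans (ler_wpM2l c4 AMgrad_le) _; rewrite mulrA ler_wpM2r//.
have s0 := powR_ge0 theta_scale (1 + al); have g0 := grad_const_ge0.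
have p1 : 0 <= 4 * grad_const + T + theta_scale `^ (1 + al) by have := T0; lra.
have := mulr_ge0 chol0 p1; rewrite /weighted_const; lra.
Qed.

Let small_scale (t0 z X : R) : 0 < t0 -> t0 <= T -> 0 <= z ->
  X <= hoelder_const (n := n) cm cp c1 al * Kweighted t0 Mgrad * z -> X <= weighted_const *
    data_size * z.
Proof.
move=> t00 t0T z0 /le_trans; apply; rewrite ler_wpM2r//.
apply: le_trans (ler_wpM2l chol0 (Kweighted_le t00 t0T)) _; rewrite mulrA ler_wpM2r//.
have s0 := powR_ge0 theta_scale (1 + al).
have p2 : 0 <= 4 * (near_const + 1) * grad_const.
  by rewrite mulr_ge0 ?grad_const_ge0//; have := near_const_ge0; lra.
rewrite /weighted_const; lra.
Qed.

Let grad_le (t s : R) x e : s \in `]0, T] -> t \in `]0, T] -> s <= t ->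
  `|nabla nu eps e (u t) x| <= Mgrad / Num.sqrt s.
Proof.
move=> sI tI st; have s0 : 0 < s by move: sI; rewrite in_itv => /andP[].
rewrite ler_pdivlMr ?sqrtr_gt0// mulrC; apply: le_trans (grad_bound x e tI).
by rewrite ler_wpM2r// ler_wsqrtr.
Qed.

Lemma weighted_space (t : R) x e i (k : nat) : t \in `]0, T] ->
  Num.sqrt t `^ (1 + al) *
    `|nabla nu eps e (u t) (x + eps (i, true) *+ k) - nabla nu eps e (u t) x|
  <= weighted_const * data_size * (k%:R / nu) `^ al.
Proof.
move=> tI; have /andP[t0 tT] : 0 < t <= T by move: tI; rewrite in_itv.
have [->|k0] := posnP k.
  by rewrite mulr0n addr0 subrr normr0 mulr0 mul0r powR0 ?mulr0// gt_eqF.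
have [rs|rb] := leP (k%:R / nu) (theta0 * Num.sqrt t).
  apply: (small_scale t0 tT (powR_ge0 _ _)).
  by apply: space_local => // s y e'; exact: grad_bound.
apply: big_grad => //; apply: le_trans (ler_normB _ _) _.
have := grad_le (x + eps (i, true) *+ k) e tI tI (lexx _).
have := grad_le x e tI tI (lexx _); lra.
Qed.

Lemma weighted_grad_time (t s : R) x e : s \in `]0, T] -> t \in `]0, T] -> s <= t ->
  Num.sqrt s `^ (1 + al) * `|nabla nu eps e (u t) x - nabla nu eps e (u s) x|
  <= weighted_const * data_size * Num.sqrt (t - s) `^ al.
Proof.
move=> sI tI st; have /andP[s0 sT] : 0 < s <= T by move: sI; rewrite in_itv.
have /andP[t0 tT] : 0 < t <= T by move: tI; rewrite in_itv.
have [<-|tns] := eqVneq s t.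
  by rewrite !subrr normr0 mulr0 sqrtr0 powR0 ?mulr0// gt_eqF.
have ts0 : 0 < t - s by rewrite subr_gt0 lt_neqAle tns.
have [rs|rb] := leP (Num.sqrt (t - s)) (theta0 * Num.sqrt s).
  apply: (small_scale s0 sT (powR_ge0 _ _)).
  apply: grad_time_local => //; first by move=> s' y e'; exact: grad_bound.
    by rewrite sqrtr_gt0.
  by rewrite sqr_sqrtr// ltW.
apply: big_grad => //; apply: le_trans (ler_normB _ _) _.
have := grad_le x e sI tI st.
have := grad_le x e sI sI (lexx _); lra.
Qed.

Lemma weighted_value_time (t s : R) x : s \in `]0, T] -> t \in `]0, T] -> s <= t ->
  Num.sqrt s `^ (1 + al) * `|u t x - u s x| <= weighted_const * data_size * Num.sqrt (t - s)
    `^ (1 + al).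
Proof.
move=> sI tI st; have /andP[s0 sT] : 0 < s <= T by move: sI; rewrite in_itv.
have /andP[t0 tT] : 0 < t <= T by move: tI; rewrite in_itv.
have [<-|tns] := eqVneq s t.
  by rewrite !subrr normr0 mulr0 sqrtr0 powR0 ?mulr0// gt_eqF// addr_gt0.
have ts0 : 0 < t - s by rewrite subr_gt0 lt_neqAle tns.
have [rs|rb] := leP (Num.sqrt (t - s)) (theta0 * Num.sqrt s).
  apply: (small_scale s0 sT (powR_ge0 _ _)).
  apply: value_time_local => //; first by move=> s' y e'; exact: grad_bound.
    by rewrite sqrtr_gt0.
  by rewrite sqr_sqrtr// ltW.
set r := Num.sqrt (t - s) in rb *; set d := Num.sqrt s in rb *.
have d0 : 0 < d by rewrite sqrtr_gt0.
have th0 := theta0_gt0; have al10 : 0 <= 1 + al by rewrite addr_ge0 ?(ltW al0).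
have uu : `|u t x - u s x| <= 2 * U.
  have sI' : s \in `[0, T] by rewrite in_itv /= (ltW s0).
  have tI' : t \in `[0, T] by rewrite in_itv /= (ltW t0).
  apply: le_trans (ler_normB _ _) _.
  by have := u_bnd x sI'; have := u_bnd x tI'; lra.
have dr : d `^ (1 + al) <= theta0^-1 `^ (1 + al) * r `^ (1 + al).
  rewrite -powRM ?invr_ge0 ?(ltW th0) ?sqrtr_ge0//.
  apply: ge0_ler_powR; rewrite ?nnegrE ?(ltW d0) ?mulr_ge0 ?invr_ge0 ?(ltW th0) ?sqrtr_ge0//.
  by rewrite mulrC ler_pdivlMr// mulrC ltW.
apply: (@le_trans _ _ (2 * U * (theta0^-1 `^ (1 + al) * r `^ (1 + al)))).
  by rewrite mulrC ler_pM ?powR_ge0.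
rewrite mulrA ler_wpM2r ?powR_ge0//.
rewrite theta0_inv powRM ?powR_ge0// -powRrM mulrDr mulr1 mulVf ?gt_eqF// [al^-1 + 1]addrC.
rewrite [leLHS](_ : _ = 2 * theta_scale `^ (1 + al) * ((A + 1) `^ (1 + al^-1) * U)); last by
  ring.
have sc0 := powR_ge0 theta_scale (1 + al); have g0 := grad_const_ge0; have c0 := near_const_ge0.
have p1 : 0 <= 4 * grad_const + T + theta_scale `^ (1 + al) by have := T0; lra.
have p2 : 0 <= 4 * (near_const + 1) * grad_const by rewrite mulr_ge0//; lra.
apply: ler_pM; rewrite ?mulr_ge0 ?powR_ge0//; last by rewrite lerDl.
by have := mulr_ge0 chol0 p1; rewrite /weighted_const; lra.
Qed.

End Weighted.

(** * The lattice and the torus distance *)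

Lemma lattice_of_intE (N n : nat) (k : 'rV[int]_n) i : (0 < N)%N ->
  ((lattice_of_int N k) ord0 i : nat)%:Z = (k ord0 i %% N%:Z)%Z.
Proof.
move=> N0; rewrite mxE /= -modz_nat prednK// gez0_abs ?modz_ge0 ?eqz_nat -?lt0n//.
by rewrite modz_mod.
Qed.

Lemma lattice_add_val (N n : nat) (x y : lattice N n) i : (0 < N)%N ->
  ((x + y)%R ord0 i : nat)%:Z =
  (((x ord0 i : nat)%:Z + (y ord0 i : nat)%:Z) %% N%:Z)%Z.
Proof. by move=> N0; rewrite mxE /= -modz_nat (_ : Posz N.-1.+1 = N%:Z) ?prednK. Qed.

Lemma lattice_eq (N n : nat) (x y : lattice N n) :
  (forall i, (x ord0 i : nat)%:Z = (y ord0 i : nat)%:Z) -> x = y.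
Proof.
move=> h; apply/rowP => i; apply/val_inj; have /eqP := h i.
by rewrite eqz_nat => /eqP.
Qed.

Lemma lattice_of_intD (N n : nat) (k m : 'rV[int]_n) : (0 < N)%N ->
  lattice_of_int N (k + m) = lattice_of_int N k + lattice_of_int N m :> lattice N n.
Proof.
move=> N0; apply: lattice_eq => i.
by rewrite lattice_add_val// !lattice_of_intE// mxE modzDml modzDmr.
Qed.

Lemma lattice_of_int0 (N n : nat) : (0 < N)%N -> lattice_of_int N 0 = 0 :> lattice N n.
Proof.
move=> N0; apply: (addrI (lattice_of_int N (0 : 'rV[int]_n) : lattice N n)).
by rewrite -lattice_of_intD// !addr0.
Qed.

Lemma lattice_of_intN (N n : nat) (k : 'rV[int]_n) : (0 < N)%N ->
  lattice_of_int N (- k) = - lattice_of_int N k :> lattice N n.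
Proof.
move=> N0; apply: (addrI (lattice_of_int N k : lattice N n)).
by rewrite -lattice_of_intD// !subrr lattice_of_int0.
Qed.

Lemma lattice_of_intMn (N n : nat) (k : 'rV[int]_n) (l : nat) : (0 < N)%N ->
  lattice_of_int N (k *+ l) = lattice_of_int N k *+ l :> lattice N n.
Proof.
move=> N0; elim: l => [|l IH]; first by rewrite !mulr0n lattice_of_int0.
by rewrite !mulrS lattice_of_intD// IH.
Qed.

Lemma dir_vec_opp (n : nat) (e : dir n) : dir_vec (dir_opp e) = - dir_vec e.
Proof. by case: e => i [] /=; rewrite /dir_vec /= ?scaleN1r ?scale1r ?opprK. Qed.

Definition lattice_step (N n : nat) (e : dir n) : lattice N n := lattice_of_int N (dir_vec e).

Lemma lattice_step_opp (N n : nat) (e : dir n) : (0 < N)%N -> lattice_step N (dir_opp e) = -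
  lattice_step N e.
Proof. by move=> N0; rewrite /lattice_step dir_vec_opp lattice_of_intN. Qed.

Section Torus.
Context {R : realType}.

Definition torus_pos (N n : nat) (x : lattice N n) : 'rV[R]_n := \row_i ((x ord0 i : nat)%:R
  / N%:R).

(** Representatives lie in [[0, 1)], so a lattice shift is a translation only up to the integer
    vector of quotients by [N]. *)
Lemma torus_pos_shift (N n : nat) (x : lattice N n) (m : 'rV[int]_n) : (0 < N)%N ->
  exists k : 'rV[int]_n,
    torus_pos (x + lattice_of_int N m) = torus_pos x + N%:R^-1 *: map_mx intr m + map_mx intr k.
Proof.
move=> N0; have NR : N%:R != 0 :> R by rewrite pnatr_eq0 -lt0n.
exists (\row_i - (((x ord0 i : nat)%:Z + m ord0 i) %/ N%:Z)%Z).
apply/rowP => i; rewrite !mxE.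
have := lattice_add_val x (lattice_of_int N m) i N0.
rewrite lattice_of_intE// modzDmr => E.
have D := divz_eq ((x ord0 i : nat)%:Z + m ord0 i) N%:Z.
have /(congr1 (fun z : int => z%:~R : R)) : ((x + lattice_of_int N m)%R ord0 i : nat)%:Z =
   (x ord0 i : nat)%:Z + m ord0 i - (((x ord0 i : nat)%:Z + m ord0 i) %/ N%:Z)%Z * N%:Z.
  by rewrite E; apply/eqP; rewrite eq_sym subr_eq {1}D addrC.
rewrite intrB intrD intrM -!pmulrn !mxE => ->; rewrite intrN.
by field.
Qed.

Lemma enorm_sqr (n : nat) (z : 'rV[R]_n) : enorm z ^+ 2 = \sum_i z ord0 i ^+ 2.
Proof. by rewrite sqr_sqrtr// sumr_ge0// => i _; rewrite sqr_ge0. Qed.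

Lemma torus_lb (n : nat) (z y : 'rV[R]_n) :
  has_inf [set enorm (z - y + map_mx intr k) | k in [set: 'rV[int]_n]].
Proof.
split; first by exists (enorm (z - y + map_mx intr 0)), 0.
by exists 0 => _ [k _ <-]; exact: sqrtr_ge0.
Qed.

Lemma torus_dist_le (n : nat) (z y : 'rV[R]_n) k :
  torus_dist z y <= enorm (z - y + map_mx intr k).
Proof. by apply: ge_inf; [have [] := torus_lb z y|exists k]. Qed.

Lemma torus_dist_ge0 (n : nat) (z y : 'rV[R]_n) : 0 <= torus_dist z y.
Proof.
apply: lb_le_inf; first by have [] := torus_lb z y.
by move=> _ [k _ <-]; exact: sqrtr_ge0.
Qed.

Lemma torus_dist_lt (n : nat) (z y : 'rV[R]_n) (c : R) : torus_dist z y < c ->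
  exists k, enorm (z - y + map_mx intr k) < c.
Proof. by move=> /(inf_lt (proj1 (torus_lb z y))) [_ [k _ <-]]; exists k. Qed.

Definition lattice_sqdist (N n : nat) (x y : lattice N n) : R := torus_dist (torus_pos y)
  (torus_pos x) ^+ 2.

(** Every translate [k] competes for the infimum. One and the same [k] may be used for all shifts
    [m], which is what second differences require. *)
Lemma lattice_sqdist_shift_le (N n : nat) (x y : lattice N n) (m k : 'rV[int]_n) : (0 < N)%N ->
  lattice_sqdist x (y + lattice_of_int N m) <=
  \sum_i ((torus_pos y - torus_pos x + map_mx intr k) ord0 i + (m ord0 i)%:~R / N%:R) ^+ 2.
Proof.
move=> N0; have [l E] := torus_pos_shift y m N0.
apply: (@le_trans _ _ (enorm (torus_pos (y + lattice_of_int N m) - torus_pos x + map_mx intr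
  (k - l)) ^+ 2)).
  by rewrite ler_pXn2r ?nnegrE ?torus_dist_ge0 ?sqrtr_ge0// torus_dist_le.
rewrite enorm_sqr le_eqVlt; apply/orP; left; apply/eqP; apply: eq_bigr => i _.
rewrite E !mxE intrB; congr (_ ^+ 2); ring.
Qed.

Lemma lpsi0 (N n : nat) (x : lattice N n) : lattice_sqdist x x = 0.
Proof.
rewrite /lattice_sqdist; apply/eqP; rewrite sqrf_eq0 eq_le torus_dist_ge0 andbT.
apply: le_trans (torus_dist_le _ _ 0) _.
rewrite subrr add0r /enorm big1 ?sqrtr0// => i _.
by rewrite !mxE expr0n.
Qed.

Lemma dir_vecE (n : nat) (e : dir n) j :
  dir_vec e ord0 j = (if e.2 then 1 else -1) * (j == e.1)%:R.
Proof. by rewrite /dir_vec !mxE eqxx. Qed.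

Lemma lattice_sqdist_step (N n : nat) (x : lattice N n) i (k : nat) : (0 < N)%N ->
  lattice_sqdist x (x + lattice_step N (i, true) *+ k) <= (k%:R / N%:R) ^+ 2.
Proof.
move=> N0; rewrite /lattice_step -lattice_of_intMn//.
apply: le_trans (lattice_sqdist_shift_le _ _ _ 0 N0) _.
rewrite (bigD1 i) //= big1 ?addr0 => [|j ji].
  rewrite !mxE subrr !add0r mulmxnE dir_vecE /= eqxx mulr1.
  by rewrite natz -pmulrn.
rewrite !mxE subrr !add0r mulmxnE dir_vecE /= (negbTE ji) mulr0 mul0rn mul0r expr0n.
by [].
Qed.

Lemma lattice_sqdist_dir_le (N n : nat) (x y : lattice N n) (k : 'rV[int]_n) (e : dir n) : (0
  < N)%N ->
  lattice_sqdist x (y + lattice_step N e) <= enorm (torus_pos y - torus_pos x + map_mx intr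
    k) ^+ 2
    + (if e.2 then 1 else -1) * (2 / N%:R * (torus_pos y - torus_pos x + map_mx intr k) ord0
      e.1) + N%:R^-1 ^+ 2.
Proof.
move=> N0; apply: le_trans (lattice_sqdist_shift_le _ _ _ k N0) _.
set w := _ + map_mx _ _; rewrite enorm_sqr.
rewrite (bigD1 e.1) //= [in leRHS](bigD1 e.1) //= dir_vecE eqxx mulr1.
rewrite (eq_bigr (fun i => w ord0 i ^+ 2)) => [|i ie]; last first.
  by rewrite dir_vecE (negbTE ie) mulr0 mul0r addr0.
by rewrite le_eqVlt; apply/orP; left; apply/eqP; case: (e.2); ring.
Qed.

(* The squared distance lies below the square of the Euclidean distance to any
   fixed translate, so it inherits the bound on the second differences of a
   translate that realizes it at [y] up to [eta]. *)
Lemma lattice_sqdist_lap (N n : nat) (cp : R) (b : 'I_n -> R) (x y : lattice N n) : (0 < N)%N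
  -> 0 <= cp ->
  (forall i, 0 <= b i <= cp) -> lap N%:R (@lattice_step N n) b (lattice_sqdist x) y <= 2 *
    n%:R * cp.
Proof.
move=> N0 cp0 hb; have NR : 0 < N%:R :> R by rewrite ltr0n.
apply/ler_addgt0Pr => d d0.
have nc0 : 0 < n%:R * cp + 1 by rewrite ltr_wpDl// mulr_ge0.
(* The error [eta] enters each second difference as [2 * eta * N ^+ 2]; after summation with
   coefficients at most [cp] it stays below [d]. *)
pose eta := d / (2 * N%:R ^+ 2 * (n%:R * cp + 1)).
have eta0 : 0 < eta by rewrite divr_gt0// !mulr_gt0.
have ps : 0 < lattice_sqdist x y + eta by rewrite ltr_wpDl// sqr_ge0.
have [k hk] : exists k, enorm (torus_pos y - torus_pos x + map_mx intr k) < Num.sqrt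
  (lattice_sqdist x y + eta).
  apply: torus_dist_lt; rewrite -[ltLHS]ger0_norm ?torus_dist_ge0// -sqrtr_sqr.
  by rewrite ltr_sqrt// ltrDl.
have {}hk : enorm (torus_pos y - torus_pos x + map_mx intr k) ^+ 2 < lattice_sqdist x y + eta.
  by rewrite -[ltRHS]sqr_sqrtr ?(ltW ps)// ltr_pXn2r ?nnegrE ?sqrtr_ge0.
rewrite /lap sum_dir mulr_sumr.
apply: (@le_trans _ _ (\sum_(i < n) cp * (2 + 2 * eta * N%:R ^+ 2))); last first.
  rewrite sumr_const card_ord -[leLHS]mulr_natl.
  rewrite [leLHS](_ : _ = 2 * n%:R * cp + n%:R * cp * (2 * eta * N%:R ^+ 2)); last by ring.
  rewrite lerD2l (_ : 2 * eta * N%:R ^+ 2 = d / (n%:R * cp + 1)); last first.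
    by rewrite /eta; field; rewrite !gt_eqF.
  by rewrite mulrA ler_pdivrMr// mulrC ler_wpM2l ?(ltW d0)// lerDl.
apply: ler_sum => i _ /=; have /andP[bi0 bicp] := hb i.
have h1 := lattice_sqdist_dir_le x y k (i, true) N0; have h2 := lattice_sqdist_dir_le x y k
  (i, false) N0.
move: h1 h2 hk; rewrite /nabla /=; set w := (_ ord0 i).
move: (lattice_sqdist x (y + lattice_step N (i, true))) (lattice_sqdist x (y + lattice_step N
  (i, false))) (lattice_sqdist x y)
  (enorm _ ^+ 2) => p q p0 E h1 h2 hk.
rewrite [leLHS](_ : _ = b i * (N%:R ^+ 2 * (p + q - 2 * p0))); last by ring.
apply: (@le_trans _ _ (b i * (2 + 2 * eta * N%:R ^+ 2))); last first.
  by rewrite ler_wpM2r// addr_ge0// (mulr_ge0 (mulr_ge0 _ (ltW eta0)) (sqr_ge0 _)).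
rewrite ler_wpM2l//.
rewrite [leRHS](_ : _ = N%:R ^+ 2 * (2 * N%:R^-1 ^+ 2 + 2 * eta)); last by field; rewrite
  gt_eqF.
by rewrite ler_wpM2l ?sqr_ge0//; lra.
Qed.

(** Some translate is closer than one mesh; measured in meshes, each coordinate of the difference is
    then an integer of modulus below 1. *)
Lemma torus_dist_eq0 (N n : nat) (x y : lattice N n) : (0 < N)%N ->
  torus_dist (torus_pos y) (torus_pos x) = 0 -> y = x.
Proof.
move=> N0 h; have NR : 0 < N%:R :> R by rewrite ltr0n.
have [k hk] : exists k, enorm (torus_pos y - torus_pos x + map_mx intr k) < N%:R^-1.
  by apply: torus_dist_lt; rewrite h invr_gt0.
apply: lattice_eq => i; set w := _ + _ in hk.
have wi : `|w ord0 i| < N%:R^-1.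
  apply: le_lt_trans hk; rewrite -sqrtr_sqr ler_sqrt.
    by rewrite (bigD1 i) //= lerDl sumr_ge0// => j _; rewrite sqr_ge0.
  by rewrite sumr_ge0// => j _; rewrite sqr_ge0.
pose z : int := (y ord0 i : nat)%:Z - (x ord0 i : nat)%:Z + k ord0 i * N%:Z.
have wz : w ord0 i = z%:~R / N%:R.
  rewrite /w /z !mxE !(intrD, intrB, intrM) -!pmulrn; field; rewrite gt_eqF//.
have z0 : z = 0.
  move: wi; rewrite wz normrM normfV (gtr0_norm NR) ltr_pdivrMr// mulVf ?gt_eqF//.
  rewrite -intr_norm -[X in _ < X]/(1%:~R) ltr_int -[X in _ < X]add0r ltzD1 normr_le0.
  by move=> /eqP.
have {z0} E : (y ord0 i : nat)%:Z = (x ord0 i : nat)%:Z + - k ord0 i * N%:Z.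
  by move: z0; rewrite /z => /eqP; rewrite addr_eq0 subr_eq => /eqP ->; rewrite mulNr addrC.
have lt (v : lattice N n) : (v ord0 i < N)%N by rewrite -[X in (_ < X)%N](prednK N0) ltn_ord.
have := modzMDl (- k ord0 i) (x ord0 i : nat) N%:Z.
by rewrite addrC -E !modz_nat !modn_small.
Qed.

Lemma sqr_max_le (p q : R) : Num.max p q ^+ 2 <= p ^+ 2 + q ^+ 2.
Proof. by case: (leP p q) => _; rewrite ?lerDr ?lerDl sqr_ge0. Qed.

(** The square of a maximum is at most the sum of squares. In this form the parabolic distance can
    be averaged through its second moment. *)
Lemma st_dist_powR (N n : nat) (s t al : R) (x y : lattice N n) : 0 <= al ->
  st_dist (embed (s, y)) (embed (t, x)) `^ al <= (`|s - t| + lattice_sqdist x y) `^ (al / 2).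
Proof.
move=> al0; have m0 : 0 <= st_dist (embed (s, y)) (embed (t, x)) :> R.
  by rewrite le_max sqrtr_ge0.
rewrite -(powR_sqr_half al m0); apply: ge0_ler_powR.
- by rewrite divr_ge0.
- by rewrite nnegrE sqr_ge0.
- by rewrite nnegrE addr_ge0 ?sqr_ge0.
apply: le_trans (sqr_max_le _ _) _; rewrite sqr_sqrtr//; exact: lexx.
Qed.

Lemma coef_seminorm_le (N n : nat) (T al A : R) (a : R -> conductance N n) (e : dir n)
    (s t : R) (x y : lattice N n) : (0 < N)%N -> 0 < al -> (coef_seminorm T al a e <= A%:E)%E
      -> 0 <= A ->
  s \in `[0, T] -> t \in `[0, T] ->
  Num.min (Num.sqrt s) (Num.sqrt t) `^ al * `|a s y e - a t x e| <=
  A * (`|s - t| + lattice_sqdist x y) `^ (al / 2).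
Proof.
move=> N0 al0 hA A0 sI tI.
have [[-> ->]|st] := pselect ((s, y) = (t, x)).
  by rewrite subrr normr0 mulr0 mulr_ge0 ?powR_ge0.
have st0 : 0 < st_dist (embed (s, y)) (embed (t, x)) :> R.
  rewrite lt_max sqrtr_gt0 normr_gt0 subr_eq0; have [E|//] := eqVneq s t.
  rewrite lt_neqAle torus_dist_ge0 andbT eq_sym; apply/eqP => /(torus_dist_eq0 N0) yx.
  by apply: st; rewrite E; congr (_, _).
apply: le_trans _ (ler_wpM2l A0 (st_dist_powR s t x y (ltW al0))).
rewrite -ler_pdivrMr ?powR_gt0// -mulrA -lee_fin; apply: le_trans hA.
apply: ereal_sup_ubound; by exists (s, y), (t, x).
Qed.

Lemma sup_norm_le (N n : nat) (T c : R) (u : R -> lattice N n -> R) (t : R) x :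
  (sup_norm T u <= c%:E)%E -> t \in `[0, T] -> `|u t x| <= c.
Proof.
move=> h tI; rewrite -lee_fin; apply: le_trans h.
by apply: ereal_sup_ubound; exists (t, x).
Qed.

Lemma within_derive (T t l : R) (f : R -> R) : t \in `]0, T[ ->
  has_derivative_within `[0, T] f t l -> is_derive t (1 : R) f l.
Proof.
rewrite in_itv /= => /andP[t0 tT] h; apply/is_derive1_caratheodory.
exists (fun z => if z == t then l else (f z - f t) / (z - t)); split.
- move=> z; case: eqVneq => [->|zt]; first by rewrite !subrr mulr0.
  by rewrite divfK// subr_eq0.
- apply/continuous_withinNx; rewrite eqxx.
  apply/cvgrPdist_lt => e e0; move/cvgrPdist_lt/(_ e e0): h; rewrite !near_withinE => h.
  have I : \forall z \near t, `[0, T]%classic z.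
    near=> z; rewrite /= in_itv /=; apply/andP; split; apply/ltW; near: z.
      exact: lt_nbhsr.
    exact: lt_nbhsl.
  by apply: filterS2 h I => z hz zI zt; rewrite ifN//; exact: hz.
- by rewrite eqxx.
Unshelve. all: by end_near. Qed.

(** A convergent difference quotient is bounded near [t], which forces continuity there; from the
    left this includes the end point [t = T]. *)
Lemma within_left (T t l : R) (f : R -> R) : t \in `]0, T] ->
  has_derivative_within `[0, T] f t l -> f s @[s --> t^'-] --> f t.
Proof.
rewrite in_itv /= => /andP[t0 tT] h; apply/cvgrPdist_lt => e e0.
move/cvgrPdist_lt/(_ 1 ltr01): h; rewrite !near_withinE => h.
have l0 : 0 < `|l| + 1 by rewrite ltr_wpDl.
near=> s => st; have s0 : 0 < s by near: s; exact: lt_nbhsr.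
have sI : `[0, T]%classic s by rewrite /= in_itv /= (ltW s0) (ltW (lt_le_trans st tT)).
have q1 : `|l - (f s - f t) / (s - t)| < 1.
  by move: sI; have : s != t by [rewrite lt_eqF]; near: s.
have ds : `|t - s| < e / (`|l| + 1).
  by near: s; apply: nbhsx_ballx; rewrite divr_gt0.
have st0 : s - t != 0 by rewrite subr_eq0 lt_eqF.
have -> : f t - f s = ((f s - f t) / (s - t)) * (t - s) by field.
move: q1; set q := _ / _ => q1.
have qb : `|q| <= `|l| + 1.
  by rewrite -[q](subKr l); apply: le_trans (ler_normB _ _) _; rewrite lerD2l ltW.
rewrite normrM; apply: le_lt_trans (ler_wpM2r (normr_ge0 _) qb) _.
by rewrite mulrC -ltr_pdivlMr.
Unshelve. all: by end_near. Qed.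

End Torus.

(** * Polylinear interpolation *)

Section Interpolation.
Context {R : realType}.
Variables (N n : nat).
Context (N0 : (0 < N)%N).
Implicit Types (f : lattice N n -> R) (z w : 'rV[R]_n).

Let NR : 0 < N%:R :> R. Proof. by rewrite ltr0n. Qed.

Definition fpart (b : R) : R := N%:R * b - (Num.floor (N%:R * b))%:~R.

Lemma fpart_itv b : 0 <= fpart b < 1.
Proof. by have := floor_itv (N%:R * b); rewrite /fpart subr_ge0 ltrBlDl intrD. Qed.

Definition corner z (v : {ffun 'I_n -> bool}) : lattice N n :=
  lattice_of_int N (\row_i (Num.floor (N%:R * z ord0 i) + (v i : nat)%:Z)).

Definition interp_at f z : R :=
  \sum_(v : {ffun 'I_n -> bool}) (\prod_i theta N (v i) (z ord0 i)) * f (corner z v).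

Lemma theta_ge0 v (b : R) : 0 <= theta N v b.
Proof.
by rewrite /theta -/(fpart b); have /andP[f0 f1] := fpart_itv b; case: v => //; rewrite
  subr_ge0 ltW.
Qed.

Lemma theta_sum z : \sum_(v : {ffun 'I_n -> bool}) \prod_i theta N (v i) (z ord0 i) = 1 :> R.
Proof.
rewrite -(bigA_distr_bigA (fun i v => theta N v (z ord0 i))) big1// => i _.
by rewrite big_bool /theta /=; ring.
Qed.

Lemma interp_at_norm f z K : (forall x, `|f x| <= K) -> `|interp_at f z| <= K.
Proof.
move=> fK; rewrite -[leRHS]mul1r -(theta_sum z) mulr_suml.
apply: le_trans (ler_norm_sum _ _ _) _; apply: ler_sum => v _.
have p0 : 0 <= \prod_i theta N (v i) (z ord0 i) by apply: prodr_ge0 => i _; exact: theta_ge0.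
by rewrite normrM ger0_norm// ler_wpM2l.
Qed.

Lemma pinterpB f g z : interp_at (fun x => f x - g x) z = interp_at f z - interp_at g z.
Proof. by rewrite /interp_at -sumrB; apply: eq_bigr => v _; rewrite mulrBr. Qed.

Lemma pinterpZ c f z : interp_at (fun x => c * f x) z = c * interp_at f z.
Proof. by rewrite /interp_at mulr_sumr; apply: eq_bigr => v _; rewrite mulrCA. Qed.

(** A lattice shift changes the integer parts only and leaves the fractional parts, hence the
    weights, as they are. *)
Lemma interp_at_shift f z (m : 'rV[int]_n) :
  interp_at f (z + N%:R^-1 *: map_mx intr m) = interp_at (fun x => f (x + lattice_of_int N
    m)) z.
Proof.
have E i : N%:R * (z + N%:R^-1 *: map_mx intr m) ord0 i = N%:R * z ord0 i + (m ord0 i)%:~R.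
  by rewrite !mxE mulrDr mulVKf// gt_eqF.
apply: eq_bigr => v _; congr (_ * f _).
  by apply: eq_bigr => i _; rewrite /theta E floorDrz ?intr_int// intrKfloor intrD opprD
    addrACA subrr addr0.
rewrite /corner -lattice_of_intD//; congr lattice_of_int; apply/rowP => i; rewrite !mxE.
by have := E i; rewrite !mxE => ->; rewrite floorDrz ?intr_int// intrKfloor addrAC.
Qed.

(** This reduces the continuum norms of the gradient to bounds for lattice gradients. *)
Lemma cont_grad_interp (u : R -> lattice N n -> R) (e : dir n) (t : R) z :
  cont_grad N e (interp u) (t, z) = interp_at (lattice_grad e (u t)) z.
Proof.
rewrite /cont_grad /lattice_grad pinterpZ pinterpB; congr (_ * (_ - _)).
exact: interp_at_shift.
Qed.

Definition set_coord z (i : 'I_n) (b : R) : 'rV[R]_n := \row_j (if j == i then b else z ord0 j).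

(** Along a coordinate line the interpolation is piecewise linear between the values of one function
    [H] of the node, common to all [b]. [H] interpolates in the other coordinates; [flip] pairs the
    vertices of the cell along direction [i]. *)
Lemma interp_at_set_coord f z i : exists H : int -> R, forall b,
  interp_at f (set_coord z i b) =
  (1 - fpart b) * H (Num.floor (N%:R * b)) + fpart b * H (Num.floor (N%:R * b) + 1).
Proof.
pose wt (v : {ffun 'I_n -> bool}) : R := \prod_(j | j != i) theta N (v j) (z ord0 j).
pose pt (k : int) (v : {ffun 'I_n -> bool}) : lattice N n := lattice_of_int N
  (\row_j (if j == i then k else Num.floor (N%:R * z ord0 j) + (v j : nat)%:Z)).
exists (fun k => \sum_(v : {ffun 'I_n -> bool} | ~~ v i) wt v * f (pt k v)) => c.
pose flip (v : {ffun 'I_n -> bool}) : {ffun 'I_n -> bool} := [ffun j => (j == i) (+) v j].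
have flipK : involutive flip.
  by move=> v; apply/ffunP => j; rewrite !ffunE addbA addbb.
have wtE (v : {ffun 'I_n -> bool}) : \prod_j theta N (v j) (set_coord z i c ord0 j) = theta N
  (v i) c * wt v.
  rewrite (bigD1 i) //= mxE eqxx; congr (_ * _); apply: eq_bigr => j ji.
  by rewrite mxE (negbTE ji).
rewrite /interp_at (bigID (fun v : {ffun 'I_n -> bool} => v i)) /= addrC; congr (_ + _).
  rewrite mulr_sumr; apply: eq_bigr => v vi; rewrite wtE (negbTE vi) mulrA; congr (_ * f _).
  rewrite /corner /pt; congr lattice_of_int; apply/rowP => j; rewrite !mxE.
  by case: eqVneq => [->|//]; rewrite (negbTE vi) addr0.
rewrite mulr_sumr (reindex_inj (inv_inj flipK)); apply: eq_big => [v|v vi].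
  by rewrite ffunE eqxx.
have {}vi : ~~ v i by move: vi; rewrite ffunE eqxx.
rewrite wtE ffunE eqxx addTb vi mulrA; congr (_ * _ * f _).
  by apply: eq_bigr => j ji; rewrite ffunE (negbTE ji).
rewrite /corner /pt; congr lattice_of_int; apply/rowP => j; rewrite !mxE ffunE.
by case: eqVneq => [->|//]; rewrite addTb vi.
Qed.

Lemma interp_at_node f z i (k : int) (H : int -> R) :
  (forall b, interp_at f (set_coord z i b) =
    (1 - fpart b) * H (Num.floor (N%:R * b)) + fpart b * H (Num.floor (N%:R * b) + 1)) ->
  interp_at f (set_coord z i (k%:~R / N%:R)) = H k.
Proof.
move=> ->; have E : N%:R * (k%:~R / N%:R) = k%:~R :> R by rewrite mulrC divfK// gt_eqF.
by rewrite /fpart E intrKfloor subrr subr0 mul1r mul0r addr0.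
Qed.

Lemma set_coord_shift z i b (k : int) :
  set_coord z i (b + k%:~R / N%:R) = set_coord z i b + N%:R^-1 *: map_mx intr (k *: delta_mx
    ord0 i).
Proof.
apply/rowP => j; rewrite !mxE /=; case: (eqVneq j i) => [_|ji].
  by rewrite mulr1 mulrC.
by rewrite !mulr0 addr0.
Qed.

(** An interval of at most one mesh crosses at most one node, and on either side the slope is that
    of an increment of [H]. *)
Lemma interp_at_lip f z i b c (L : R) : 0 <= L ->
  (forall x, `|f (x + lattice_step N (i, true)) - f x| <= L) ->
  b <= c -> N%:R * (c - b) <= 1 ->
  `|interp_at f (set_coord z i c) - interp_at f (set_coord z i b)| <= N%:R * (c - b) * L.
Proof.
move=> L0 hL bc cb1; have [H HE] := interp_at_set_coord f z i.
have HL k : `|H (k + 1) - H k| <= L.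
  rewrite -!(interp_at_node _ HE) intrD mulrDl set_coord_shift interp_at_shift -pinterpB.
  apply: interp_at_norm => x; have := hL x; rewrite /lattice_step /dir_vec /=; exact.
rewrite !HE /fpart; set p := N%:R * b; set q := N%:R * c.
have pq : p <= q by rewrite ler_pM2l.
have pq1 : q - p <= 1 by rewrite -mulrBr.
rewrite mulrBr -/p -/q.
have /andP[p1 p2] := floor_itv p; have /andP[q1 q2] := floor_itv q.
have kl : Num.floor p <= Num.floor q by exact: le_floor.
set k := Num.floor p in p1 p2 kl *; set l := Num.floor q in q1 q2 kl *.
rewrite !intrD in p2 q2.
have [<-|kl'] := eqVneq k l.
  rewrite (_ : _ - _ = (q - p) * (H (k + 1) - H k)); last by ring.
  by rewrite normrM ger0_norm ?subr_ge0// ler_wpM2l ?subr_ge0.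
have kl1 : k + 1 <= l by rewrite -ltzD1 ltrD2r lt_neqAle kl' kl.
have lk : l = k + 1.
  apply/eqP; rewrite eq_le kl1 andbT -ltzD1 -(ltr_int R) !intrD; lra.
rewrite lk intrD in q1 q2 *.
rewrite (_ : _ - _ = (q - (k%:~R + 1)) * (H (k + 1 + 1) - H (k + 1)) +
  (k%:~R + 1 - p) * (H (k + 1) - H k)); last by ring.
rewrite (_ : q - p = (q - (k%:~R + 1)) + (k%:~R + 1 - p)); last by ring.
apply: le_trans (ler_normD _ _) _; rewrite [leRHS]mulrDl !normrM.
rewrite (ger0_norm (x := q - _)) ?subr_ge0// (ger0_norm (x := _ - p)) ?subr_ge0 ?(ltW p2)//.
by apply: lerD; rewrite ler_wpM2l ?subr_ge0// ltW.
Qed.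

Section Hoelder.
Variables (al H : R) (f : lattice N n -> R).
Context (al0 : 0 < al) (al1 : al < 1) (H0 : 0 <= H).
Context (f_hol : forall x i (k : nat),
  `|f (x + lattice_step N (i, true) *+ k) - f x| <= H * (k%:R / N%:R) `^ al).

(** The increment splits into [k] whole meshes, where interpolation commutes with the shift, and a
    rest of at most one mesh, where the linear bound is below the power [al]. The two parts give the
    factor 2. *)
Lemma interp_at_hol1_le z i b c : b <= c ->
  `|interp_at f (set_coord z i c) - interp_at f (set_coord z i b)| <= 2 * H * (c - b) `^ al.
Proof.
move=> bc; set beta := c - b; have beta0 : 0 <= beta by rewrite subr_ge0.
pose k := `|Num.floor (N%:R * beta)|%N.
have kE : k%:Z = Num.floor (N%:R * beta).
  by rewrite /k gez0_abs// floor_ge0 mulr_ge0 ?(ltW NR).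
have /andP[k1 k2] := floor_itv (N%:R * beta); rewrite -kE in k1 k2.
have kR : k%:Z%:~R = k%:R :> R by rewrite -pmulrn.
rewrite intrD kR in k1 k2.
pose m := b + k%:Z%:~R / N%:R.
have kN : k%:R / N%:R <= beta by rewrite ler_pdivrMr// mulrC.
have mc : m <= c by rewrite /m kR; move: kN; rewrite /beta; lra.
have cm1 : N%:R * (c - m) <= 1.
  rewrite /m kR (_ : c - _ = beta - k%:R / N%:R); last by rewrite /beta; ring.
  rewrite mulrBr [X in _ - X]mulrC divfK ?gt_eqF//; lra.
have part1 : `|interp_at f (set_coord z i m) - interp_at f (set_coord z i b)| <= H * beta `^ al.
  rewrite /m set_coord_shift interp_at_shift -pinterpB; apply: interp_at_norm => x.
  apply: (@le_trans _ _ (H * (k%:R / N%:R) `^ al)).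
    have := f_hol x i k; rewrite /lattice_step -lattice_of_intMn//.
    by rewrite /dir_vec /= scale1r -scaler_nat natz.
  rewrite ler_wpM2l//; apply: ge0_ler_powR; rewrite ?nnegrE ?(ltW al0) ?divr_ge0//; exact: ltW.
have part2 : `|interp_at f (set_coord z i c) - interp_at f (set_coord z i m)| <= H * beta `^ al.
  have L0 : 0 <= H * (1%:R / N%:R) `^ al by rewrite mulr_ge0 ?powR_ge0.
  apply: le_trans (interp_at_lip z L0 (fun x => f_hol x i 1) mc cm1) _.
  set y := c - m; have y0 : 0 <= y by rewrite subr_ge0.
  rewrite mulrCA ler_wpM2l//.
  have yb : y <= beta.
    have kN0 : 0 <= k%:R / N%:R :> R by rewrite divr_ge0 ?(ltW NR).
    by rewrite /y /m kR /beta; lra.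
  apply: (@le_trans _ _ (y `^ al)); last first.
    by apply: ge0_ler_powR; rewrite ?nnegrE ?(ltW al0).
  have -> : y `^ al = (N%:R * y) `^ al * (1%:R / N%:R) `^ al.
    by rewrite -powRM ?mulr_ge0 ?divr_ge0 ?(ltW NR)//; congr (_ `^ _); field; rewrite gt_eqF.
  rewrite ler_wpM2r ?powR_ge0//.
  have [->|Ny] := eqVneq (N%:R * y) 0; first exact: powR_ge0.
  by apply: ger1_powR; rewrite ?(ltW al1)// lt_neqAle eq_sym Ny mulr_ge0// ltW.
rewrite -(subrKA (interp_at f (set_coord z i m))); apply: le_trans (ler_normD _ _) _.
by rewrite (_ : 2 * H * _ = H * beta `^ al + H * beta `^ al) ?lerD//; ring.
Qed.

Lemma interp_at_hol1 z i b c :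
  `|interp_at f (set_coord z i c) - interp_at f (set_coord z i b)| <= 2 * H * `|c - b| `^ al.
Proof.
have [bc|cb] := leP b c; first by rewrite (ger0_norm (x := c - b)) ?subr_ge0 ?interp_at_hol1_le.
rewrite distrC (distrC c b) (ger0_norm (x := b - c)) ?subr_ge0 ?(ltW cb)//.
by rewrite interp_at_hol1_le ?(ltW cb).
Qed.

(** Coordinates are replaced one at a time, each at a cost bounded through the full distance: hence
    the factor [n]. *)
Lemma interp_at_hol z w :
  `|interp_at f w - interp_at f z| <= n%:R * (2 * H * enorm (w - z) `^ al).
Proof.
pose path (s : seq 'I_n) : 'rV[R]_n := \row_j (if j \in s then w ord0 j else z ord0 j).
have key s : `|interp_at f (path s) - interp_at f z| <= (size s)%:R * (2 * H * enorm (w - z)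
  `^ al).
  elim: s => [|i s IH].
    rewrite (_ : path [::] = z) ?subrr ?normr0 ?mul0r//.
    by apply/rowP => j; rewrite mxE.
  have -> : path (i :: s) = set_coord (path s) i (w ord0 i).
    by apply/rowP => j; rewrite !mxE inE; case: eqVneq => [->|].
  have E : path s = set_coord (path s) i (path s ord0 i).
    by apply/rowP => j; rewrite !mxE; case: eqVneq => [->|].
  rewrite -(subrKA (interp_at f (path s))); apply: le_trans (ler_normD _ _) _.
  rewrite [(size _)%:R]/= -natr1 mulrDl mul1r addrC; apply: lerD => //.
  rewrite [X in _ - interp_at f X]E; apply: le_trans (interp_at_hol1 _ _ _ _) _.
  rewrite ler_wpM2l ?mulr_ge0//; apply: ge0_ler_powR; rewrite ?nnegrE ?(ltW al0) ?sqrtr_ge0//.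
  rewrite mxE; case: ifP => _; first by rewrite subrr normr0 sqrtr_ge0.
  rewrite -sqrtr_sqr ler_sqrt; last by rewrite sumr_ge0// => j _; rewrite sqr_ge0.
  by rewrite (bigD1 i) //= !mxE lerDl sumr_ge0// => j _; rewrite sqr_ge0.
have := key (enum 'I_n); rewrite size_enum_ord (_ : path _ = w)//.
by apply/rowP => j; rewrite mxE mem_enum.
Qed.

End Hoelder.

Lemma interp_at_periodic f z (k : 'rV[int]_n) : interp_at f (z + map_mx intr k) = interp_at f z.
Proof. exact: (interp_periodic (fun=> f) 0). Qed.

(** No minimizing translate is required: if the conclusion failed, some translate would be close
    enough to violate the hypothesis. *)
Lemma powR_inf_le (al tau F C : R) z w : 0 < al -> 0 <= tau -> 0 <= C ->
  (forall k : 'rV[int]_n, F <= C * Num.max tau (enorm (w - z + map_mx intr k)) `^ al) ->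
  F <= C * Num.max tau (torus_dist w z) `^ al.
Proof.
move=> al0 tau0; rewrite le_eqVlt => /predU1P[<-|C0] h.
  by have := h 0; rewrite !mul0r.
rewrite leNgt; apply/negP => hlt.
set m := Num.max tau (torus_dist w z) in hlt.
have m0 : 0 <= m by rewrite le_max tau0.
have FC : m `^ al < F / C by rewrite ltr_pdivlMr// mulrC.
have FC0 : 0 < F / C by apply: le_lt_trans FC; exact: powR_ge0.
have my : m < (F / C) `^ al^-1.
  rewrite -[ltLHS](powRr1 m0) -(mulfV (lt0r_neq0 al0)) powRrM.
  by apply: gt0_ltr_powR; rewrite ?nnegrE ?powR_ge0 ?invr_gt0 ?(ltW FC0).
have [k hk] : exists k, enorm (w - z + map_mx intr k) < (F / C) `^ al^-1.
  by apply: torus_dist_lt; apply: le_lt_trans my; rewrite le_max lexx orbT.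
have := h k; apply/negP; rewrite -ltNge mulrC -ltr_pdivlMr//.
have E : F / C = ((F / C) `^ al^-1) `^ al.
  by rewrite -powRrM mulVf ?lt0r_neq0// powRr1// ltW.
rewrite [ltRHS]E.
apply: gt0_ltr_powR; rewrite ?nnegrE ?powR_ge0 ?le_max ?tau0//.
by rewrite gt_max hk andbT; apply: le_lt_trans my; rewrite le_max lexx.
Qed.

End Interpolation.

Lemma enormN (R : realType) (n : nat) (z : 'rV[R]_n) : enorm (- z) = enorm z.
Proof. by rewrite /enorm; congr Num.sqrt; apply: eq_bigr => i _; rewrite mxE sqrrN. Qed.

Lemma torus_dist_sym (R : realType) (n : nat) (z y : 'rV[R]_n) :
  torus_dist z y = torus_dist y z.
Proof.
have le (p q : 'rV[R]_n) : torus_dist p q <= torus_dist q p.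
  apply: lb_le_inf; first by have [] := torus_lb q p.
  move=> _ [k _ <-]; apply: le_trans (torus_dist_le _ _ (- k)) _.
  by rewrite -enormN (_ : - _ = q - p + map_mx intr k)// map_mxN opprD opprB opprK.
by apply/eqP; rewrite eq_le !le.
Qed.

(** [f] and [h] stand for two time slices at parabolic distance [tau]. Periodicity gives the
    estimate for every translate before the infimum is taken. *)
Lemma interp_at_dist (R : realType) (N n : nat) (al H tau : R) (f h : lattice N n -> R)
    (z w : 'rV[R]_n) : (0 < N)%N -> 0 < al -> al < 1 -> 0 <= H -> 0 <= tau ->
  (forall x i (k : nat), `|f (x + lattice_step N (i, true) *+ k) - f x| <= H * (k%:R / N%:R)
    `^ al) ->
  (forall x, `|f x - h x| <= H * tau `^ al) ->
  `|interp_at f z - interp_at h w| <=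
    ((2 * n%:R + 1) * H) * Num.max tau (torus_dist z w) `^ al.
Proof.
move=> N0 al0 al1 H0 tau0 fH fh.
apply: powR_inf_le => //; first by rewrite mulr_ge0// addr_ge0// mulr_ge0.
move=> k; set m := Num.max _ _.
have m1 : tau `^ al <= m `^ al.
  by apply: ge0_ler_powR; rewrite ?nnegrE ?(ltW al0)// le_max ?lexx ?tau0.
have m2 : enorm (z - w + map_mx intr k) `^ al <= m `^ al.
  by apply: ge0_ler_powR; rewrite ?nnegrE ?(ltW al0) ?sqrtr_ge0// le_max ?lexx ?tau0 ?orbT.
rewrite -(interp_at_periodic N0 f z k) -(subrKA (interp_at f w)).
apply: le_trans (ler_normD _ _) _.
rewrite (_ : _ * _ = n%:R * (2 * H * m `^ al) + H * m `^ al); last by ring.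
apply: lerD.
  apply: le_trans (interp_at_hol N0 al0 al1 H0 fH w (z + map_mx intr k)) _.
  by rewrite addrAC ler_wpM2l// ler_wpM2l// mulr_ge0.
rewrite -pinterpB; apply: le_trans (interp_at_norm _ fh) _.
by rewrite ler_wpM2l.
Qed.

(** * From lattice estimates to the norms of the interpolation *)

Lemma gen_generator (R : realType) (N n : nat) (a : conductance N n) (f : lattice N n -> R) x :
  gen N%:R (@lattice_step N n) a f x = generator a f x.
Proof.
rewrite /gen /generator expr2 -mulrA; congr (_ * _); rewrite mulr_sumr.
by apply: eq_bigr => e _; rewrite /nabla mulrCA.
Qed.

Lemma weighted_quot (R : realType) (p q r K al : R) : 0 <= p -> 0 <= K -> p * q <= K * r `^
  al ->
  p * (q / r `^ al) <= K.
Proof.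
move=> p0 K0 h; have [->|r0] := eqVneq (r `^ al) 0; first by rewrite invr0 !mulr0.
by rewrite mulrA ler_pdivrMr// lt_neqAle eq_sym r0 powR_ge0.
Qed.

Theorem theorem4p1 (R : realType) (n : nat) (cm cp T alpha : R)
    (n_gt0 : (0 < n)%N) (cm_gt0 : 0 < cm) (cm_lt_cp : cm < cp)
    (T_gt0 : 0 < T) (alpha_gt0 : 0 < alpha) (alpha_lt1 : alpha < 1) :
  exists C : R, 0 < C /\
  forall (A G : R)
    (a : forall N : nat, R -> lattice N n -> dir n -> R)
    (g u : forall N : nat, R -> lattice N n -> R),
  (forall N, (0 < N)%N ->
     [/\ forall x e, {within `[0, T], continuous (fun t => a N t x e)},
         forall x, {within `[0, T], continuous (fun t => g N t x)} &
         solves T (a N) (g N) (u N)]) ->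
  (forall N, (0 < N)%N -> forall t, t \in `[0, T] -> elliptic cm cp (a N t)) ->
  (forall N, (0 < N)%N -> forall e, (coef_seminorm T alpha (a N) e <= A%:E)%E) ->
  (forall N, (0 < N)%N -> (sup_norm T (g N) <= G%:E)%E) ->
  (ereal_sup [set sup_norm T (u N) | N in [set N | (0 < N)%N]] < +oo)%E ->
  forall N, (0 < N)%N ->
    (full_norm T alpha (u N) <=
       C%:E * (((A + 1) `^ (1 + alpha^-1))%:E * sup_norm T (u N) + G%:E))%E /\
    (forall (e : dir n) (t : R) (x : lattice N n), 0 < t <= T ->
       (`|lattice_grad e (u N t) x|%:E <=
         (C * t `^ (- 2^-1))%:E *
           (((A + 1) `^ alpha^-1)%:E * sup_norm T (u N)
            + ((A + 1)^-1 * G)%:E))%E).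
Proof.
have cp0 : 0 <= cp by exact: ltW (lt_trans cm_gt0 cm_lt_cp).
pose c1 : R := 2 * n%:R * cp.
have c10 : 0 <= c1 by rewrite !mulr_ge0.
pose Ch := weighted_const (n := n) cm cp c1 alpha T; pose Cg := grad_const (n := n) cm c1
  alpha T.
have Ch0 : 0 <= Ch by exact: weighted_const_ge0.
have Cg0 : 0 <= Cg by exact: grad_const_ge0.
(* [2 * n + 1] comes from the gradient seminorm, one more [Ch] from the time seminorm, [Cg] from the
   weighted gradient; the last 1 makes [C] positive. *)
pose C := (2 * n%:R + 2) * Ch + Cg + 1.
have C0 : 0 < C by rewrite ltr_wpDl// addr_ge0// mulr_ge0// addr_ge0// mulr_ge0.
exists C; split=> // A G a g u hsol hell hcoef hg hu N N0.
have [_ _ usol] := hsol N N0.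
have T0I : T \in `[0, T] by rewrite in_itv /= lexx ltW.
have O0I : 0 \in `[0, T] by rewrite in_itv /= lexx ltW.
(* [A] bounds a supremum of nonnegative numbers; a direction exists as [n > 0], and two distinct
   points as [T > 0]. *)
have A0 : 0 <= A.
  rewrite -lee_fin; apply: le_trans (hcoef N N0 (Ordinal n_gt0, true)).
  apply: (@le_trans _ _ (Num.min (st_d (embed (T, 0 : lattice N n))) (st_d (embed (0 : R, 0 :
    lattice N n))) `^ alpha *
     (`|a N T 0 (Ordinal n_gt0, true) - a N 0 0 (Ordinal n_gt0, true)| /
      st_dist (embed (T, 0 : lattice N n)) (embed (0, 0 : lattice N n)) `^ alpha))%:E).
    by rewrite lee_fin mulr_ge0 ?powR_ge0// divr_ge0 ?powR_ge0.
  apply: ereal_sup_ubound; exists (T, 0), (0, 0); split => //.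
  by move=> [/eqP]; rewrite gt_eqF.
have gb (s : R) x : s \in `[0, T] -> `|g N s x| <= G by exact: sup_norm_le (hg N N0).
have G0 : 0 <= G by apply: le_trans (gb 0 0 O0I).
have uinf : (sup_norm T (u N) < +oo)%E.
  by apply: le_lt_trans hu; apply: ereal_sup_ubound; exists N.
have unonneg : (0 <= sup_norm T (u N))%E.
  apply: (@le_trans _ _ (`|u N 0 0|%:E)); first by rewrite lee_fin.
  by apply: ereal_sup_ubound; exists (0, 0).
have ufin : sup_norm T (u N) \is a fin_num by rewrite ge0_fin_numE.
set U := fine (sup_norm T (u N)).
have UE : sup_norm T (u N) = U%:E by rewrite fineK.
have U0 : 0 <= U by rewrite fine_ge0.
have ub (s : R) x : s \in `[0, T] -> `|u N s x| <= U.
  by apply: sup_norm_le; rewrite UE.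
have NR : 0 < N%:R :> R by rewrite ltr0n.
have oc (s : R) : s \in `]0, T] -> s \in `[0, T].
  by rewrite !in_itv /= => /andP[/ltW -> ->].
have oo (s : R) : s \in `]0, T[ -> s \in `[0, T].
  by rewrite !in_itv /= => /andP[/ltW -> /ltW ->].
have asym (s : R) x e : s \in `[0, T] -> a N s x e = a N s (x + lattice_step N e) (dir_opp e).
  by move=> sI; have [h _] := hell N N0 s sI; exact: h.
have aell (s : R) x e : s \in `[0, T] -> cm <= a N s x e <= cp.
  by move=> sI; have [_ h] := hell N N0 s sI; exact: h.
have ahol (s t : R) x y i : s \in `]0, T] -> t \in `]0, T] ->
    Num.min (Num.sqrt s) (Num.sqrt t) `^ alpha * `|a N s y (i, true) - a N t x (i, true)| <=
    A * (`|s - t| + lattice_sqdist x y) `^ (alpha / 2).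
  by move=> sI tI; apply: coef_seminorm_le (oc _ sI) (oc _ tI) => //; exact: hcoef.
have uder (s : R) x : s \in `]0, T[ ->
    is_derive s (1 : R) (fun s => u N s x) (gen N%:R (@lattice_step N n) (a N s) (u N s) x +
      g N s x).
  by move=> sI; rewrite gen_generator; apply: within_derive (sI) _; apply: usol; exact: oo.
have uleft (t : R) x : t \in `]0, T] -> u N s x @[s --> t^'-] --> u N t x.
  by move=> tI; apply: within_left (tI) (usol t x (oc _ tI)).
have psil b x y := @lattice_sqdist_lap R N n cp b x y N0 cp0.
have eo (e : dir n) := lattice_step_opp e N0.
pose W := data_size alpha A G U; pose M := Mgrad (n := n) cm c1 alpha T A G U.
have W0 : 0 <= W by rewrite addr_ge0// mulr_ge0// powR_ge0.
have hM (t : R) x e : t \in `]0, T] -> Num.sqrt t * `|lattice_grad e (u N t) x| <= M.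
  move=> tI; exact: (grad_bound NR eo cm_gt0 c10 alpha_gt0 alpha_lt1 T_gt0 (@lpsi0 R N n)
    (fun x y => sqr_ge0 _) psil A0 G0 U0 asym aell ahol ub gb uder uleft x e tI).
have hS (t : R) x e i (k : nat) : t \in `]0, T] -> Num.sqrt t `^ (1 + alpha) *
    `|lattice_grad e (u N t) (x + lattice_step N (i, true) *+ k) - lattice_grad e (u N t) x| <=
    Ch * W * (k%:R / N%:R) `^ alpha.
  move=> tI; exact: (weighted_space NR eo cm_gt0 cp0 c10 alpha_gt0 alpha_lt1 T_gt0 (@lpsi0 R
    N n)
    (fun x y => sqr_ge0 _) psil (fun x i k => lattice_sqdist_step x i k N0) A0 G0 U0
    asym aell ahol ub gb uder uleft x e i k tI).
have hT (t s : R) x e : s \in `]0, T] -> t \in `]0, T] -> s <= t ->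
    Num.sqrt s `^ (1 + alpha) * `|lattice_grad e (u N t) x - lattice_grad e (u N s) x| <=
    Ch * W * Num.sqrt (t - s) `^ alpha.
  move=> sI tI st; exact: (weighted_grad_time NR eo cm_gt0 cp0 c10 alpha_gt0 alpha_lt1 T_gt0
    (@lpsi0 R N n) (fun x y => sqr_ge0 _) psil A0 G0 U0
    asym aell ahol ub gb uder uleft x e sI tI st).
have hV (t s : R) x : s \in `]0, T] -> t \in `]0, T] -> s <= t ->
    Num.sqrt s `^ (1 + alpha) * `|u N t x - u N s x| <=
    Ch * W * Num.sqrt (t - s) `^ (1 + alpha).
  move=> sI tI st; exact: (weighted_value_time NR eo cm_gt0 cp0 c10 alpha_gt0 alpha_lt1 T_gt0
    (@lpsi0 R N n) (fun x y => sqr_ge0 _) psil A0 G0 U0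
    asym aell ahol ub gb uder uleft x sI tI st).
have ChW : 0 <= Ch * W by rewrite mulr_ge0.
have sq0 (s : R) : s \in `]0, T] -> 0 < Num.sqrt s.
  by rewrite in_itv /= sqrtr_gt0 => /andP[].
have hG (t s : R) z w e : s \in `]0, T] -> t \in `]0, T] -> s <= t ->
    Num.sqrt s `^ (1 + alpha) * `|cont_grad N e (interp (u N)) (t, z) -
      cont_grad N e (interp (u N)) (s, w)| <=
    (2 * n%:R + 1) * (Ch * W) * st_dist (t, z) (s, w) `^ alpha.
  move=> sI tI st; have p0 := powR_gt0 (1 + alpha) (sq0 s sI).
  (* The space bound at the later time [t] has the larger weight, so it also holds with the weight
     at [s]. *)
  have pt : Num.sqrt s `^ (1 + alpha) <= Num.sqrt t `^ (1 + alpha).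
    by apply: ge0_ler_powR; rewrite ?nnegrE ?sqrtr_ge0 ?ler_wsqrtr// addr_ge0// ltW.
  have H0 : 0 <= Ch * W / Num.sqrt s `^ (1 + alpha) by rewrite divr_ge0// ltW.
  rewrite !cont_grad_interp//.
  have ts0 : 0 <= t - s by rewrite subr_ge0.
  rewrite /st_dist /= (ger0_norm ts0).
  have h := @interp_at_dist R N n alpha (Ch * W / Num.sqrt s `^ (1 + alpha)) (Num.sqrt (t - s))
    (lattice_grad e (u N t)) (lattice_grad e (u N s)) z w N0 alpha_gt0 alpha_lt1 H0
      (sqrtr_ge0 _).
  rewrite mulrC -ler_pdivlMr//; apply: le_trans (h _ _) _.
  - move=> x i k; rewrite mulrAC ler_pdivlMr// mulrC; apply: le_trans (hS t x e i k tI).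
    by rewrite ler_wpM2r.
  - by move=> x; rewrite mulrAC ler_pdivlMr// mulrC; exact: hT.
  by rewrite le_eqVlt; apply/orP; left; apply/eqP; field; rewrite gt_eqF.
(* At time 0 the weights vanish, so only positive times have to be estimated. *)
have itv0 (s : R) : s \in `[0, T] -> s = 0 \/ s \in `]0, T].
  rewrite !in_itv /= => /andP[s0 ->]; rewrite andbT.
  by move: s0; rewrite le_eqVlt => /predU1P[<-|->]; [left|right].
have K0 : 0 <= (2 * n%:R + 1) * (Ch * W).
  by rewrite (mulr_ge0 _ ChW)// addr_ge0// mulr_ge0.
have p10 : 1 + alpha != 0 by rewrite gt_eqF// addr_gt0.
have B1 : (grad_seminorm N T alpha (interp (u N)) <= ((2 * n%:R + 1) * (Ch * W))%:E)%E.
  apply: ge_ereal_sup => _ [[t z] [[s w] [/= tI sI _ ->]]]; rewrite lee_fin.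
  apply: weighted_quot; rewrite ?powR_ge0 ?K0//.
  set p := _ `^ (1 + alpha); set d := st_dist _ _.
  have Kd : 0 <= (2 * n%:R + 1) * (Ch * W) * d `^ alpha.
    by rewrite (mulr_ge0 K0)// powR_ge0.
  have each e : p * `|cont_grad N e (interp (u N)) (t, z) - cont_grad N e (interp (u N)) (s, w)|
      <= (2 * n%:R + 1) * (Ch * W) * d `^ alpha.
    have [t0|t0] := itv0 t tI.
      suff -> : p = 0 by rewrite mul0r.
      by rewrite /p /st_d /= t0 sqrtr0 min_l ?sqrtr_ge0// powR0.
    have [s0|s0] := itv0 s sI.
      suff -> : p = 0 by rewrite mul0r.
      by rewrite /p /st_d /= s0 sqrtr0 min_r ?sqrtr_ge0// powR0.
    rewrite /p /d /st_d /=.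
    have [st|ts] := leP s t.
      by rewrite min_r ?ler_wsqrtr//; exact: hG.
    rewrite min_l ?ler_wsqrtr ?(ltW ts)// distrC.
    have -> : st_dist (t, z) (s, w) = st_dist (s, w) (t, z).
      by rewrite /st_dist /= distrC torus_dist_sym.
    by apply: hG => //; exact: ltW.
  (* After division by the weight the bound passes to the maximum over directions. *)
  have [p00|p0] := eqVneq p 0; first by rewrite p00 mul0r.
  have pp : 0 < p by rewrite lt_neqAle eq_sym p0 powR_ge0.
  rewrite mulrC -ler_pdivlMr//; apply: bigmax_le; first by rewrite divr_ge0 ?(ltW pp).
  by move=> e _; rewrite ler_pdivlMr// mulrC; exact: each.
have B2 : (time_seminorm T alpha (u N) <= (Ch * W)%:E)%E.
  apply: ge_ereal_sup => _ [t [s [x [tI sI ts ->]]]]; rewrite lee_fin.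
  rewrite /st_d /= [(1 + alpha) / 2]mulrC.
  have -> : `|t - s| `^ (2^-1 * (1 + alpha)) = Num.sqrt `|t - s| `^ (1 + alpha).
    by rewrite powRrM powR12_sqrt.
  apply: weighted_quot; rewrite ?powR_ge0 ?ChW//.
  have [t0|t0] := itv0 t tI.
    by rewrite t0 sqrtr0 min_l ?sqrtr_ge0// powR0// mul0r (mulr_ge0 ChW)// powR_ge0.
  have [s0|s0] := itv0 s sI.
    by rewrite s0 sqrtr0 min_r ?sqrtr_ge0// powR0// mul0r (mulr_ge0 ChW)// powR_ge0.
  have [st|st] := leP s t.
    by rewrite min_r ?ler_wsqrtr// (ger0_norm (x := t - s)) ?subr_ge0//; exact: hV.
  rewrite min_l ?ler_wsqrtr ?(ltW st)// distrC (distrC t) (ger0_norm (x := s - t)) ?subr_ge0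
    ?(ltW st)//.
  by apply: hV => //; exact: ltW.
have AA : 0 < A + 1 by rewrite ltr_wpDl.
have M0 : 0 <= M.
  by rewrite mulr_ge0// addr_ge0// mulr_ge0 ?powR_ge0 ?invr_ge0 ?(ltW AA).
have MW : M <= Cg * W.
  apply: le_trans (AMgrad_le (n := n) cm c1 alpha T G U A0).
  by rewrite ler_peMl// lerDr.
have B3 : (grad_sup N T (interp (u N)) <= (Cg * W)%:E)%E.
  apply: bigmax_le => [|e _]; first exact: leNye.
  apply: ge_ereal_sup => _ [[t z] /= tI <-]; rewrite lee_fin /st_d /=; apply: le_trans MW.
  have [->|t0] := itv0 t tI; first by rewrite sqrtr0 mul0r.
  have q0 := sq0 t t0; rewrite cont_grad_interp// mulrC -ler_pdivlMr//.
  by apply: interp_at_norm => x; rewrite ler_pdivlMr// mulrC; exact: hM.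
split.
  apply: le_trans (leeD (leeD B1 B2) B3) _.
  rewrite UE -!EFinM -!EFinD lee_fin -/(data_size alpha A G U) -/W.
  rewrite [leLHS](_ : _ = ((2 * n%:R + 2) * Ch + Cg) * W); last by ring.
  by rewrite ler_wpM2r// lerDl.
move=> e t x /andP[t0 tT]; have tI : t \in `]0, T] by rewrite in_itv /= t0.
rewrite UE -!EFinM lee_fin powRN powR12_sqrt ?(ltW t0)// mulrAC ler_pdivlMr ?sq0//.
rewrite mulrC; apply: le_trans (hM t x e tI) _.
rewrite /M /Mgrad ler_wpM2r//.
  by rewrite addr_ge0// mulr_ge0 ?powR_ge0 ?invr_ge0 ?(ltW AA).
have : 0 <= (2 * n%:R + 2) * Ch by rewrite mulr_ge0// addr_ge0// mulr_ge0.
by rewrite -/Cg /C; lra.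
Qed.
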